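(* Let $\boldsymbol{F}\in L^2(\mathbb{R}^2_+)^{2\times 2}$ and assume that there is a weak solution $\bar{\boldsymbol{u}}\in\dot H^1_{0,\sigma}(\mathbb{R}^2_+)$ to the stationary Navier-Stokes equations with forcing $\boldsymbol{F}$ which satisfies the energy inequality $$\|\nabla\bar{\boldsymbol{u}}\|^2_{L^2(\mathbb{R}^2_+)}\le\langle\nabla\bar{\boldsymbol{u}},\boldsymbol{F}\rangle_{L^2(\mathbb{R}^2_+)}$$ and one of the following conditions: (i) There is $i\in\{0,1,2\}$ such that $\bar{\boldsymbol{u}}\in L^\infty(\mathbb{R}^2_+,\omega_i^{1/2})$ and $\|\bar{\boldsymbol{u}}\|_{L^\infty(\mathbb{R}^2_+,\omega_i^{1/2})}<1/4$. (ii) $\bar{\boldsymbol{u}}\in\mathcal{X}$ and $\left(\int_0^\infty x_2\|\bar{\boldsymbol{u}}(\cdot,x_2)\|_{L^\infty(\mathbb{R})}^2\,dx_2\right)^{1/2}<1$. Then for every weak solution $\boldsymbol{u}\in\dot H^1_{0,\sigma}(\mathbb{R}^2_+)$ to the same equations (with the same $\boldsymbol{F}$) satisfying $\|\nabla\boldsymbol{u}\|^2_{L^2(\mathbb{R}^2_+)}\le\langle\nabla\boldsymbol{u},\boldsymbol{F}\rangle_{L^2(\mathbb{R}^2_+)}$, we have $\boldsymbol{u}=\bar{\boldsymbol{u}}$.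
   Context: Let $\mathbb{R}^2_+=\{\boldsymbol{x}=(x_1,x_2)\in\mathbb{R}^2: x_2>0\}$. Let $C^\infty_{c,\sigma}(\mathbb{R}^2_+)$ be the set of compactly supported smooth vector fields $\boldsymbol{\varphi}:\mathbb{R}^2_+\to\mathbb{R}^2$ with $\nabla\cdot\boldsymbol{\varphi}=0$. The homogeneous Sobolev space is $\dot H^1(\mathbb{R}^2_+)=\{u\in L^1_{\mathrm{loc}}(\mathbb{R}^2_+):\nabla u\in L^2(\mathbb{R}^2_+)\}$ with semi-norm $\|\nabla u\|_{L^2(\mathbb{R}^2_+)}$. $\dot H^1_{0,\sigma}(\mathbb{R}^2_+)$ denotes the completion of $C^\infty_{c,\sigma}(\mathbb{R}^2_+)$ in $\dot H^1(\mathbb{R}^2_+)\times\dot H^1(\mathbb{R}^2_+)$; by Hardy's inequality the semi-norm is a norm on it, and its elements are identified with functions (limits $\boldsymbol v$ of sequences $\boldsymbol\varphi_k\in C^\infty_{c,\sigma}(\mathbb{R}^2_+)$ with $\nabla\boldsymbol\varphi_k\to\nabla\boldsymbol v$ in $L^2$ and $\boldsymbol\varphi_k\to\boldsymbol v$ in $L^2_{\mathrm{loc}}$). The equations are $-\Delta\boldsymbol{u}+(\boldsymbol{u}\cdot\nabla)\boldsymbol{u}+\nabla P+\operatorname{div}(\boldsymbol{F})=0$, $\nabla\cdot\boldsymbol{u}=0$ in $\mathbb{R}^2_+$, $\boldsymbol{u}=0$ on $\partial\mathbb{R}^2_+$. For $\boldsymbol{F}=(\boldsymbol{F}_1,\boldsymbol{F}_2)\in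 L^2(\mathbb{R}^2_+)^{2\times2}$ with $\boldsymbol{F}_i=(F_{i1},F_{i2})$, a vector field $\boldsymbol{u}=(u_1,u_2)\in\dot H^1_{0,\sigma}(\mathbb{R}^2_+)$ is a weak solution if $$\sum_{i=1}^2\int_{\mathbb{R}^2_+}\big(\nabla u_i\cdot\nabla\varphi_i+(\boldsymbol{u}\cdot\nabla)u_i\,\varphi_i\big)\,d\boldsymbol{x}=\sum_{i=1}^2\int_{\mathbb{R}^2_+}\boldsymbol{F}_i\cdot\nabla\varphi_i\,d\boldsymbol{x}$$ for all $\boldsymbol{\varphi}=(\varphi_1,\varphi_2)\in C^\infty_{c,\sigma}(\mathbb{R}^2_+)$. Here $\langle\nabla\boldsymbol{u},\boldsymbol{F}\rangle_{L^2(\mathbb{R}^2_+)}=\sum_{i=1}^2\int_{\mathbb{R}^2_+}\nabla u_i\cdot\boldsymbol{F}_i\,d\boldsymbol{x}$. Weights: $\omega_0(\boldsymbol{x})=\frac{|x_2|^2|\boldsymbol{x}|}{|x_2|+4|\boldsymbol{x}|}$, $\omega_1(\boldsymbol{x})=|x_2||\boldsymbol{x}|$, $\omega_2(\boldsymbol{x})=|x_2|^2/4$. For a weight $\mu$, $L^\infty(\mathbb{R}^2_+,\mu)$ is the space of functions with finite norm $\|f\|_{L^\infty(\mathbb{R}^2_+,\mu)}=\operatorname{ess\,sup}_{\boldsymbol{x}\in\mathbb{R}^2_+}|f(\boldsymbol{x})\mu(\boldsymbol{x})|$. $\mathcal{X}=\big\{\boldsymbol{v}\in\dot H^1_{0,\sigma}(\mathbb{R}^2_+):\int_0^\infty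 x_2\|\boldsymbol{v}(\cdot,x_2)\|_{L^\infty(\mathbb{R})}^2\,dx_2<\infty\big\}$. *)

(* Defs.v *)
From HB Require Import structures.
From mathcomp Require Import all_boot all_order all_algebra.
From mathcomp Require Import all_classical all_reals all_analysis.
Import Order.TTheory GRing.Theory Num.Theory.
Import numFieldNormedType.Exports.

Set Implicit Arguments.
Unset Strict Implicit.
Unset Printing Implicit Defensive.

Local Open Scope classical_set_scope.
Local Open Scope ring_scope.

(* Scalar functions on the half-plane are represented by total functions on
   R * R whose values off [half_plane] are irrelevant; vector fields are
   families indexed by 'I_2, the matrix field F has entries F i j.  Indices are
   shifted by one, so that x.1, x.2 are the coordinates 0 and 1.  Functions are
   Borel representatives of their almost-everywhere classes. *)

Definition lebesgue_plane (R : realType) :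
    {measure set (measurableTypeR R * measurableTypeR R) -> \bar R} :=
  (@lebesgue_measure R \x @lebesgue_measure R)%E.

Definition half_plane (R : realType) : set (R * R) := [set x | 0 < x.2].
Arguments half_plane {R}.

(* The norm of the library on R * R is the sup norm, hence these two. *)
Definition euclid_norm (R : realType) (x : R * R) : R :=
  Num.sqrt (x.1 ^+ 2 + x.2 ^+ 2).

Definition field_norm (R : realType) (v : 'I_2 -> R * R -> R) (x : R * R) : R :=
  Num.sqrt (\sum_(i < 2) v i x ^+ 2).

Definition partial (R : realType) (j : 'I_2) (f : R * R -> R) : R * R -> R :=
  fun x => 'D_(((j == 0)%:R, (j == 1)%:R) : R * R) f x.

Definition smooth (R : realType) (f : R * R -> R) : Prop :=
  forall s : seq 'I_2,
    let g := foldr (@partial R) f s in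
    continuous g /\
    forall (j : 'I_2) (x : R * R),
      derivable g x (((j == 0)%:R, (j == 1)%:R) : R * R).

(* Test functions on the half-plane, extended by zero to the plane. *)
Definition test_function (R : realType) (f : R * R -> R) : Prop :=
  [/\ smooth f,
      compact (closure [set x : R * R | f x != 0]) &
      closure [set x : R * R | f x != 0] `<=` half_plane].

Definition solenoidal_test_field (R : realType) (phi : 'I_2 -> R * R -> R) :
    Prop :=
  (forall i, test_function (phi i)) /\
  (forall x, \sum_(j < 2) partial j (phi j) x = 0).

Definition L1loc (R : realType) (f : R * R -> R) : Prop :=
  forall K : set (R * R), compact K -> K `<=` half_plane ->
    (lebesgue_plane R).-integrable K (EFin \o f).

Definition L2 (R : realType) (f : R * R -> R) : Prop :=
  (f \_ half_plane) \in Lfun (lebesgue_plane R) 2%:E.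

Definition is_weak_partial (R : realType) (j : 'I_2) (f g : R * R -> R) : Prop :=
  L1loc g /\
  forall psi : R * R -> R, test_function psi ->
    \int[lebesgue_plane R]_(x in half_plane) (f x * partial j psi x) =
    - \int[lebesgue_plane R]_(x in half_plane) (g x * psi x).

(* A chosen representative; zero when there is no weak derivative. *)
Definition weak_partial (R : realType) (j : 'I_2) (f : R * R -> R) :
    R * R -> R :=
  xget (fun=> 0) [set g | is_weak_partial j f g].

Definition H1dot (R : realType) (f : R * R -> R) : Prop :=
  L1loc f /\
  forall j : 'I_2,
    (exists g, is_weak_partial j f g) /\ L2 (weak_partial j f).

Definition H1dot0sigma (R : realType) (v : 'I_2 -> R * R -> R) : Prop :=
  (forall i, H1dot (v i)) /\
  exists phi : nat -> 'I_2 -> R * R -> R,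
    [/\ forall k, solenoidal_test_field (phi k),
        forall i j : 'I_2,
          ('N[lebesgue_plane R]_2%:E
            [EFin \o ((partial j (phi k i) \- weak_partial j (v i))%R
                        \_ half_plane)])%E
            @[k --> \oo] --> 0%E &
        forall (i : 'I_2) (K : set (R * R)),
          compact K -> K `<=` half_plane ->
          ('N[lebesgue_plane R]_2%:E [EFin \o ((phi k i \- v i)%R \_ K)])%E
            @[k --> \oo] --> 0%E].

Definition weak_solution (R : realType) (F : 'I_2 -> 'I_2 -> R * R -> R)
    (u : 'I_2 -> R * R -> R) : Prop :=
  H1dot0sigma u /\
  forall phi : 'I_2 -> R * R -> R, solenoidal_test_field phi ->
    \sum_(i < 2) \int[lebesgue_plane R]_(x in half_plane)
      ((\sum_(j < 2) weak_partial j (u i) x * partial j (phi i) x) +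
       (\sum_(j < 2) u j x * weak_partial j (u i) x) * phi i x) =
    \sum_(i < 2) \int[lebesgue_plane R]_(x in half_plane)
      (\sum_(j < 2) F i j x * partial j (phi i) x).

Definition grad_pairing (R : realType) (u : 'I_2 -> R * R -> R)
    (F : 'I_2 -> 'I_2 -> R * R -> R) : R :=
  \sum_(i < 2) \int[lebesgue_plane R]_(x in half_plane)
    (\sum_(j < 2) weak_partial j (u i) x * F i j x).

Definition energy_inequality (R : realType) (F : 'I_2 -> 'I_2 -> R * R -> R)
    (u : 'I_2 -> R * R -> R) : Prop :=
  \int[lebesgue_plane R]_(x in half_plane)
    (\sum_(i < 2) \sum_(j < 2) weak_partial j (u i) x ^+ 2)
  <= grad_pairing u F.

Definition omega (R : realType) (i : 'I_3) (x : R * R) : R :=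
  match val i with
  | 0%N => `|x.2| ^+ 2 * euclid_norm x / (`|x.2| + 4 * euclid_norm x)
  | 1%N => `|x.2| * euclid_norm x
  | _ => `|x.2| ^+ 2 / 4
  end.

Definition weighted_Linfty (R : realType) (mu : R * R -> R)
    (v : 'I_2 -> R * R -> R) : Prop :=
  ((fun x => field_norm v x * mu x) \_ half_plane)
    \in Lfun (lebesgue_plane R) +oo%E.

Definition weighted_Linfty_norm (R : realType) (mu : R * R -> R)
    (v : 'I_2 -> R * R -> R) : \bar R :=
  ('N[lebesgue_plane R]_+oo
    [EFin \o ((fun x => field_norm v x * mu x)%R \_ half_plane)])%E.

Definition X_norm_sq (R : realType) (v : 'I_2 -> R * R -> R) : \bar R :=
  (\int[@lebesgue_measure R]_(x2 in `]0%R, +oo[)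
    (x2%:E *
     'N[@lebesgue_measure R]_+oo [(fun x1 => (field_norm v (x1, x2))%:E)] ^+ 2))%E.

Definition X_space (R : realType) (v : 'I_2 -> R * R -> R) : Prop :=
  H1dot0sigma v /\ (X_norm_sq v < +oo)%E.

(* Main.v *)
(** Write w = u - ubar.  Once ubar may be used as a test field in the equation
    for u, the two energy inequalities and the two tested equations combine to
    |grad w|^2 <= int (w . grad) w . ubar.  Both smallness conditions give a
    majorant |ubar x| <= m x.2 with int (m x.2)^2 f^2 <= 5/4 int (d_2 f)^2:
    under (i) because all three weights are at least x_2^2 / 5, by Hardy's
    inequality; under (ii) because f^2 <= x_2 int (d_2 f)^2 on vertical lines.
    As div w = 0, the norms of d_1 w_1 and d_2 w_2 agree, and a weighted Young
    inequality absorbs the constant 5/4, although it exceeds 1.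

    To test with ubar, let phi_k be solenoidal test fields converging to it,
    with stream functions psi_k.  The convective term is only controlled with
    a weight 1 / x_2, so phi_k is replaced by the curl of E_t psi_k, where
    E_t = exp (- t log^2 (1 + x_2^2)); first k tends to infinity, then t to 0.
    The error terms vanish because int_1^X m grows at most logarithmically,
    hence so does the limit stream function. *)

Require Import Defs.
From HB Require Import structures.
From mathcomp Require Import all_boot all_order all_algebra.
From mathcomp Require Import all_classical all_reals all_analysis.
From mathcomp Require Import ring lra measurable_realfun ess_sup_inf.
Import Order.TTheory GRing.Theory Num.Theory.
Import numFieldNormedType.Exports.
Local Open Scope classical_set_scope.
Local Open Scope ring_scope.
Set Implicit Arguments.
Unset Strict Implicit.
Unset Printing Implicit Defensive.

(** Only one of the two tested equations needs the cutoff. A product with [ubar] is harmless: [ubar]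
    is dominated by [m], and multiplication by [m] maps limits of test fields into L2, so [u] can be
    inserted directly into the equation for [ubar]. In the equation for [u] the test fields inherit
    no bound from their limit, and only u_j phi_k / x_2 converges in L2. The cutoff must therefore
    absorb a factor x_2 while k tends to infinity. Afterwards it may disappear, because u_j ubar_i
    is in L2 by the bound on [ubar]. Cutting off the stream function instead of the field keeps the
    divergence zero, at the price of a term E_t' Psi, where Psi may grow like a logarithm. With a
    cutoff at a single scale, x_2 E' is bounded but x_2 E' Psi is not. The squared logarithm in the
    exponent makes x_2 E_t' (1 + log (1 + x_2^2)) bounded uniformly in t, so dominated convergence
    disposes of this term. The second derivative of the cutoff meets Psi only through Psi / x_2^2,
    which is in L2 by applying Hardy's inequality twice. *)

Local Notation plane R := (measurableTypeR R * measurableTypeR R)%type.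
Local Notation vfield R := ('I_2 -> R * R -> R)%type.
Local Notation mfun_half :=
  (measurable_fun (half_plane : set (measurableTypeR _ * measurableTypeR _))).
Local Notation mfun_pos :=
  (measurable_fun (`]0%R, +oo[%classic : set (measurableTypeR _))).

(** * Real L2 functions *)

Section L2kit.
Context {d : measure_display} {T : measurableType d} {R : realType}.
Variables (mu : {measure set T -> \bar R}) (D : set T).
Hypothesis mD : measurable D.
Implicit Types f g h : T -> R.
Implicit Types fs gs : nat -> T -> R.

Definition inL2 f := measurable_fun D f /\
  (\int[mu]_(x in D) (f x ^+ 2)%:E < +oo)%E.

(** [Rintegral] takes the [fine] part of an integral, hence the [inL2] hypotheses in the bilinearity
    lemmas below. *)
Definition inner f g : R := \int[mu]_(x in D) (f x * g x).

Lemma inL2_sq f : inL2 f -> mu.-integrable D (EFin \o (fun x => f x ^+ 2)).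
Proof.
move=> [mf fi]; apply/integrableP; split.
  by apply/measurable_EFinP; exact: measurable_funX.
by under eq_integral do rewrite /= ger0_norm ?sqr_ge0//.
Qed.

Lemma inL2_mul f g : inL2 f -> inL2 g ->
  mu.-integrable D (EFin \o (fun x => f x * g x)).
Proof.
move=> If Ig.
have h := integrableD mD (inL2_sq If) (inL2_sq Ig).
apply: (le_integrable mD _ _ h).
  by apply/measurable_EFinP; apply: measurable_funM; [case: If|case: Ig].
move=> x Dx /=; rewrite lee_fin [leRHS]ger0_norm ?addr_ge0 ?sqr_ge0//.
rewrite normrM -(real_normK (num_real (f x))) -(real_normK (num_real (g x))).
have := sqr_ge0 (`|f x| - `|g x|); rewrite sqrrB.
have := normr_ge0 (f x); have := normr_ge0 (g x); nra.
Qed.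

Lemma inL2D f g : inL2 f -> inL2 g -> inL2 (fun x => f x + g x).
Proof.
move=> If Ig; split; first by apply: measurable_funD; [case: If|case: Ig].
have h := integrableZl mD 2 (integrableD mD (inL2_sq If) (inL2_sq Ig)).
have /integrableP[_] := h; apply: le_lt_trans.
apply: ge0_le_integral => //.
- by move=> x _; rewrite lee_fin sqr_ge0.
- apply/measurable_EFinP; apply: measurable_funX.
  by apply: measurable_funD; [case: If|case: Ig].
- by apply: measurableT_comp => //; case/integrableP: h.
- move=> x Dx /=; rewrite lee_fin ger0_norm.
    by have := sqr_ge0 (f x - g x); rewrite sqrrB sqrrD; lra.
  by rewrite mulr_ge0 ?addr_ge0 ?sqr_ge0.
Qed.

Lemma inL2M (c : T -> R) f (C : R) : measurable_fun D c -> (forall x, D x -> `|c x| <= C) ->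
  inL2 f -> inL2 (fun x => c x * f x).
Proof.
move=> mc cC If; split; first by apply: measurable_funM => //; case: If.
have h := integrableZl mD (C ^+ 2) (inL2_sq If).
have /integrableP[_] := h; apply: le_lt_trans.
apply: ge0_le_integral => //.
- by move=> x _; rewrite lee_fin sqr_ge0.
- apply/measurable_EFinP; apply: measurable_funX.
  by apply: measurable_funM => //; case: If.
- by apply: measurableT_comp => //; case/integrableP: h.
- move=> x Dx /=; rewrite lee_fin ger0_norm; last first.
    by rewrite mulr_ge0 ?sqr_ge0.
  rewrite exprMn ler_wpM2r ?sqr_ge0// -(real_normK (num_real (c x))).
  by rewrite lerXn2r ?nnegrE ?cC// (le_trans _ (cC _ Dx)).
Qed.

Lemma inL2Z a f : inL2 f -> inL2 (fun x => a * f x).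
Proof. by move=> If; apply: (@inL2M (cst a) f `|a|). Qed.

Lemma inL2B f g : inL2 f -> inL2 g -> inL2 (fun x => f x - g x).
Proof.
move=> If Ig; have := inL2D If (inL2Z (-1) Ig).
by under [X in inL2 X]eq_fun do rewrite mulN1r.
Qed.

Lemma ipC f g : inner f g = inner g f.
Proof. by apply: eq_Rintegral => x _; rewrite mulrC. Qed.

Lemma eq_ip f f' g g' : {in D, f =1 f'} -> {in D, g =1 g'} ->
  inner f g = inner f' g'.
Proof. by move=> e1 e2; apply: eq_Rintegral => x Dx; rewrite e1 ?e2. Qed.

Lemma ipDl f g h : inL2 f -> inL2 g -> inL2 h ->
  inner (fun x => f x + g x) h = inner f h + inner g h.
Proof.
move=> If Ig Ih; rewrite /inner -RintegralD//; [|exact: inL2_mul..].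
by apply: eq_Rintegral => x _; rewrite mulrDl.
Qed.

Lemma ipZl a f h : inL2 f -> inL2 h -> inner (fun x => a * f x) h = a * inner f h.
Proof.
move=> If Ih; rewrite /inner -RintegralZl//; last exact: inL2_mul.
by apply: eq_Rintegral => x _; rewrite mulrA.
Qed.

Lemma ipBl f g h : inL2 f -> inL2 g -> inL2 h ->
  inner (fun x => f x - g x) h = inner f h - inner g h.
Proof.
move=> If Ig Ih; rewrite /inner -RintegralB//; [|exact: inL2_mul..].
by apply: eq_Rintegral => x _; rewrite mulrBl.
Qed.

Lemma ipBr f g h : inL2 f -> inL2 g -> inL2 h ->
  inner h (fun x => f x - g x) = inner h f - inner h g.
Proof. by move=> *; rewrite ipC ipBl// (ipC h f) (ipC h g). Qed.

Lemma ipDr f g h : inL2 f -> inL2 g -> inL2 h ->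
  inner h (fun x => f x + g x) = inner h f + inner h g.
Proof. by move=> *; rewrite ipC ipDl// (ipC h f) (ipC h g). Qed.

Lemma ipZr a f h : inL2 f -> inL2 h -> inner h (fun x => a * f x) = a * inner h f.
Proof. by move=> *; rewrite ipC ipZl// (ipC h f). Qed.

Lemma ip_ge0 f : 0 <= inner f f.
Proof. by apply: Rintegral_ge0 => x _; rewrite -expr2 sqr_ge0. Qed.

Lemma ipE f : inL2 f -> (\int[mu]_(x in D) (f x ^+ 2)%:E)%E = (inner f f)%:E.
Proof.
move=> If; rewrite /inner /Rintegral fineK//.
by apply: (integrable_fin_num mD); exact: inL2_mul.
Qed.

Lemma ip_sqB f g : inL2 f -> inL2 g ->
  inner (fun x => f x - g x) (fun x => f x - g x) = inner f f - 2 * inner f g + inner g g.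
Proof.
move=> If Ig; rewrite ipBl ?ipBr ?(ipC g f)//; last exact: inL2B.
by lra.
Qed.

Lemma ip_CS f g : inL2 f -> inL2 g -> inner f g ^+ 2 <= inner f f * inner g g.
Proof.
move=> If Ig.
have key a b : 0 <= a ^+ 2 * inner f f - 2 * (a * b) * inner f g + b ^+ 2 * inner g g.
  have := ip_ge0 (fun x => a * f x - b * g x).
  have Iaf := inL2Z a If; have Ibg := inL2Z b Ig.
  rewrite ip_sqB// !ipZl// !ipZr//.
  by move: (inner f f) (inner f g) (inner g g) => p q r; nra.
have := ip_ge0 f; rewrite le_eqVlt => /orP[/eqP f0|f0].
  (* If [f] has norm 0, these multipliers turn the quadratic expression into -q^4 (r + 2), with q =
     [inner f g] and r = [inner g g]; its being nonnegative forces q = 0. *)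
  have := key (inner f g * (inner g g + 1)) (inner f g ^+ 2 ).
  rewrite -f0; have := ip_ge0 g; move: (inner f g) (inner g g) => q r r0 h.
  have h2 : 0 <= - (q ^+ 4 * (r + 2)) by move: h; rewrite [X in 0 <= X -> _](_ : _ = - (q ^+ 4 * (r + 2))); [|ring].
  have : q ^+ 4 * (r + 2) <= 0 by lra.
  rewrite pmulr_lle0 ?ltr_wpDl// => q4.
  have /eqP : q ^+ 4 = 0.
    by apply/le_anti; rewrite q4 (exprM q 2 2) sqr_ge0.
  by rewrite expf_eq0 => /= /eqP ->; rewrite expr0n/= mul0r.
have := key (inner f g) (inner f f); move: f0.
move: (inner f g) (inner g g) (inner f f) => q r p p0 h.
have : 0 <= p * (p * r - q ^+ 2).
  by move: h; rewrite [X in 0 <= X -> _](_ : _ = p * (p * r - q ^+ 2)); [|ring].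
by rewrite pmulr_rge0// subr_ge0.
Qed.

Definition cvgL2 (fs : nat -> T -> R) f :=
  [/\ inL2 f, (forall n, inL2 (fs n)) &
   (fun n => inner (fun x => fs n x - f x) (fun x => fs n x - f x)) @ \oo --> 0].

Lemma cvgL2_ipr fs f g : cvgL2 fs f -> inL2 g ->
  (fun n => inner (fs n) g) @ \oo --> inner f g.
Proof.
move=> [If In c] Ig.
have e n : `|inner (fs n) g - inner f g| <=
  Num.sqrt (inner (fun x => fs n x - f x) (fun x => fs n x - f x) * inner g g).
  rewrite -sqrtr_sqr ler_wsqrtr// -ipBl//; apply: ip_CS => //; exact: inL2B.
apply/subr_cvg0; apply/norm_cvg0P.
have c2 : (fun n => Num.sqrt (inner (fun x => fs n x - f x)
  (fun x => fs n x - f x) * inner g g)) @ \oo --> 0.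
  rewrite -(@sqrtr0 R) -(mul0r (inner g g)).
  apply: continuous_cvg; first exact: sqrt_continuous.
  by apply: cvgM => //; exact: cvg_cst.
apply: (squeeze_cvgr _ (cvg_cst 0) c2).
by apply: nearW => n; rewrite normr_ge0 e.
Qed.

Lemma ip_sqD_le f g : inL2 f -> inL2 g ->
  inner (fun x => f x + g x) (fun x => f x + g x) <= 2 * inner f f + 2 * inner g g.
Proof.
move=> If Ig; have := ip_ge0 (fun x => f x - g x); rewrite ip_sqB//.
have ID := inL2D If Ig.
by rewrite ipDl// !ipDr// (ipC g f); lra.
Qed.

Lemma cvgL2_cst f : inL2 f -> cvgL2 (fun=> f) f.
Proof.
move=> If; split=> //; rewrite (_ : (fun=> _) = cst 0); first exact: cvg_cst.
apply/funext => n; rewrite /inner (@eq_Rintegral _ _ _ _ _ (cst 0)).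
  by rewrite Rintegral_cst// mul0r.
by move=> x _; rewrite subrr mulr0.
Qed.

Lemma cvgL2D fs f gs g : cvgL2 fs f -> cvgL2 gs g ->
  cvgL2 (fun n x => fs n x + gs n x) (fun x => f x + g x).
Proof.
move=> [If In c] [Ig Im c']; split; [exact: inL2D|by move=> n; exact: inL2D|].
have c2 : (fun n => 2 * inner (fun x => fs n x - f x) (fun x => fs n x - f x) +
   2 * inner (fun x => gs n x - g x) (fun x => gs n x - g x)) @ \oo --> 0.
  rewrite (_ : 0 = 2 * 0 + 2 * 0); last by ring.
  by apply: cvgD; apply: cvgM => //; exact: cvg_cst.
apply: (squeeze_cvgr _ (cvg_cst 0) c2); apply: nearW => n; rewrite ip_ge0/=.
rewrite (_ : inner _ _ = inner (fun x => (fs n x - f x) + (gs n x - g x))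
                   (fun x => (fs n x - f x) + (gs n x - g x))).
  by apply: ip_sqD_le; exact: inL2B.
by apply: eq_ip => x _; ring.
Qed.

Lemma ip_le f g : inL2 f -> inL2 g -> (forall x, D x -> `|f x| <= `|g x|) ->
  inner f f <= inner g g.
Proof.
move=> If Ig fg; apply: le_Rintegral => //; [exact: inL2_mul..|].
move=> x Dx; rewrite -!expr2 -(real_normK (num_real (f x))).
by rewrite -(real_normK (num_real (g x))) lerXn2r ?nnegrE ?fg.
Qed.

Lemma cvgL2M (c : T -> R) (C : R) fs f : measurable_fun D c -> (forall x, D x -> `|c x| <= C) ->
  cvgL2 fs f -> cvgL2 (fun n x => c x * fs n x) (fun x => c x * f x).
Proof.
move=> mc cC [If In cv]; split; [exact: (inL2M mc cC If)|by move=> n; exact: (inL2M mc cC (In n))|].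
have c2 : (fun n => C ^+ 2 * inner (fun x => fs n x - f x) (fun x => fs n x - f x))
    @ \oo --> 0.
  by rewrite -[X in _ --> X](mulr0 (C ^+ 2)); apply: cvgM => //; exact: cvg_cst.
apply: (squeeze_cvgr _ (cvg_cst 0) c2); apply: nearW => n; rewrite ip_ge0/=.
have IB := inL2B (In n) If.
rewrite (_ : _ * inner _ _ = inner (fun x => C * (fs n x - f x)) (fun x => C * (fs n x - f x))).
  apply: ip_le; [exact: inL2B (inL2M mc cC (In n)) (inL2M mc cC If)|exact: inL2Z|].
  move=> x Dx; rewrite -mulrBr !normrM ler_wpM2r//.
  by rewrite (le_trans (cC _ Dx))// ler_norm.
by rewrite ipZl ?ipZr//; [ring|exact: inL2Z].
Qed.

Lemma cvgL2Z a fs f : cvgL2 fs f ->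
  cvgL2 (fun n x => a * fs n x) (fun x => a * f x).
Proof. by move=> h; apply: (@cvgL2M (cst a) `|a|). Qed.

Lemma cvgL2B fs f gs g : cvgL2 fs f -> cvgL2 gs g ->
  cvgL2 (fun n x => fs n x - gs n x) (fun x => f x - g x).
Proof.
move=> cf cg; have [If In c] := cvgL2D cf (cvgL2Z (-1) cg).
case: cf cg => [If' In' _] [Ig Ign _].
split; [exact: inL2B|by move=> n; exact: inL2B|].
apply: cvg_trans c; apply: near_eq_cvg; apply: nearW => n.
by apply: eq_ip => x _; ring.
Qed.

Lemma cvgL2_sq fs f : cvgL2 fs f -> (fun n => inner (fs n) (fs n)) @ \oo --> inner f f.
Proof.
move=> cf; have [If In c] := cf; have c1 := cvgL2_ipr cf If.
rewrite (_ : (fun n => _) = (fun n => inner (fun x => fs n x - f x) (fun x => fs n x - f x)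
   + 2 * inner (fs n) f - inner f f)); last first.
  by apply/funext => n; rewrite ip_sqB//; ring.
rewrite [X in _ --> X](_ : _ = 0 + 2 * inner f f - inner f f); last by ring.
apply: cvgB; last exact: cvg_cst.
by apply: cvgD => //; apply: cvgM => //; exact: cvg_cst.
Qed.

(** Polarisation: 2 <f, g> = |f|^2 + |g|^2 - |f - g|^2 reduces joint convergence to convergence of
    norms. *)
Lemma cvgL2_ip fs f gs g : cvgL2 fs f -> cvgL2 gs g ->
  (fun n => inner (fs n) (gs n)) @ \oo --> inner f g.
Proof.
move=> cf cg; have [If In _] := cf; have [Ig Im _] := cg.
have c1 := cvgL2_sq (cvgL2B cf cg).
have c2 := cvgL2_sq cf; have c3 := cvgL2_sq cg.
rewrite (_ : (fun n => _) = (fun n => 2^-1 * (inner (fs n) (fs n) + inner (gs n) (gs n) -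
   inner (fun x => fs n x - gs n x) (fun x => fs n x - gs n x)))); last first.
  by apply/funext => n; rewrite ip_sqB//; field.
rewrite [X in _ --> X](_ : _ = 2^-1 * (inner f f + inner g g -
   inner (fun x => f x - g x) (fun x => f x - g x))); last first.
  by rewrite ip_sqB//; field.
by apply: cvgM; [exact: cvg_cst|apply: cvgB => //; exact: cvgD].
Qed.

(** Fatou's lemma, once the square of the limit is replaced almost everywhere by the liminf of the
    squares. A bound for large [n] is enough, which is what a convergent sequence of norms
    provides. *)
Lemma fatou_L2 fs f (A : \bar R) : (forall n, measurable_fun D (fs n)) ->
  {ae mu, forall x, D x -> (fun n => fs n x) @ \oo --> f x} ->
  (\forall n \near \oo, (\int[mu]_(x in D) (fs n x ^+ 2)%:E <= A)%E) ->
  measurable_fun D f ->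
  (\int[mu]_(x in D) (f x ^+ 2)%:E <= A)%E.
Proof.
move=> mfn cv [N _ hA] mf.
have mfn2 n : measurable_fun D (fun x => (fs n x ^+ 2)%:E).
  by apply/measurable_EFinP; exact: measurable_funX.
have -> : (\int[mu]_(x in D) (f x ^+ 2)%:E)%E =
    (\int[mu]_(x in D) (limn_einf (fun n => (fs n x ^+ 2)%:E)))%E.
  apply: ae_eq_integral => //.
  - by apply/measurable_EFinP; exact: measurable_funX.
  - rewrite /limn_einf; apply: measurableT_comp => //.
    apply: measurable_fun_limn_esup => n.
    by apply: measurableT_comp => //.
  - apply: filterS cv => x /[apply] cvx; apply/esym.
    apply: (cvg_limn_einf_sup _).1.
    by apply/cvg_EFin; [exact: nearW|rewrite expr2; exact: cvgM].
apply: (le_trans (fatou mu mD mfn2 _)).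
  by move=> n x _; rewrite lee_fin sqr_ge0.
rewrite limn_einf_lim; apply: lime_le; first exact: is_cvg_einfs.
near=> n; apply: ge_ereal_inf.
exists (\int[mu]_(x in D) (fs (maxn n N) x ^+ 2)%:E)%E.
  by exists (maxn n N) => //=; exact: leq_maxl.
by apply: hA; exact: leq_maxr.
Unshelve. all: by end_near. Qed.

(** Completeness in the form used later: the limit is not constructed but prescribed as the almost
    everywhere limit. Fatou's lemma in [m] carries the Cauchy bound over to [fs n - f]. *)
Lemma cauchy_cvgL2 fs f : (forall n, inL2 (fs n)) -> measurable_fun D f ->
  {ae mu, forall x, D x -> (fun n => fs n x) @ \oo --> f x} ->
  (forall e, 0 < e -> exists N, forall n m, (N <= n)%N -> (N <= m)%N ->
     inner (fun x => fs n x - fs m x) (fun x => fs n x - fs m x) <= e) ->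
  cvgL2 fs f.
Proof.
move=> In mf cv cau.
have key e n N : (forall n m, (N <= n)%N -> (N <= m)%N ->
     inner (fun x => fs n x - fs m x) (fun x => fs n x - fs m x) <= e) ->
  (N <= n)%N -> (\int[mu]_(x in D) ((fs n x - f x) ^+ 2)%:E <= e%:E)%E.
  move=> h Nn; apply: (@fatou_L2 (fun m x => fs n x - fs m x)).
  - by move=> m; apply: measurable_funB; [case: (In n)|case: (In m)].
  - apply: filterS cv => x /[apply] cvx.
    by apply: cvgB => //; exact: cvg_cst.
  - by exists N => // m Nm; rewrite (ipE (inL2B (In n) (In m))) lee_fin h.
  - by apply: measurable_funB => //; case: (In n).
have Ifn e n N : (forall n m, (N <= n)%N -> (N <= m)%N ->
     inner (fun x => fs n x - fs m x) (fun x => fs n x - fs m x) <= e) ->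
  (N <= n)%N -> inL2 (fun x => fs n x - f x).
  move=> h Nn; split; first by apply: measurable_funB => //; case: (In n).
  by apply: le_lt_trans (key _ _ _ h Nn) _; rewrite ltry.
have If : inL2 f.
  have [N hN] := cau 1 ltr01; have := inL2B (In N) (Ifn _ _ _ hN (leqnn N)).
  by under [X in inL2 X]eq_fun do rewrite opprB addrC subrK.
split=> //; apply/cvgr0Pnorm_le => e e0; have [N hN] := cau e e0.
exists N => // n /= Nn; rewrite ger0_norm ?ip_ge0//.
by rewrite -lee_fin -(ipE (inL2B (In n) If)) (key _ _ _ hN).
Qed.

(** Dominated convergence with majorant 4 C^2 h^2. It serves to let the cutoff parameter tend to 0
    in front of a fixed L2 function. *)
Lemma cvgL2_mulseq (cs : nat -> T -> R) (c : T -> R) (C : R) h :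
  (forall n, measurable_fun D (cs n)) -> measurable_fun D c ->
  (forall n x, D x -> `|cs n x| <= C) ->
  (forall x, D x -> (fun n => cs n x) @ \oo --> c x) -> inL2 h ->
  cvgL2 (fun n x => cs n x * h x) (fun x => c x * h x).
Proof.
move=> mcs mc bd cv Ih.
have bc x : D x -> `|c x| <= C.
  move=> Dx; have cn : (fun n => `|cs n x|) @ \oo --> `|c x|.
    by apply: cvg_norm; exact: cv.
  rewrite -(cvg_lim _ cn)//; apply: limr_le; first by apply/cvg_ex; exists `|c x|.
  by apply: nearW => n; exact: bd.
have I1 := inL2M mc bc Ih; have I2 n := inL2M (mcs n) (bd n) Ih.
split=> //.
have IB n := inL2B (I2 n) I1.
pose F n x := ((cs n x * h x - c x * h x) ^+ 2)%:E.
have [] := @dominated_convergence _ _ _ mu D mD F (cst 0%E)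
   (fun x => (4 * C ^+ 2)%:E * (h x ^+ 2)%:E)%E.
- by move=> n; apply/measurable_EFinP; apply: measurable_funX; case: (IB n).
- exact: measurable_cst.
- apply: aeW => x Dx; rewrite /F /=.
  have -> : 0%E = ((c x * h x - c x * h x) ^+ 2)%:E :> \bar R by rewrite subrr expr0n.
  apply: cvg_EFin; first exact: nearW.
  have c1 : (fun n => cs n x * h x - c x * h x) @ \oo --> c x * h x - c x * h x.
    by apply: cvgB; [apply: cvgM; [exact: cv|exact: cvg_cst]|exact: cvg_cst].
  by under eq_fun do rewrite expr2; rewrite expr2; exact: cvgM.
- by apply: integrableZl => //; exact: inL2_sq.
- apply: aeW => x n Dx; rewrite /F /= lee_fin ger0_norm ?sqr_ge0//.
  rewrite -mulrBl exprMn ler_wpM2r ?sqr_ge0//.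
  rewrite (_ : 4 * C ^+ 2 = (C + C) ^+ 2); last by ring.
  rewrite -(real_normK (num_real (cs n x - c x))) lerXn2r ?nnegrE//.
    by rewrite addr_ge0 // (le_trans _ (bc _ Dx)).
  by rewrite (le_trans (ler_normB _ _)) // lerD// ?bd ?bc.
move=> _ _; rewrite integral0_eq// => cvF.
have : (fun n => (inner (fun x => cs n x * h x - c x * h x) (fun x => cs n x * h x - c x * h x))%:E) @ \oo --> 0%E.
  apply: cvg_trans cvF; apply: near_eq_cvg; apply: nearW => n.
  by rewrite -ipE.
by move/fine_cvg.
Qed.

(** The sum of the series has a finite integral, so it is finite almost everywhere, and there each
    term is at most a tail that tends to 0. This is the standard way from L2 convergence to an
    almost everywhere convergent subsequence. *)
Lemma ae_cvg0_summable (gs : nat -> T -> R) :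
  (forall n, measurable_fun D (gs n)) -> (forall n x, D x -> 0 <= gs n x) ->
  (forall n, (\int[mu]_(x in D) (gs n x)%:E <= (1 / (2 ^ n.+1)%:R)%:E)%E) ->
  {ae mu, forall x, D x -> (fun n => gs n x) @ \oo --> (0:R)}.
Proof.
move=> mg g0 ig.
have mS : measurable_fun D (fun x => (\sum_(0 <= n <oo) (gs n x)%:E)%E).
  apply: ge0_emeasurable_sum; [by move=> n x Dx _; rewrite lee_fin g0|].
  by move=> n _; apply/measurable_EFinP.
have S0 x : D x -> (0 <= \sum_(0 <= n <oo) (gs n x)%:E)%E.
  by move=> Dx; apply: nneseries_ge0 => n _ _; rewrite lee_fin g0.
have iS : mu.-integrable D (fun x => (\sum_(0 <= n <oo) (gs n x)%:E)%E).
  apply/integrableP; split=> //.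
  under eq_integral => x /set_mem Dx do rewrite gee0_abs ?S0//.
  rewrite integral_nneseries//; last first.
    by move=> n; apply/measurable_EFinP.
  apply: (@le_lt_trans _ _ (\sum_(0 <= n <oo) (1 / (2 ^ n.+1)%:R)%:E)%E).
    apply: lee_nneseries => n _ //.
    by move=> _; apply: integral_ge0 => x Dx; rewrite lee_fin g0.
  by apply: (le_lt_trans (epsilon_trick0 _ _)); rewrite ?ltry.
have := integrable_ae mD iS; apply: filterS => x h Dx.
have {h} := h Dx; rewrite ge0_fin_numE ?S0// => fS.
have g0' k : true -> (0 <= (gs k x)%:E)%E by rewrite lee_fin g0.
have tl := nneseries_tail_cvg fS g0'.
suff : (fun n => (gs n x)%:E) @ \oo --> 0%E by move/fine_cvg.
apply: (squeeze_cvge _ (cvg_cst 0%E) tl); apply: nearW => n; rewrite g0'//=.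
rewrite (nneseries_split _ 1); last by move=> *; exact: g0'.
rewrite addn1 big_nat1 leeDl// nneseries_ge0// => *; exact: g0'.
Qed.
End L2kit.

(** * The half-plane and its slices *)

Section Plane.
Context {R : realType}.
Notation H := (@half_plane R).

(** Measurability refers to the product of the Borel structures, so an open set has to be exhausted
    by countably many rational boxes; those not contained in [U] are replaced by the empty set. *)
Lemma open_measurable_plane (U : set (R * R)) : open U ->
  measurable (U : set (plane R)).
Proof.
move=> oU.
pose B (q1 q2 r : rat) : set (plane R) :=
  [set x : R * R | (ratr q1 - ratr r < x.1) && (x.1 < ratr q1 + ratr r)] `&`
  [set x : R * R | (ratr q2 - ratr r < x.2) && (x.2 < ratr q2 + ratr r)].
pose B' q1 q2 r := if `[< B q1 q2 r `<=` U >] then B q1 q2 r else set0.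
have -> : U = \bigcup_q1 \bigcup_q2 \bigcup_r B' q1 q2 r.
  apply/seteqP; split=> [x Ux|x [q1 _ [q2 _ [r _]]]]; last first.
    by rewrite /B'; case: asboolP => // h /h.
  have /nbhs_ballP[e /= e0 he] : nbhs x U by exact: open_nbhs_nbhs.
  have [r] : exists r : rat, ratr r \in `]0, (e / 2)[%R.
    by apply: rat_in_itvoo; rewrite divr_gt0.
  rewrite in_itv /= => /andP[r0 re].
  have [q1] : exists q : rat, ratr q \in `](x.1 - ratr r), (x.1 + ratr r)[%R.
    by apply: rat_in_itvoo; lra.
  have [q2] : exists q : rat, ratr q \in `](x.2 - ratr r), (x.2 + ratr r)[%R.
    by apply: rat_in_itvoo; lra.
  rewrite !in_itv /= => /andP[a1 a2] /andP[b1 b2].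
  exists q1 => //; exists q2 => //; exists r => //.
  rewrite /B'; case: asboolP; first by move=> _; split => /=; lra.
  case=> y [/= /andP[c1 c2] /andP[d1 d2]]; apply: he.
  by split; rewrite /ball /= ltr_norml; lra.
apply: bigcupT_measurable_rat => q1; apply: bigcupT_measurable_rat => q2.
apply: bigcupT_measurable_rat => r; rewrite /B'; case: asboolP => // _.
rewrite /B; apply: measurableI.
- rewrite (_ : [set _ | _] = `](ratr q1 - ratr r), (ratr q1 + ratr r)[ `*` setT).
    exact: measurableX.
  by apply/seteqP; split=> x /=; rewrite in_itv /=; [move=> ?; split|case].
- rewrite (_ : [set _ | _] = setT `*` `](ratr q2 - ratr r), (ratr q2 + ratr r)[).
    exact: measurableX.
  by apply/seteqP; split=> x /=; rewrite in_itv /=; [move=> ?; split|case].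
Qed.

Lemma measurable_half_plane : measurable (H : set (plane R)).
Proof.
rewrite (_ : H = setT `*` `]0, +oo[); first exact: measurableX.
by apply/seteqP; split=> x; rewrite /half_plane /= in_itv /= andbT; [move=> ?; split|case].
Qed.

Lemma continuous_measurable_plane (f : R * R -> R) : continuous f ->
  measurable_fun (setT : set (plane R)) f.
Proof.
move=> /continuousP cf; apply: (measurability _ (RGenOpens.measurableE R)).
move=> _ [_ [a [b ->] <-]]; rewrite setTI; apply: open_measurable_plane.
exact/cf/interval_open.
Qed.
End Plane.

(** * Compact boxes, local boundedness, and Tonelli's theorem on the half-plane *)

Section Boxes.
Context {R : realType}.
Notation mu := (lebesgue_plane R).
Notation lam := (@lebesgue_measure R).
Notation H := (@half_plane R).
Implicit Types f g : R * R -> R.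
Let mH := @measurable_half_plane R.

(** A compact exhaustion of the open half-plane by a single parameter: [A] bounds both the distance
    from the origin and the inverse distance from the boundary. *)
Definition box (A : R) : set (R * R) := `[- A, A] `*` `[A^-1, A].

(** Boundedness is required only away from the boundary, so the Hardy weights, powers of 1 / x_2,
    qualify. *)
Definition locbd f := mfun_half f /\
  forall A, 0 < A -> exists C, forall x, box A x -> `|f x| <= C.

Definition csupp f := exists2 A, 0 < A & forall x, H x -> f x != 0 -> box A x.

Lemma box_half_plane A : 0 < A -> box A `<=` H.
Proof.
move=> A0 x [_ /=]; rewrite in_itv /half_plane /= => /andP[h _].
by apply: lt_le_trans h; rewrite invr_gt0.
Qed.

Lemma compact_box A : compact (box A).
Proof. by apply: compact_setX; exact: segment_compact. Qed.

Lemma measurable_box A : measurable (box A : set (plane R)).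
Proof. exact: measurableX. Qed.

Lemma box_finite A : (mu (box A) < +oo)%E.
Proof.
have -> : mu (box A) = (lam `[(- A)%R, A] * lam `[A^-1%R, A])%E.
  by apply: product_measure1E.
by rewrite !lebesgue_measure_itv/=; case: ifP => _; case: ifP => _; rewrite ltry.
Qed.

Lemma box_sub A B : 0 < A -> A <= B -> box A `<=` box B.
Proof.
move=> A0 AB x [/=]; rewrite !in_itv /= => /andP[a b] /andP[c d].
have B0 := lt_le_trans A0 AB.
have : B^-1 <= A^-1 by rewrite lef_pV2.
by split; rewrite /= in_itv /=; lra.
Qed.

Lemma continuous_locbd f : continuous f -> locbd f.
Proof.
move=> cf; split.
  by apply: (measurable_funS measurableT) => //; exact: continuous_measurable_plane.
move=> A A0.
have : compact (f @` box A).
  apply: continuous_compact; last exact: compact_box.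
  exact: continuous_subspaceT.
move=> /compact_bounded[C [_ hC]]; exists (C + 1) => x bx.
by apply: (hC (C + 1)); [rewrite ltrDl|exists x].
Qed.

Lemma locbdM f g : locbd f -> locbd g -> locbd (fun x => f x * g x).
Proof.
move=> [mf bf] [mg bg]; split; first exact: measurable_funM.
move=> A A0; have [C hC] := bf A A0; have [C' hC'] := bg A A0.
by exists (C * C') => x bx; rewrite normrM ler_pM ?hC ?hC'.
Qed.

Lemma locbdD f g : locbd f -> locbd g -> locbd (fun x => f x + g x).
Proof.
move=> [mf bf] [mg bg]; split; first exact: measurable_funD.
move=> A A0; have [C hC] := bf A A0; have [C' hC'] := bg A A0.
by exists (C + C') => x bx; rewrite (le_trans (ler_normD _ _))// lerD ?hC ?hC'.
Qed.

Lemma locbd_cst (c : R) : locbd (fun=> c).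
Proof. by apply: continuous_locbd => x; exact: cvg_cst. Qed.

Lemma locbdN f : locbd f -> locbd (fun x => - f x).
Proof.
move=> [mf bf]; split; first exact: measurable_funN.
by move=> A A0; have [C hC] := bf A A0; exists C => x bx; rewrite normrN hC.
Qed.

Lemma locbdB f g : locbd f -> locbd g -> locbd (fun x => f x - g x).
Proof. by move=> hf hg; apply: locbdD => //; exact: locbdN. Qed.

Lemma locbdX f n : locbd f -> locbd (fun x => f x ^+ n).
Proof.
move=> hf; elim: n => [|n ih]; first exact: locbd_cst.
under eq_fun do rewrite exprS; exact: locbdM.
Qed.

Lemma locbd_inv2 : locbd (fun x => x.2^-1).
Proof.
split.
  have mV : measurable_fun (`]0, +oo[%classic : set (measurableTypeR R)) (fun y : R => y^-1).
    apply: open_continuous_measurable_fun; first exact: interval_open.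
    move=> x; rewrite inE /= in_itv /= andbT => x0.
    by apply: inv_continuous; rewrite gt_eqF.
  have m2 : mfun_half (@snd R R).
    by apply: (measurable_funS measurableT) => //; exact: measurable_snd.
  have h := measurable_comp (measurable_itv _) _ mV m2.
  by apply: h => _ [x Hx <-] /=; rewrite in_itv /= andbT.
move=> A A0; exists A => x [_ /=]; rewrite in_itv /= => /andP[h1 _].
have x0 : 0 < x.2 by apply: lt_le_trans h1; rewrite invr_gt0.
rewrite ger0_norm; last by rewrite invr_ge0 ltW.
have : x.2^-1 <= (A^-1)^-1 by rewrite lef_pV2// posrE invr_gt0.
by rewrite invrK.
Qed.

Lemma csuppM f g : csupp f -> csupp (fun x => g x * f x).
Proof.
move=> [A A0 h]; exists A => // x Hx; rewrite mulf_eq0 negb_or => /andP[_].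
exact: h.
Qed.

Lemma csuppMr f g : csupp f -> csupp (fun x => f x * g x).
Proof. by move=> /(@csuppM _ g); under eq_fun do rewrite mulrC. Qed.

Lemma locbd_integrable f : locbd f -> csupp f -> mu.-integrable H (EFin \o f).
Proof.
move=> [mf bf] [A A0 sf]; have [C hC] := bf A A0.
have I1 : mu.-integrable (box A) (cst C%:E).
  apply/integrableP; split; first exact: measurable_cst.
  rewrite integral_cst; last exact: measurable_box.
  by apply: lte_mul_pinfty => //; exact: box_finite.
have I2 : mu.-integrable H ((cst C%:E) \_ (box A)).
  apply/integrable_restrict => //; first exact: measurable_box.
  by rewrite setIidr//; exact: box_half_plane.
apply: (le_integrable mH _ _ I2); first exact/measurable_EFinP.
move=> x Hx /=; have [->|f0] := eqVneq (f x) 0; first by rewrite normr0 abse_ge0.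
rewrite patchE mem_set; last exact: sf.
by rewrite /= lee_fin (le_trans (hC _ _))//; [exact: sf|exact: ler_norm].
Qed.

Lemma locbd_inL2 f : locbd f -> csupp f -> inL2 mu H f.
Proof.
move=> lf sf; split; first by case: lf.
have [] := integrableP _ _ _ (locbd_integrable (locbdM lf lf) (csuppMr f sf)).
move=> _; apply: le_lt_trans; rewrite le_eqVlt; apply/orP; left; apply/eqP; apply: eq_integral => x _.
by rewrite expr2 /= ger0_norm// -expr2 sqr_ge0.
Qed.

Lemma tonelli_H (f : R * R -> \bar R) : mfun_half f ->
  (forall x, H x -> (0 <= f x)%E) ->
  (\int[mu]_(x in H) f x = \int[lam]_(y in `]0%R, +oo[) \int[lam]_x f (x, y))%E.
Proof.
move=> mf f0; rewrite integral_mkcond.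
have -> : (\int[mu]_x (f \_ H) x = \int[lam]_y fubini_G lam (f \_ H) y)%E.
  apply: fubini_tonelli2; first exact/(measurable_restrictT _ _).1.
  by move=> x; rewrite patchE; case: ifPn => // /set_mem/f0.
rewrite [RHS]integral_mkcond; apply: eq_integral => y _.
rewrite /fubini_G patchE; case: ifPn; rewrite ?inE ?notin_setE /= in_itv/= andbT.
  move=> y0; apply: eq_integral => x _; rewrite patchE.
  by case: ifPn => //; rewrite notin_setE.
move=> y0; apply: integral0_eq => x _; rewrite patchE.
by case: ifPn => //; rewrite inE.
Qed.

Lemma tonelli_H1 (f : R * R -> \bar R) : mfun_half f ->
  (forall x, H x -> (0 <= f x)%E) ->
  (\int[mu]_(x in H) f x = \int[lam]_x \int[lam]_(y in `]0%R, +oo[) f (x, y))%E.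
Proof.
move=> mf f0; rewrite integral_mkcond.
have -> : (\int[mu]_x (f \_ H) x = \int[lam]_x fubini_F lam (f \_ H) x)%E.
  apply: fubini_tonelli1; first exact/(measurable_restrictT _ _).1.
  by move=> x; rewrite patchE; case: ifPn => // /set_mem/f0.
apply: eq_integral => x _; rewrite [RHS]integral_mkcond; apply: eq_integral => y _.
  rewrite !patchE.
  by do 2 case: ifPn; rewrite ?inE ?notin_setE /half_plane /= in_itv/= andbT.
Qed.

Lemma measurable_slice1 (f : R * R -> \bar R) (y : R) : mfun_half f ->
  0 < y -> measurable_fun setT (fun x : measurableTypeR R => f (x, y)).
Proof.
move=> /(measurable_restrictT _ mH).1 mf y0.
rewrite (_ : (fun _ => _) = (f \_ H) \o (fun x : R => (x, y))).
  by apply: measurableT_comp => //; exact: measurable_pair2.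
by apply/funext => x /=; rewrite patchE mem_set.
Qed.

Lemma measurable_slice2 (f : R * R -> \bar R) (x : R) : mfun_half f ->
  mfun_pos (fun y => f (x, y)).
Proof.
move=> /(measurable_restrictT _ mH).1 mf; apply/(measurable_restrictT _ _) => //.
rewrite (_ : _ \_ _ = (f \_ H) \o (fun y : R => (x, y))).
  by apply: measurableT_comp => //; exact: measurable_pair1.
apply/funext => y /=; rewrite !patchE.
by do 2 case: ifPn; rewrite ?inE ?notin_setE /half_plane /= in_itv/= andbT.
Qed.
End Boxes.

(** * Pointwise bounds on the real line by integrals of the derivative *)

Section Line.
Context {R : realType}.
Notation lam := (@lebesgue_measure R).
Implicit Types g dg : R -> R.

Lemma FTC_line g dg (a b : R) : a <= b ->
  (forall t, a <= t <= b -> is_derive t 1 g (dg t)) ->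
  (forall t, a <= t <= b -> {for t, continuous dg}) ->
  (\int[lam]_(t in `[a, b]) (dg t)%:E = (g b - g a)%:E)%E.
Proof.
rewrite le_eqVlt => /orP[/eqP <- _ _|ab dg_ cg].
  by rewrite set_itv1 integral_set1 subrr.
have cgg t : a <= t <= b -> {for t, continuous g}.
  move=> /dg_ [h _]; apply: differentiable_continuous.
  exact/derivable1_diffP.
rewrite (@continuous_FTC2 _ dg g)//.
- apply: continuous_in_subspaceT => t; rewrite inE /= in_itv /=; exact: cg.
- split.
  + by move=> t; rewrite in_itv /= => /andP[t1 t2]; have [] := dg_ t; rewrite ?ltW.
  + by apply: cvg_at_right_filter; apply: cgg; rewrite lexx ltW.
  + by apply: cvg_at_left_filter; apply: cgg; rewrite lexx ltW.
- move=> t; rewrite in_itv /= => /andP[t1 t2].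
  by rewrite derive1E; apply: derive_val; apply: dg_; rewrite !ltW.
Qed.

Lemma FTC_supp g dg (a b : R) : a <= b ->
  (forall t, a <= t <= b -> is_derive t 1 g (dg t)) ->
  (forall t, a <= t <= b -> {for t, continuous dg}) ->
  g a = 0 -> g b = 0 ->
  (\int[lam]_(t in `[a, b]) (dg t)%:E = 0)%E.
Proof. by move=> ab h1 h2 ga gb; rewrite (FTC_line ab h1 h2) ga gb subrr. Qed.

(** The derivative 2 g g' of g^2 is integrated from a zero of [g]. On horizontal lines this bounds a
    supremum by a product of two L2 norms. *)
Lemma sq_le_int_prod g dg (a x : R) :
  (forall t : R, is_derive t 1 g (dg t)) -> continuous dg ->
  g a = 0 -> a <= x ->
  ((g x ^+ 2)%:E <= \int[lam]_t (2 * `|g t| * `|dg t|)%:E)%E.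
Proof.
move=> dg_ cdg ga ax.
have cg : continuous g.
  move=> t; have [h _] := dg_ t; apply: differentiable_continuous.
  exact/derivable1_diffP.
have := @FTC_line (fun t => g t * g t) (fun t => 2 * g t * dg t) a x ax.
move=> /(_ _)/wrap[].
  move=> t _; have h := dg_ t.
  apply: (is_derive_eq (is_deriveM h h)).
  by rewrite /GRing.scale /=; ring.
move=> /(_ _)/wrap[].
  by move=> t _; apply: cvgM; [apply: cvgM; [exact: cvg_cst|exact: cg]|exact: cdg].
rewrite ga mulr0 subr0 -expr2 => <-.
have mf : measurable_fun setT (fun t : R => 2 * g t * dg t).
  apply: continuous_measurable_fun => t.
  by apply: cvgM; [apply: cvgM; [exact: cvg_cst|exact: cg]|exact: cdg].
apply: (le_trans (lee_abs _)).
apply: (le_trans (le_abse_integral _ _ _)) => //.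
  by apply/measurable_EFinP; exact: (measurable_funS measurableT).
under eq_integral do rewrite /= !normrM (@ger0_norm _ 2)//.
apply: ge0_subset_integral => //.
  apply/measurable_EFinP; rewrite (_ : (fun _ => _) = Num.norm \o (fun t : R => 2 * g t * dg t)).
    exact: measurableT_comp.
  by apply/funext => t /=; rewrite !normrM (@ger0_norm _ 2).
Qed.

(** Cauchy-Schwarz for the integral of [dg] against the constant 1, whose squared norm on [[0, x]]
    is [x]. *)
Lemma sq_le_int_sq_itv g dg (x : R) :
  (forall t : R, is_derive t 1 g (dg t)) -> continuous dg ->
  g 0 = 0 -> 0 < x ->
  ((g x ^+ 2)%:E <= x%:E * \int[lam]_(t in `[0%R, x]) (dg t ^+ 2)%:E)%E.
Proof.
move=> dg_ cdg g0 x0.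
have mdg (D : set (measurableTypeR R)) : measurable D -> measurable_fun D dg.
  by move=> mD; apply: (measurable_funS measurableT) => //; exact: continuous_measurable_fun.
have I1 (h : R -> R) : continuous h -> inL2 lam `[0, x]%classic h.
  move=> ch; split.
    by apply: (measurable_funS measurableT) => //; exact: continuous_measurable_fun.
  have : lam.-integrable `[0, x] (EFin \o (fun t => h t ^+ 2)).
    apply: continuous_compact_integrable; first exact: segment_compact.
    apply: continuous_subspaceT => t; under eq_fun do rewrite expr2.
    by apply: cvgM; exact: ch.
  move=> /integrableP[_]; apply: le_lt_trans; rewrite le_eqVlt; apply/orP; left.
  by apply/eqP; apply: eq_integral => t _; rewrite /= ger0_norm ?sqr_ge0.
have c1 : continuous (fun _ : R => 1 : R) by move=> t; exact: cvg_cst.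
have := @ip_CS _ _ _ lam _ (measurable_itv _) _ _ (I1 _ cdg) (I1 (fun=> 1) c1).
have -> : inner lam `[0, x] dg (fun=> 1) = g x.
  have := @FTC_line g dg 0 x (ltW x0) (fun t _ => dg_ t) (fun t _ => cdg t).
  rewrite g0 subr0 /inner /Rintegral => h.
  by under eq_integral do rewrite mulr1; rewrite h.
have -> : inner lam `[0, x] (fun=> 1) (fun=> 1) = x.
  rewrite /inner /Rintegral (@eq_integral _ _ _ lam _ (cst 1%:E)); last first.
    by move=> t _; rewrite /= mulr1.
  rewrite integral_cst// mul1e.
  have e : lam `[0%R, x]%classic = x%:E.
    by rewrite lebesgue_measure_itv/= lte_fin x0 sube0.
  transitivity (fine (lam `[0%R, x]%classic)); last by rewrite e.
  reflexivity.
rewrite -lee_fin => /le_trans; apply.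
rewrite mulrC EFinM -(@ipE _ _ _ lam _ (measurable_itv _) _ (I1 _ cdg)); exact: lexx.
Qed.

Lemma sq_le_int_sq g dg (x : R) :
  (forall t : R, is_derive t 1 g (dg t)) -> continuous dg ->
  g 0 = 0 -> 0 < x ->
  ((g x ^+ 2)%:E <= x%:E * \int[lam]_(t in `]0%R, +oo[) (dg t ^+ 2)%:E)%E.
Proof.
move=> dg_ cdg g0 x0; apply: (le_trans (sq_le_int_sq_itv dg_ cdg g0 x0)).
have mdg (D : set (measurableTypeR R)) : measurable D -> measurable_fun D dg.
  by move=> mD; apply: (measurable_funS measurableT) => //; exact: continuous_measurable_fun.
apply: lee_wpmul2l; first by rewrite lee_fin ltW.
rewrite -(@integral_itv_obnd_cbnd _ _ (BRight x)); last first.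
  by apply/measurable_EFinP; apply: measurable_funX; apply: mdg.
apply: ge0_subset_integral => //.
- by apply/measurable_EFinP; apply: measurable_funX; apply: mdg.
- by move=> t _; rewrite lee_fin sqr_ge0.
- by move=> t; rewrite /= !in_itv /= andbT => /andP[].
Qed.
End Line.

(** * Smooth functions and test functions *)

Section Partials.
Context {R : realType}.
Implicit Types f g : R * R -> R.

Notation e j := (((j : 'I_2) == 0)%:R : R, ((j : 'I_2) == 1)%:R : R).

Lemma is_derive_slice0 f (x : R * R) (df : R) :
  is_derive x (e (0 : 'I_2)) f df <->
  is_derive x.1 1 (fun t => f (t, x.2)) df.
Proof.
have E : (fun h : R => h^-1 *: ((f \o shift x) (h *: e (0 : 'I_2)) - f x)) =
  (fun h : R => h^-1 *: (((fun t => f (t, x.2)) \o shift x.1) (h *: 1) - f (x.1, x.2))).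
  apply/funext => h; congr (_ *: (f _ - f _)); last by case: x.
  by rewrite /shift /=; apply/pair_equal_spec; split; rewrite //= scaler0 add0r.
by split=> -[d v]; split; move: d v; rewrite /derivable /derive; rewrite ?E.
Qed.

Lemma is_derive_slice1 f (x : R * R) (df : R) :
  is_derive x (e (1 : 'I_2)) f df <->
  is_derive x.2 1 (fun t => f (x.1, t)) df.
Proof.
have E : (fun h : R => h^-1 *: ((f \o shift x) (h *: e (1 : 'I_2)) - f x)) =
  (fun h : R => h^-1 *: (((fun t => f (x.1, t)) \o shift x.2) (h *: 1) - f (x.1, x.2))).
  apply/funext => h; congr (_ *: (f _ - f _)); last by case: x.
  by rewrite /shift /=; apply/pair_equal_spec; split; rewrite //= scaler0 add0r.
by split=> -[d v]; split; move: d v; rewrite /derivable /derive; rewrite ?E.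
Qed.

(** Smoothness is defined through words of partial derivatives, a form in which the product rule is
    awkward. Stability under products is proved by induction on the finite order [n] instead, and
    [smooth] means [Cn n] for all [n]. *)
Fixpoint Cn n f : Prop := if n is n'.+1 then
  [/\ continuous f, (forall j x, derivable f x (e j)) &
      forall j, Cn n' (partial j f)] else continuous f.

Lemma smoothP f : smooth f <-> forall n, Cn n f.
Proof.
split=> [sf n|].
  elim: n f sf => [f sf|n ih f sf]; first by have [] := sf [::].
  split; first by have [] := sf [::].
    by have [] := sf [::].
  (* The derivative taken first is the innermost one in the [foldr], so words are split at their
     right end. *)
  move=> j; apply: ih => s; have := sf (rcons s j).
  by rewrite foldr_rcons.
move=> h s; elim/last_ind: s f h => [|s j ih] f h.
  by have [h1 h2 _] := h 1%N; split.
rewrite foldr_rcons; apply: ih => n.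
by have [_ _] := h n.+1; exact.
Qed.

Lemma smooth_continuous f : smooth f -> continuous f.
Proof. by move=> /(_ [::])[]. Qed.

Lemma smooth_derivable f j x : smooth f -> derivable f x (e j).
Proof. by move=> /(_ [::])[_]; exact. Qed.

Lemma smooth_partial j f : smooth f -> smooth (partial j f).
Proof.
by move=> /smoothP h; apply/smoothP => n; have [_ _] := h n.+1; apply.
Qed.

Lemma smooth_is_derive f j x : smooth f -> is_derive x (e j) f (partial j f x).
Proof. by move=> sf; split=> //; exact: smooth_derivable. Qed.

Lemma smoothI f : continuous f -> (forall j x, derivable f x (e j)) ->
  (forall j, smooth (partial j f)) -> smooth f.
Proof.
move=> cf df sf; apply/smoothP => -[|n] //; split=> // j.
by move/smoothP: (sf j).
Qed.

Lemma partialE f j x (df : R) : is_derive x (e j) f df -> partial j f x = df.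
Proof. by move=> h; rewrite /partial derive_val. Qed.

Lemma partialD f g j x : derivable f x (e j) -> derivable g x (e j) ->
  partial j (fun x => f x + g x) x = partial j f x + partial j g x.
Proof. by move=> df dg; rewrite /partial deriveD. Qed.

Lemma partialM f g j x : derivable f x (e j) -> derivable g x (e j) ->
  partial j (fun x => f x * g x) x = f x * partial j g x + g x * partial j f x.
Proof. by move=> df dg; rewrite /partial deriveM. Qed.

Lemma Cn_pred n f : Cn n.+1 f -> Cn n f.
Proof.
elim: n f => [f []//|n ih f [c d h]]; split=> // j; exact/ih/h.
Qed.

Lemma CnD n f g : Cn n f -> Cn n g -> Cn n (fun x => f x + g x).
Proof.
elim: n f g => [|n ih] f g; first by move=> cf cg x; apply: cvgD; [exact: cf|exact: cg].
move=> [cf df pf] [cg dg pg]; split.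
- by move=> x; apply: cvgD; [exact: cf|exact: cg].
- by move=> j x; apply: derivableD.
- move=> j; rewrite (_ : partial j _ = fun x => partial j f x + partial j g x).
    exact: (ih _ _ (pf j) (pg j)).
  by apply/funext => x; rewrite partialD.
Qed.

Lemma CnM n f g : Cn n f -> Cn n g -> Cn n (fun x => f x * g x).
Proof.
elim: n f g => [|n ih] f g; first by move=> cf cg x; apply: cvgM; [exact: cf|exact: cg].
move=> hf hg; have [cf df pf] := hf; have [cg dg pg] := hg; split.
- by move=> x; apply: cvgM; [exact: cf|exact: cg].
- by move=> j x; apply: derivableM.
- move=> j; rewrite (_ : partial j _ =
     fun x => f x * partial j g x + g x * partial j f x).
    by apply: CnD; [exact: (ih _ _ (Cn_pred hf) (pg j))|exact: (ih _ _ (Cn_pred hg) (pf j))].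
  by apply/funext => x; rewrite partialM.
Qed.

Lemma partial_cst (c : R) j : partial j (fun=> c) = fun=> 0.
Proof. by apply/funext => x; rewrite /partial derive_cst. Qed.

Lemma Cn_cst n (c : R) : Cn n (fun=> c).
Proof.
elim: n c => [|n ih] c; first by move=> x; exact: cvg_cst.
split; first by move=> x; exact: cvg_cst.
- by move=> j x; exact: derivable_cst.
- by move=> j; rewrite partial_cst.
Qed.

Lemma smoothD f g : smooth f -> smooth g -> smooth (fun x => f x + g x).
Proof. by move=> /smoothP hf /smoothP hg; apply/smoothP => n; exact: CnD. Qed.

Lemma smoothM f g : smooth f -> smooth g -> smooth (fun x => f x * g x).
Proof. by move=> /smoothP hf /smoothP hg; apply/smoothP => n; exact: CnM. Qed.

Lemma smooth_cst (c : R) : smooth (fun=> c).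
Proof. by apply/smoothP => n; exact: Cn_cst. Qed.

Lemma smoothB f g : smooth f -> smooth g -> smooth (fun x => f x - g x).
Proof.
move=> hf hg; rewrite (_ : (fun x => f x - g x) = (fun x => f x + (-1) * g x)).
  by apply: smoothD => //; apply: smoothM => //; exact: smooth_cst.
by apply/funext => x; rewrite mulN1r.
Qed.

Lemma smooth_snd : smooth (fun x : R * R => x.2).
Proof.
have dd (j : 'I_2) (x : R * R) : is_derive x (e j) (fun x : R * R => x.2) (j == 1)%:R.
  have [->|->] : j = 0 \/ j = 1 by case: j => -[|[|//]] i; [left|right]; exact: val_inj.
    by apply/is_derive_slice0 => /=; exact: is_derive_cst.
  by apply/is_derive_slice1 => /=; exact: is_derive_id.
apply: smoothI.
- by move=> x; exact: cvg_snd.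
- by move=> j x; have [] := dd j x.
- move=> j; rewrite (_ : partial _ _ = fun=> (j == 1)%:R); first exact: smooth_cst.
  by apply/funext => x; exact: partialE.
Qed.
End Partials.

(** * Supports of test functions and vanishing integrals of derivatives *)

Section TestFunctions.
Context {R : realType}.
Notation mu := (lebesgue_plane R).
Notation lam := (@lebesgue_measure R).
Notation H := (@half_plane R).
Implicit Types f g : R * R -> R.
Let mH := @measurable_half_plane R.

Notation e j := (((j : 'I_2) == 0)%:R : R, ((j : 'I_2) == 1)%:R : R).

(** Unlike [csupp], this also forces [f] to vanish off the half-plane, as an extension by zero
    does. *)
Definition gsupp f := exists2 A, 0 < A & forall x, f x != 0 -> box A x.

Lemma closed_box (A : R) : closed (box A).
Proof.
apply: compact_closed; last exact: compact_box.
by apply: norm_hausdorff.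
Qed.

Lemma test_functionP f : test_function f <-> smooth f /\ gsupp f.
Proof.
split=> [[sf cS SH]|[sf [A A0 fA]]].
  split=> //; set S := [set x | f x != 0] in cS SH.
  have [C1 [_ hC1]] : bounded_set (fst @` closure S).
    apply: compact_bounded; apply: continuous_compact => //.
    by apply: continuous_subspaceT => x; exact: cvg_fst.
  have c2 : compact (snd @` closure S).
    apply: continuous_compact => //.
    by apply: continuous_subspaceT => x; exact: cvg_snd.
  have [C2 [_ hC2]] := compact_bounded c2.
  (* The second projection of the support is compact and misses 0, so the support keeps a positive
     distance [d] from the boundary. *)
  have : nbhs (0 : R) (~` (snd @` closure S)).
    apply: open_nbhs_nbhs; split.
      by apply: closed_openC; apply: compact_closed => //; exact: norm_hausdorff.
    by move=> [x /SH]; rewrite /half_plane /= => /[swap] ->; rewrite ltxx.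
  move=> /nbhs_ballP[d /= d0 hd].
  pose A := `|C1| + `|C2| + d^-1 + 1.
  have A1 : 0 < A by rewrite ltr_wpDl// !addr_ge0// invr_ge0 ltW.
  exists A => // x fx; have xS : closure S x by exact: subset_closure.
  have h1 : `|x.1| <= `|C1| + 1.
    by apply: hC1; [rewrite (le_lt_trans (ler_norm _))// ltrDl|exists x].
  have h2 : `|x.2| <= `|C2| + 1.
    by apply: hC2; [rewrite (le_lt_trans (ler_norm _))// ltrDl|exists x].
  have x0 : 0 < x.2 by exact: SH.
  have dx : d <= x.2.
    rewrite leNgt; apply/negP => xd.
    apply: (hd x.2); last by exists x.
    by rewrite /ball /= sub0r normrN gtr0_norm.
  have dA : A^-1 <= d.
    rewrite -[leRHS]invrK lef_pV2 ?posrE ?invr_gt0//.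
    by rewrite /A; have := normr_ge0 C1; have := normr_ge0 C2; lra.
  have di : 0 <= d^-1 by rewrite invr_ge0 ltW.
  move: h1 h2; rewrite !ler_norml => /andP[h1 h1'] /andP[h2 h2'].
  have := normr_ge0 C1; have := normr_ge0 C2.
  by split; rewrite /= in_itv /=; apply/andP; split; rewrite /A in dA *; lra.
have SA : closure [set x | f x != 0] `<=` box A.
  have /closure_id -> := @closed_box A; exact: closureS.
split=> //; last exact: subset_trans SA (box_half_plane A0).
by apply: subclosed_compact SA; [exact: closed_closure|exact: compact_box].
Qed.

Lemma gsupp_csupp f : gsupp f -> csupp f.
Proof. by move=> [A A0 h]; exists A => // x _; exact: h. Qed.

Lemma gsupp_sub f g : (forall x, f x = 0 -> g x = 0) -> gsupp f -> gsupp g.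
Proof.
move=> fg [A A0 h]; exists A => // x gx; apply: h.
by apply: contraNneq gx => /fg ->.
Qed.

Lemma gsuppM f g : gsupp f -> gsupp (fun x => g x * f x).
Proof. by apply: gsupp_sub => x ->; rewrite mulr0. Qed.

Lemma gsuppD f g : gsupp f -> gsupp g -> gsupp (fun x => f x + g x).
Proof.
move=> [A A0 hf] [B B0 hg]; exists (Num.max A B); first by rewrite lt_max A0.
move=> x n0; have [f0|f0] := eqVneq (f x) 0.
  apply: (@box_sub _ B) => //; first by rewrite le_max lexx orbT.
  by apply: hg => //; apply: contraNneq n0 => ->; rewrite f0 addr0.
by apply: (@box_sub _ A) => //; [rewrite le_max lexx|exact: hf].
Qed.

Lemma gsupp_partial j f : gsupp f -> gsupp (partial j f).
Proof.
move=> [A A0 h]; exists A => // x; apply: contra_neqP => nb.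
have nz : \near x, f x = cst 0 x.
  have : nbhs x (~` box A).
    by apply: open_nbhs_nbhs; split => //; apply: closed_openC; exact: closed_box.
  apply: filterS => y /= ny; apply/eqP; apply: contraPT ny => /h.
  by move=> ? ?.
by rewrite /partial (near_eq_derive _ nz) derive_cst.
Qed.

Definition tf (f : R * R -> R) : Prop := smooth f /\ gsupp f.

Lemma tf_partial j f : tf f -> tf (partial j f).
Proof. by move=> [sf gf]; split; [exact: smooth_partial|exact: gsupp_partial]. Qed.

Lemma tfB f g : tf f -> tf g -> tf (fun x => f x - g x).
Proof.
move=> [sf gf] [sg gg]; split; first exact: smoothB.
apply: gsuppD => //; apply: gsupp_sub gg => x ->; exact: oppr0.
Qed.

Lemma tfD f g : tf f -> tf g -> tf (fun x => f x + g x).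
Proof. by move=> [sf gf] [sg gg]; split; [exact: smoothD|exact: gsuppD]. Qed.

Lemma tfM f g : smooth g -> tf f -> tf (fun x => g x * f x).
Proof. by move=> sg [sf gf]; split; [exact: smoothM|exact: gsuppM]. Qed.

Lemma tf_locbd f : tf f -> locbd f.
Proof. by move=> [sf _]; apply: continuous_locbd; exact: smooth_continuous. Qed.

Lemma tf_csupp f : tf f -> csupp f.
Proof. by move=> [_ h]; exact: gsupp_csupp. Qed.

Lemma tf_inL2 f : tf f -> inL2 mu H f.
Proof. by move=> h; apply: locbd_inL2; [exact: tf_locbd|exact: tf_csupp]. Qed.

Lemma tf_measurable f : tf f -> mfun_half f.
Proof. by move=> /tf_locbd[]. Qed.

Lemma partialB j f g : tf f -> tf g ->
  partial j (fun x => f x - g x) = fun x => partial j f x - partial j g x.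
Proof.
move=> [sf _] [sg _]; apply/funext => x; rewrite /partial deriveB//.
  exact: smooth_derivable.
exact: smooth_derivable.
Qed.

(** Differentiability is asked for on vertical slices inside the half-plane only: in Hardy's
    inequality [F] contains a negative power of x_2. *)
Lemma int_Dsnd (F dF : R * R -> R) :
  csupp F -> locbd dF -> csupp dF ->
  (forall x, H x -> is_derive x.2 1 (fun t => F (x.1, t)) (dF x)) ->
  (forall x, H x -> {for x.2, continuous (fun t => dF (x.1, t))}) ->
  \int[mu]_(x in H) dF x = 0.
Proof.
move=> [A A0 sF] lF [A' A'0 sdF] dd cd.
have idF := locbd_integrable lF (ex_intro2 _ _ A' A'0 sdF).
rewrite /Rintegral (_ : (\int[mu]_(x in H) _)%E = 0%E)//.
have idF' : mu.-integrable setT ((EFin \o dF) \_ H) by apply/(integrable_mkcond _ mH).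
rewrite integral_mkcond.
have -> : (\int[mu]_x ((EFin \o dF) \_ H) x = \int[lam]_x \int[lam]_y ((EFin \o dF) \_ H) (x, y))%E.
  by apply/esym; apply: integral12_prod_meas1.
apply: integral0_eq => x _.
(* Strictly larger than both radii, so that [F] vanishes at the two ends [B^-1] and [B]. *)
pose B := Num.max A A' + 1.
have AB : A < B by rewrite /B ltr_pwDr// le_max lexx.
have A'B : A' < B by rewrite /B ltr_pwDr// le_max lexx orbT.
have B0 : 0 < B by exact: lt_trans AB.
have iB0 : 0 < B^-1 by rewrite invr_gt0.
have B1 : 1 <= B by rewrite /B lerDr le_max ltW.
have iB : B^-1 < A^-1 by rewrite ltf_pV2.
have iB' : B^-1 < A'^-1 by rewrite ltf_pV2.
have F0 t : 0 < t -> (t < A^-1) || (A < t) -> F (x, t) = 0.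
  move=> t0 h; apply/eqP/negPn/negP => /sF -/(_ t0) [_] /=.
  by rewrite in_itv/= => /andP[]; lra.
transitivity (\int[lam]_(t in `[(B^-1)%R, B]) (dF (x, t))%:E)%E.
  rewrite [RHS]integral_mkcond; apply: eq_integral => t _; rewrite !patchE.
  case: ifPn; rewrite ?inE ?notin_setE; last first.
    rewrite /half_plane /= => t0; case: ifPn => //; rewrite inE /= in_itv /=.
    by move=> /andP[h _]; exfalso; apply: t0; exact: lt_le_trans h.
  rewrite /half_plane /= => t0; case: ifPn => //; rewrite notin_setE /= in_itv /=.
  move=> h; congr EFin; apply/eqP/negPn/negP => /sdF -/(_ t0) [_] /=.
  by rewrite in_itv/= => /andP[h1 h2]; apply: h; lra.
apply: (@FTC_supp _ (fun t => F (x, t)) (fun t => dF (x, t))).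
- by rewrite (le_trans _ B1)// invf_le1.
- move=> t /andP[h _]; apply: (dd (x, t)); exact: lt_le_trans h.
- move=> t /andP[h _]; apply: (cd (x, t)); exact: lt_le_trans h.
- by apply: F0; rewrite ?iB.
- by apply: F0; rewrite ?AB ?orbT.
Qed.

Lemma int_Dfst (F dF : R * R -> R) :
  csupp F -> locbd dF -> csupp dF ->
  (forall x, H x -> is_derive x.1 1 (fun t => F (t, x.2)) (dF x)) ->
  (forall x, H x -> {for x.1, continuous (fun t => dF (t, x.2))}) ->
  \int[mu]_(x in H) dF x = 0.
Proof.
move=> [A A0 sF] lF [A' A'0 sdF] dd cd.
have idF := locbd_integrable lF (ex_intro2 _ _ A' A'0 sdF).
rewrite /Rintegral (_ : (\int[mu]_(x in H) _)%E = 0%E)//.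
have idF' : mu.-integrable setT ((EFin \o dF) \_ H) by apply/(integrable_mkcond _ mH).
rewrite integral_mkcond.
have -> : (\int[mu]_x ((EFin \o dF) \_ H) x = \int[lam]_y \int[lam]_x ((EFin \o dF) \_ H) (x, y))%E.
  by apply/esym; apply: integral21_prod_meas1.
apply: integral0_eq => y _.
have [y0|y0] := leP y 0.
  apply: integral0_eq => x _; rewrite patchE; case: ifPn => //.
  by rewrite inE /half_plane /= ltNge y0.
pose B := Num.max A A' + 1.
have AB : A < B by rewrite /B ltr_pwDr// le_max lexx.
have A'B : A' < B by rewrite /B ltr_pwDr// le_max lexx orbT.
have F0 t : (t < - A) || (A < t) -> F (t, y) = 0.
  move=> h; apply/eqP/negPn/negP => /sF -/(_ y0) [] /=.
  by rewrite in_itv/= => /andP[]; lra.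
transitivity (\int[lam]_(t in `[(- B)%R, B]) (dF (t, y))%:E)%E.
  rewrite [RHS]integral_mkcond; apply: eq_integral => t _; rewrite !patchE.
  rewrite mem_set//; case: ifPn => //; rewrite notin_setE /= in_itv /=.
  move=> h; congr EFin; apply/eqP/negPn/negP => /sdF -/(_ y0) [] /=.
  by rewrite in_itv/= => /andP[h1 h2]; exfalso; apply: h; lra.
apply: (@FTC_supp _ (fun t => F (t, y)) (fun t => dF (t, y))).
- by lra.
- by move=> t _; apply: (dd (t, y)); rewrite /half_plane.
- by move=> t _; apply: (cd (t, y)); rewrite /half_plane.
- by apply: F0; apply/orP; left; lra.
- by apply: F0; rewrite AB orbT.
Qed.

Lemma continuous_slice1 f (x : R * R) : continuous f -> {for x.2, continuous (fun t => f (x.1, t))}.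
Proof.
move=> cf; apply: (@continuous_comp _ _ _ (fun t => (x.1, t)) f); last exact: cf.
have h1 : (fun=> x.1 : R) @ x.2 --> (x.1 : R) by exact: cvg_cst.
have h2 : (fun t : R => t) @ x.2 --> (x.2 : R) by exact: cvg_id.
exact: (cvg_pair h1 h2).
Qed.

Lemma continuous_slice0 f (x : R * R) : continuous f -> {for x.1, continuous (fun t => f (t, x.2))}.
Proof.
move=> cf; apply: (@continuous_comp _ _ _ (fun t => (t, x.2)) f); last exact: cf.
have h1 : (fun=> x.2 : R) @ x.1 --> (x.2 : R) by exact: cvg_cst.
have h2 : (fun t : R => t) @ x.1 --> (x.1 : R) by exact: cvg_id.
exact: (cvg_pair h2 h1).
Qed.

Lemma int_partial j f : tf f -> \int[mu]_(x in H) partial j f x = 0.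
Proof.
move=> tff; have tfp := tf_partial j tff.
have cp : continuous (partial j f) by apply: smooth_continuous; case: tfp.
have h := tf_csupp tff; have h1 := tf_csupp tfp; have h2 := tf_locbd tfp.
have [e0|e1] : j = 0 \/ j = 1 by case: j {tfp cp h1 h2} => -[|[|//]] i; [left|right]; exact: val_inj.
  apply: int_Dfst h h2 h1 _ _ => x _; last exact: continuous_slice0.
  by apply/is_derive_slice0; rewrite e0; apply: smooth_is_derive; case: tff.
apply: int_Dsnd h h2 h1 _ _ => x _; last exact: continuous_slice1.
by apply/is_derive_slice1; rewrite e1; apply: smooth_is_derive; case: tff.
Qed.

End TestFunctions.

(** * Inequalities for test functions *)

Section TestInequalities.
Context {R : realType}.
Notation mu := (lebesgue_plane R).
Notation H := (@half_plane R).
Notation ip := (inner mu H).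
Implicit Types f g : R * R -> R.
Let mH := @measurable_half_plane R.

Lemma integrableZR (k : R) f : mu.-integrable H (EFin \o f) ->
  mu.-integrable H (EFin \o (fun x => k * f x)).
Proof. by move=> h; exact: (integrableZl mH k h). Qed.

Lemma integrableBR f g : mu.-integrable H (EFin \o f) -> mu.-integrable H (EFin \o g) ->
  mu.-integrable H (EFin \o (fun x => f x - g x)).
Proof. by move=> h h'; exact: (integrableB mH h h'). Qed.

Lemma integrableDR f g : mu.-integrable H (EFin \o f) -> mu.-integrable H (EFin \o g) ->
  mu.-integrable H (EFin \o (fun x => f x + g x)).
Proof. by move=> h h'; exact: (integrableD mH h h'). Qed.

Lemma is_derive_invX k (t : R) : 0 < t ->
  is_derive t 1 (fun t : R => t^-1 ^+ k) (- (k%:R) * t^-1 ^+ k.+1).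
Proof.
move=> t0; elim: k => [|k ih].
  by rewrite oppr0 mul0r; apply: is_derive_cst.
have h : is_derive t 1 (fun t : R => t^-1) (- t^-1 ^+ 2).
  split; first by apply: (@derivableV _ _ id); [rewrite /= gt_eqF|exact: derivable_id].
  have dI : derivable (id : R -> R) t 1 by exact: derivable_id.
  have t1 : id t != 0 by rewrite /= gt_eqF.
  rewrite (deriveV t1 dI).
  by rewrite derive_id /GRing.scale /= mulr1 exprVn.
have := is_deriveM h ih.
rewrite (_ : _ * _ = fun t : R => t^-1 ^+ k.+1); last by apply/funext => s; rewrite exprS.
move/is_derive_eq; apply; rewrite /GRing.scale /= !exprS -natr1; ring.
Qed.

(** The derivative d_2 (x_2^-(2q+1) f^2) has integral 0, and the right-hand integrand over 4 exceeds
    the left-hand one over 4 by half of it, up to the square of x_2^-q d_2 f - x_2^-(q+1) f / 2 and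
    q times a square. The constant 4 is the one for q = 0 and is merely convenient for larger q; the
    case q = 1 is meant for stream functions. *)
Lemma hardy q f : tf f ->
  ip (fun x => x.2^-1 ^+ q.+1 * f x) (fun x => x.2^-1 ^+ q.+1 * f x) <=
  4 * ip (fun x => x.2^-1 ^+ q * partial 1 f x) (fun x => x.2^-1 ^+ q * partial 1 f x).
Proof.
move=> tff; have tfp := tf_partial 1 tff.
have [lf cf] := (tf_locbd tff, tf_csupp tff).
have [lp cp] := (tf_locbd tfp, tf_csupp tfp).
pose V (x : R * R) := x.2^-1; pose df := partial 1 f.
have lV k : locbd (fun x => V x ^+ k) by apply: locbdX; exact: locbd_inv2.
pose F x := V x ^+ (2 * q).+1 * (f x * f x).
pose dF x := V x ^+ (2 * q).+1 * (2 * f x * df x) - (2 * q).+1%:R * V x ^+ (2 * q).+2 * (f x * f x).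
have ldF : locbd dF.
  apply: locbdB; apply: locbdM; do ?[exact: lV | exact: locbdM | exact: locbd_cst].
    by apply: locbdM => //; apply: locbdM => //; exact: locbd_cst.
  by apply: locbdM; [exact: locbd_cst|exact: lV].
have cdF : csupp dF.
  have [A A0 h] := cf; exists A => // x Hx; apply: contra_neqP => nb.
  have f0 : f x = 0 by apply/eqP; apply: contrapT => /negP /(h _ Hx).
  by rewrite /dF f0; ring.
have I0 : \int[mu]_(x in H) dF x = 0.
  apply: (@int_Dsnd _ F) => //.
  - by apply: csuppM; exact: csuppM.
  - move=> x Hx.
    have h1 := is_derive_invX (2 * q).+1 Hx.
    have h2 : is_derive x.2 1 (fun t => f (x.1, t)) (df x).
      by apply/is_derive_slice1; apply: smooth_is_derive; case: tff.
    apply: (is_derive_eq (is_deriveM h1 (is_deriveM h2 h2))).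
    rewrite /dF /V /GRing.scale /= -surjective_pairing.
    have -> : ((fun t : R => f (x.1, t)) * (fun t : R => f (x.1, t))) x.2 = f x * f x.
      by case: (x).
    by ring.
  - move=> x Hx.
    have cV k : {for x.2, continuous (fun t : R => t^-1 ^+ k)}.
      apply: (@continuous_comp _ _ _ (fun t : R => t^-1) (fun t => t ^+ k)).
        by apply: inv_continuous; rewrite gt_eqF.
      exact: exprn_continuous.
    have c1 : {for x.2, continuous (fun t => f (x.1, t))}.
      by apply: continuous_slice1; apply: smooth_continuous; case: tff.
    have c2 : {for x.2, continuous (fun t => df (x.1, t))}.
      by apply: continuous_slice1; apply: smooth_continuous; case: tfp.
    apply: cvgB; apply: cvgM; do ?[exact: cV|exact: cvgM].
      by apply: cvgM => //; apply: cvgM => //; exact: cvg_cst.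
    by apply: cvgM => //; [exact: cvg_cst|exact: cV].
have Ia : inL2 mu H (fun x => V x ^+ q.+1 * f x).
  by apply: locbd_inL2; [exact: locbdM|exact: csuppM].
have Ib : inL2 mu H (fun x => V x ^+ q * df x).
  by apply: locbd_inL2; [exact: locbdM|exact: csuppM].
have : 2^-1 * \int[mu]_(x in H) dF x <=
  ip (fun x => V x ^+ q * df x) (fun x => V x ^+ q * df x)
  - 4^-1 * ip (fun x => V x ^+ q.+1 * f x) (fun x => V x ^+ q.+1 * f x).
  have i1 := locbd_integrable ldF cdF.
  rewrite /inner -!RintegralZl//; [|exact: inL2_mul..].
  rewrite -RintegralB//; [|exact: inL2_mul|by apply: integrableZR => //; exact: inL2_mul].
  apply: le_Rintegral => //.
  - exact: integrableZR.
  - by apply: integrableBR => //; [exact: inL2_mul|apply: integrableZR => //; exact: inL2_mul].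
  move=> x Hx; rewrite -subr_ge0.
  rewrite [X in 0 <= X](_ : _ = (V x ^+ q * df x - 2^-1 * (V x ^+ q.+1 * f x)) ^+ 2 +
     q%:R * (V x ^+ q.+1 * f x) ^+ 2).
    by rewrite addr_ge0 ?sqr_ge0// mulr_ge0// sqr_ge0.
  rewrite /dF (_ : (2 * q).+1%:R = 2 * q%:R + 1 :> R); last by rewrite -natr1 natrM.
  by rewrite !exprS mulnC !exprM; field.
by rewrite I0 mulr0; rewrite /V /df; lra.
Qed.
End TestInequalities.

(** * Estimates on horizontal and vertical slices *)

Section SliceInequalities.
Context {R : realType}.
Notation mu := (lebesgue_plane R).
Notation lam := (@lebesgue_measure R).
Notation H := (@half_plane R).
Notation ip := (inner mu H).
Implicit Types f g : R * R -> R.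
Let mH := @measurable_half_plane R.

Lemma measurable_int_slice1 (f : R * R -> \bar R) :
  mfun_half f -> (forall x, H x -> (0 <= f x)%E) ->
  measurable_fun (setT : set (measurableTypeR R))
    (fun x => \int[lam]_(y in `]0%R, +oo[) f (x, y))%E.
Proof.
move=> mf f0; apply: (eq_measurable_fun (fubini_F lam (f \_ H))).
  move=> x _; rewrite /fubini_F [RHS]integral_mkcond; apply: eq_integral => y _.
  rewrite !patchE.
  by do 2 case: ifPn; rewrite ?inE ?notin_setE /half_plane /= in_itv/= andbT.
apply: measurable_fun_fubini_tonelli_F; first exact/(measurable_restrictT _ _).1.
by move=> x; rewrite patchE; case: ifPn => // /set_mem/f0.
Qed.

Lemma measurable_int_slice2 (f : R * R -> \bar R) :
  mfun_half f -> (forall x, H x -> (0 <= f x)%E) ->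
  mfun_pos (fun y => \int[lam]_x f (x, y))%E.
Proof.
move=> mf f0; apply: (eq_measurable_fun (fubini_G lam (f \_ H))).
  move=> y; rewrite inE /= in_itv /= andbT => y0; rewrite /fubini_G; apply: eq_integral => x _.
  by rewrite patchE mem_set.
apply: (measurable_funS measurableT) => //.
apply: measurable_fun_fubini_tonelli_G; first exact/(measurable_restrictT _ _).1.
by move=> x; rewrite patchE; case: ifPn => // /set_mem/f0.
Qed.

Lemma tf_derive0 f (y : R) : tf f ->
  forall t : R, is_derive t 1 (fun t => f (t, y)) (partial 0 f (t, y)).
Proof.
move=> [sf _] t; apply/(is_derive_slice0 f (t, y)); exact: smooth_is_derive.
Qed.

Lemma tf_derive1 f (x : R) : tf f ->
  forall t : R, is_derive t 1 (fun t => f (x, t)) (partial 1 f (x, t)).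
Proof.
move=> [sf _] t; apply/(is_derive_slice1 f (x, t)); exact: smooth_is_derive.
Qed.

Lemma tf_cont0 f (y : R) : tf f -> continuous (fun t => f (t, y)).
Proof.
by move=> [sf _] t; apply: (@continuous_slice0 _ f (t, y)); exact: smooth_continuous.
Qed.

Lemma tf_cont1 f (x : R) : tf f -> continuous (fun t => f (x, t)).
Proof.
by move=> [sf _] t; apply: (@continuous_slice1 _ f (x, t)); exact: smooth_continuous.
Qed.

Lemma tf_zero f (x : R * R) : tf f -> x.2 <= 0 -> f x = 0.
Proof.
move=> [_ [A A0 h]] x0; apply/eqP/negPn/negP => /h/(box_half_plane A0).
by rewrite /half_plane /= ltNge x0.
Qed.

Lemma tf_zero_left f : tf f -> exists2 A, 0 < A & forall x y : R, x < - A -> f (x, y) = 0.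
Proof.
move=> [_ [A A0 h]]; exists A => // x y xA; apply/eqP/negPn/negP => /h[].
by rewrite /= in_itv/= => /andP[]; lra.
Qed.

Lemma tf_sup_slice f (x y : R) : tf f ->
  ((f (x, y) ^+ 2)%:E <=
   \int[lam]_t (2 * `|f (t, y)| * `|partial 0 f (t, y)|)%:E)%E.
Proof.
move=> tff; have [A A0 fA] := tf_zero_left tff.
(* The integration starts to the left of both [x] and the support of [f]. *)
apply: (@sq_le_int_prod _ (fun t => f (t, y)) (fun t => partial 0 f (t, y))
   (Num.min x (- A - 1)) x).
- exact: tf_derive0.
- by apply: tf_cont0; exact: tf_partial.
- by apply: fA; rewrite gt_min; apply/orP; right; lra.
- by rewrite ge_min lexx.
Qed.

Lemma tf_slice_sq f (y : R) : tf f -> 0 < y ->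
  (\int[lam]_x (f (x, y) ^+ 2)%:E <= (y * ip (partial 1 f) (partial 1 f))%:E)%E.
Proof.
move=> tff y0; have tfp := tf_partial 1 tff.
have mp2 : mfun_half (fun x => (partial 1 f x ^+ 2)%:E).
  by apply/measurable_EFinP; apply: measurable_funX; exact: tf_measurable.
rewrite EFinM -(ipE mH (tf_inL2 tfp)) tonelli_H1//; last first.
  by move=> x _; rewrite lee_fin sqr_ge0.
rewrite -ge0_integralZl_EFin//; last first.
- exact: ltW.
- by apply: (measurable_int_slice1 mp2) => x _; rewrite lee_fin sqr_ge0.
- by move=> x _; apply: integral_ge0 => t _; rewrite lee_fin sqr_ge0.
apply: ge0_le_integral => //.
- by move=> x _; rewrite lee_fin sqr_ge0.
- apply: (measurable_slice1 (f := fun x => (f x ^+ 2)%:E)) => //.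
  by apply/measurable_EFinP; apply: measurable_funX; exact: tf_measurable.
- apply: measurable_funeM.
  by apply: (measurable_int_slice1 mp2) => z _; rewrite lee_fin sqr_ge0.
move=> x _; apply: (@sq_le_int_sq _ (fun t => f (x, t))) => //.
- exact: tf_derive1.
- by apply: tf_cont1.
- exact: tf_zero.
Qed.

Lemma tf_weight (m : R -> R) f :
  mfun_pos m -> tf f ->
  (\int[mu]_(x in H) ((m x.2 * f x) ^+ 2)%:E <=
   (\int[lam]_(y in `]0%R, +oo[) (y * m y ^+ 2)%:E) *
     (ip (partial 1 f) (partial 1 f))%:E)%E.
Proof.
move=> mm tff.
have mm2 : mfun_half (fun x => m x.2).
  apply: (@measurable_comp _ _ _ (plane R) (measurableTypeR R) _ _ m half_plane snd (measurable_itv `]0, +oo[)) => //.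
    by move=> _ [x Hx <-] /=; rewrite in_itv /= andbT.
  by apply: (measurable_funS measurableT) => //; exact: measurable_snd.
have mmf : mfun_half (fun x => ((m x.2 * f x) ^+ 2)%:E).
  apply/measurable_EFinP; apply: measurable_funX; apply: measurable_funM => //.
  exact: tf_measurable.
have my : mfun_pos (fun y => (y * m y ^+ 2)%:E).
  apply/measurable_EFinP; apply: measurable_funM => //.
  exact: measurable_funX.
rewrite tonelli_H//; last by move=> x _; rewrite lee_fin sqr_ge0.
rewrite -ge0_integralZr//; last first.
- by rewrite lee_fin ip_ge0.
- by move=> y; rewrite /= in_itv /= andbT => y0; rewrite lee_fin mulr_ge0 ?sqr_ge0 ?ltW.
apply: ge0_le_integral => //.
- by move=> y _; apply: integral_ge0 => x _; rewrite lee_fin sqr_ge0.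
- by apply: (measurable_int_slice2 mmf) => x _; rewrite lee_fin sqr_ge0.
- by apply: emeasurable_funM => //; exact: measurable_cst.
move=> y; rewrite /= in_itv /= andbT => y0.
under eq_integral do rewrite exprMn EFinM.
rewrite ge0_integralZl_EFin//; last first.
- exact: sqr_ge0.
- apply: (measurable_slice1 (f := fun x => (f x ^+ 2)%:E)) => //.
  by apply/measurable_EFinP; apply: measurable_funX; exact: tf_measurable.
- by move=> x _; rewrite lee_fin sqr_ge0.
rewrite (_ : (y * m y ^+ 2)%:E = ((m y ^+ 2)%:E * y%:E)%E); last by rewrite -EFinM mulrC.
rewrite -muleA; apply: lee_wpmul2l; first by rewrite lee_fin sqr_ge0.
by rewrite -EFinM; exact: tf_slice_sq.
Qed.

(** A Ladyzhenskaya-type inequality. On the line at height y, f^2 is at most the integral of 2 |f|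
    |d_1 f|, while the integral of g^2 is at most y |d_2 g|^2. The weight y^-2 leaves 2 y^-1 |f|
    |d_1 f|, which is integrable by Young's and Hardy's inequalities. This is the bound on the
    convective term that holds without any smallness. *)
Lemma tf_ladyzhenskaya f g : tf f -> tf g ->
  (\int[mu]_(x in H) ((x.2^-1 * (f x * g x)) ^+ 2)%:E <=
   (4 * (ip (partial 0 f) (partial 0 f) + ip (partial 1 f) (partial 1 f)) *
     ip (partial 1 g) (partial 1 g))%:E)%E.
Proof.
move=> tff tfg; set G := ip (partial 1 g) (partial 1 g).
have G0 : 0 <= G by exact: ip_ge0.
have [tf0 tf1] := (tf_partial 0 tff, tf_partial 1 tff).
pose V (x : R * R) := x.2^-1.
have lV : locbd V by exact: locbd_inv2.
have [lf lg] := (tf_locbd tff, tf_locbd tfg).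
have lf0 := tf_locbd tf0.
pose psi x := 2 * `|f x| * `|partial 0 f x|.
have mpsi : mfun_half psi.
  apply: measurable_funM; first apply: measurable_funM => //.
    by apply: measurableT_comp => //; case: lf.
  by apply: measurableT_comp => //; case: lf0.
have psi0 x : 0 <= psi x by rewrite /psi !mulr_ge0.
have mF : mfun_half (fun x => ((V x * (f x * g x)) ^+ 2)%:E).
  by apply/measurable_EFinP; apply: measurable_funX; case: (locbdM lV (locbdM lf lg)).
have mP : mfun_half (fun x => (psi x * (V x * G))%:E).
  apply/measurable_EFinP; apply: measurable_funM => //; apply: measurable_funM => //.
  by case: lV.
have P0 x : H x -> (0 <= (psi x * (V x * G))%:E)%E.
  by move=> Hx; rewrite lee_fin !mulr_ge0// invr_ge0 ltW.
apply: (@le_trans _ _ (\int[mu]_(x in H) (psi x * (V x * G))%:E)%E).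
  rewrite !tonelli_H//; last by move=> x _; rewrite lee_fin sqr_ge0.
  apply: ge0_le_integral => //.
  - by move=> y _; apply: integral_ge0 => x _; rewrite lee_fin sqr_ge0.
  - by apply: (measurable_int_slice2 mF) => x _; rewrite lee_fin sqr_ge0.
  - exact: (measurable_int_slice2 mP).
  move=> y; rewrite /= in_itv /= andbT => y0.
  have mpsiy : measurable_fun setT (fun x : measurableTypeR R => (psi (x, y))%:E).
    by apply: (measurable_slice1 (f := fun x => (psi x)%:E)) => //; exact/measurable_EFinP.
  have mgy : measurable_fun setT (fun x : measurableTypeR R => (g (x, y) ^+ 2)%:E).
    apply: (measurable_slice1 (f := fun x => (g x ^+ 2)%:E)) => //.
    by apply/measurable_EFinP; apply: measurable_funX; case: lg.
  pose a := (\int[lam]_t (psi (t, y))%:E)%E.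
  have a0 : (0 <= a)%E by apply: integral_ge0 => t _; rewrite lee_fin.
  apply: (@le_trans _ _ (\int[lam]_x (a * ((y^-1 ^+ 2)%:E * (g (x, y) ^+ 2)%:E)))%E).
    apply: ge0_le_integral => //.
    - by move=> x _; rewrite lee_fin sqr_ge0.
    - exact: (measurable_slice1 mF).
    - by apply: measurable_funeM; exact: measurable_funeM.
    move=> x _; rewrite (_ : (V (x, y) * (f (x, y) * g (x, y))) ^+ 2 =
       f (x, y) ^+ 2 * (y^-1 ^+ 2 * g (x, y) ^+ 2)); last by rewrite /V /=; ring.
    rewrite EFinM; apply: (@lee_wpmul2r _ (y^-1 ^+ 2 * g (x, y) ^+ 2)%:E).
      by rewrite lee_fin mulr_ge0 ?sqr_ge0.
    exact: tf_sup_slice.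
  rewrite ge0_integralZl//; last 2 first.
  - exact: measurable_funeM.
  - by move=> x _; rewrite -EFinM lee_fin mulr_ge0 ?sqr_ge0.
  rewrite ge0_integralZl_EFin//; last 2 first.
  - by move=> x _; rewrite lee_fin sqr_ge0.
  - by rewrite sqr_ge0.
  have -> : (\int[lam]_x (psi (x, y) * (V (x, y) * G))%:E = a * (y^-1 * G)%:E)%E.
    rewrite -ge0_integralZr//; first by move=> x _; rewrite lee_fin.
    by rewrite lee_fin mulr_ge0// invr_ge0 ltW.
  apply: lee_wpmul2l => //.
  apply: (@le_trans _ _ ((y^-1 ^+ 2)%:E * (y * G)%:E)%E).
    by apply: lee_wpmul2l; [rewrite lee_fin sqr_ge0|exact: tf_slice_sq].
  by rewrite -EFinM lee_fin /V /= expr2 -mulrA (mulrA _ y) mulVf ?mul1r// gt_eqF.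
have Ia : inL2 mu H (fun x => x.2^-1 ^+ 1 * f x).
  by apply: locbd_inL2; [apply: locbdM => //; exact: locbdX|apply: csuppM; exact: tf_csupp].
have Ib := tf_inL2 tf0.
apply: (@le_trans _ _ (\int[mu]_(x in H) (G * ((x.2^-1 ^+ 1 * f x) ^+ 2 + partial 0 f x ^+ 2))%:E)%E).
  apply: ge0_le_integral => //.
    apply/measurable_EFinP; apply: measurable_funM => //; apply: measurable_funD.
      by apply: measurable_funX; case: Ia.
    by apply: measurable_funX; case: Ib.
  move=> x Hx; rewrite lee_fin mulrA mulrC ler_wpM2l// /psi /V expr1 -real_normK ?num_real//.
  rewrite -[X in _ + X]real_normK ?num_real// normrM ger0_norm; last by rewrite invr_ge0 ltW.
  have := sqr_ge0 (x.2^-1 * `|f x| - `|partial 0 f x|); lra.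
under eq_integral do rewrite EFinM EFinD.
rewrite ge0_integralZl_EFin//; last 2 first.
- by move=> x _; rewrite -EFinD lee_fin addr_ge0 ?sqr_ge0.
- apply: emeasurable_funD; apply/measurable_EFinP; apply: measurable_funX.
    by case: Ia.
  by case: Ib.
rewrite ge0_integralD//; last 4 first.
- by move=> x _; rewrite lee_fin sqr_ge0.
- by apply/measurable_EFinP; apply: measurable_funX; case: Ia.
- by move=> x _; rewrite lee_fin sqr_ge0.
- by apply/measurable_EFinP; apply: measurable_funX; case: Ib.
rewrite (ipE mH Ia) (ipE mH Ib) -EFinD -EFinM lee_fin mulrC ler_wpM2r//.
have hd : ip (fun x => x.2^-1 ^+ 1 * f x) (fun x => x.2^-1 ^+ 1 * f x) <=
    4 * ip (partial 1 f) (partial 1 f).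
  apply: (le_trans (hardy 0 tff)); rewrite le_eqVlt; apply/orP; left; apply/eqP.
  by congr (4 * _); apply: eq_ip => x _; rewrite expr0 mul1r.
have := ip_ge0 mu H (partial 0 f).
move: hd; move: (ip (partial 0 f) (partial 0 f)) (ip (partial 1 f) (partial 1 f)).
by move: (ip _ _) => a b c; lra.
Qed.
End SliceInequalities.

(** * Stream functions *)

Section Stream.
Context {R : realType}.
Notation lam := (@lebesgue_measure R).
Implicit Types f g : R * R -> R.
Let mH := @measurable_half_plane R.

Lemma continuous_integrable_itv (g : R -> R) (a b : R) : continuous g ->
  lam.-integrable `[a, b] (EFin \o g).
Proof.
move=> cg; apply: continuous_compact_integrable; first exact: segment_compact.
exact: continuous_subspaceT.
Qed.

(** Below [c] the primitive is identically 0, also at negative arguments, where the interval of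
    integration is empty; from [c] on, the fundamental theorem applies at an interior point. *)
Lemma is_derive_primitive (g : R -> R) (c x : R) : continuous g -> 0 < c ->
  (forall t, t < c -> g t = 0) ->
  is_derive x 1 (fun y => \int[lam]_(t in `[0, y]) g t) (g x).
Proof.
move=> cg c0 gc; have [xc|cx] := ltP x c.
  rewrite gc//; have d0 := @is_derive_cst R R R 0 x 1.
  apply: near_eq_is_derive d0; near=> t; have tc : t < c by near: t; exact: lt_nbhsl.
  rewrite /Rintegral integral0_eq// => s /=; rewrite in_itv /= => /andP[_ st].
  by rewrite gc//; exact: le_lt_trans tc.
have x0 : 0 < x by exact: lt_le_trans cx.
have [d1 d2] := @continuous_FTC1_closed _ g 0 x (x + 1) (ltr_pwDr ltr01 (lexx x))
  (continuous_integrable_itv 0 (x + 1) cg) x0 (cg x).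
by split=> //; rewrite -derive1E.
Unshelve. all: by end_near. Qed.

Lemma tf_bounded f : tf f -> exists2 C, 0 <= C & forall x, `|f x| <= C.
Proof.
move=> tff; have [lf [A A0 fA]] := (tf_locbd tff, tff.2).
have [C hC] := lf.2 A A0; exists `|C| => // x.
have [->|/fA bx] := eqVneq (f x) 0; first by rewrite normr0.
by rewrite (le_trans (hC _ bx))// ler_norm.
Qed.

Variables phi1 phi2 : R * R -> R.
Hypotheses (t1 : tf phi1) (t2 : tf phi2).
Hypothesis div0 : forall x, partial 0 phi1 x + partial 1 phi2 x = 0.

(** The stream function normalised to vanish on the boundary: its derivatives are d_2 = [phi1] and
    d_1 = -[phi2]. *)
Definition stream (x : R * R) : R := \int[lam]_(t in `[0, x.2]) phi1 (x.1, t).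

Lemma tf_zero_below f : tf f -> exists2 c, 0 < c & forall x t : R, t < c -> f (x, t) = 0.
Proof.
move=> [_ [A A0 h]]; exists A^-1; first by rewrite invr_gt0.
move=> x t tc; apply/eqP/negPn/negP => /h[_ /=].
by rewrite in_itv/= => /andP[]; lra.
Qed.

Lemma stream_is_derive1 (x : R * R) : is_derive x.2 1 (fun t => stream (x.1, t)) (phi1 x).
Proof.
have [c c0 h] := tf_zero_below t1; rewrite [in phi1 _](surjective_pairing x).
by apply: (@is_derive_primitive (fun t => phi1 (x.1, t)) c) => //; [exact: tf_cont1|exact: h].
Qed.

(** Differentiation under the integral gives the integral of d_1 phi1 = -d_2 phi2 over a vertical
    segment, and phi2 vanishes at its lower end. *)
Lemma stream_is_derive0 (x : R * R) : is_derive x.1 1 (fun t => stream (t, x.2)) (- phi2 x).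
Proof.
have tp := tf_partial 0 t1; have [C C0 hC] := tf_bounded tp.
have [x20|x20] := ltP x.2 0.
  rewrite (_ : (fun t => stream (t, x.2)) = cst 0).
    by rewrite (tf_zero t2) ?ltW// oppr0; exact: is_derive_cst.
  apply/funext => t; rewrite /stream /= set_itv_ge ?Rintegral_set0// bnd_simp.
  by rewrite -ltNge.
pose f (a b : R) := phi1 (a, b).
have Ia : `]x.1 - 1, x.1 + 1[%classic x.1.
  by rewrite /= in_itv /=; apply/andP; split; lra.
have intf y : `]x.1 - 1, x.1 + 1[%classic y ->
    lam.-integrable `[0, x.2] (EFin \o f y).
  by move=> _; apply: continuous_integrable_itv; exact: tf_cont1.
have derf y z : `]x.1 - 1, x.1 + 1[%classic y -> `[0, x.2]%classic z -> derivable (f ^~ z) y 1.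
  by move=> _ _; have [] := tf_derive0 z t1 y.
have intG : lam.-integrable `[0, x.2] (EFin \o (fun=> C)).
  by apply: continuous_integrable_itv => t; exact: cvg_cst.
have dE y z : 'D_1 (f ^~ z) y = partial 0 phi1 (y, z).
  by have [_] := tf_derive0 z t1 y.
have Gub y z : `]x.1 - 1, x.1 + 1[%classic y -> `[0, x.2]%classic z ->
    `|partial1of2 f y z| <= C.
  by move=> _ _; rewrite partial1of2E dE.
have h1 := @derivable_under_integral R _ (measurableTypeR R) lam f _ (measurable_itv `[0, x.2]) _ _ _ Ia intf derf (fun=> C) (fun=> C0) intG Gub.
have h2 := @differentiation_under_integral R _ (measurableTypeR R) lam f _ (measurable_itv `[0, x.2]) _ _ _ Ia intf derf (fun=> C) (fun=> C0) intG Gub.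
split; first exact: h1.
rewrite -derive1E; rewrite [LHS]h2.
have h3 := @FTC_line _ (fun t => phi2 (x.1, t)) (fun t => partial 1 phi2 (x.1, t)) 0 x.2 x20
  (fun t _ => tf_derive1 x.1 t2 t) (fun t _ => @tf_cont1 R _ x.1 (tf_partial 1 t2) t).
rewrite (tf_zero (x := (x.1, 0)) t2)// subr0 -surjective_pairing in h3.
rewrite /Rintegral (@eq_integral _ _ _ lam _ (fun t => (-1)%:E * (partial 1 phi2 (x.1, t))%:E)%E).
  rewrite integralZl//; last first.
    by apply: continuous_integrable_itv; apply: tf_cont1; exact: tf_partial.
  by rewrite [X in (_ * X)%E]h3 -EFinM /= mulN1r.
move=> t _; rewrite partial1of2E dE -EFinM mulN1r; congr EFin.
by apply/eqP; rewrite -addr_eq0 div0.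
Qed.

Lemma derive_lipschitz (h dh : R -> R) (C : R) : (forall t : R, is_derive t 1 h (dh t)) ->
  (forall t, `|dh t| <= C) -> forall a b, `|h b - h a| <= C * `|b - a|.
Proof.
move=> hd bd a b; wlog ab : a b / a <= b.
  by move=> hw; have [/hw//|/ltW/hw] := leP a b; rewrite distrC (distrC a).
have ch : continuous h.
  move=> t; have [d _] := hd t; apply: differentiable_continuous.
  exact/derivable1_diffP.
have [c _ ->] := MVT_segment ab (fun x _ => hd x) (continuous_subspaceT ch).
by rewrite normrM ler_wpM2r.
Qed.

(** Both partial derivatives are bounded, so a path along the two coordinate directions gives a
    Lipschitz estimate. *)
Lemma stream_continuous : continuous stream.
Proof.
have [C1 C10 h1] := tf_bounded t1; have [C2 C20 h2] := tf_bounded t2.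
move=> x; apply/cvgrPdist_le => e e0.
pose d := e / (C1 + C2 + 1).
have D0 : 0 < C1 + C2 + 1 by rewrite ltr_wpDl// addr_ge0.
have d0 : 0 < d by rewrite divr_gt0.
have : nbhs x (ball x d) by exact: nbhsx_ballx.
apply: filterS => y [b1 b2].
have e1 := @derive_lipschitz (fun t => stream (t, x.2)) (fun t => - phi2 (t, x.2)) C2
   (fun t => stream_is_derive0 (t, x.2)) _ x.1 y.1.
have e2 := @derive_lipschitz (fun t => stream (y.1, t)) (fun t => phi1 (y.1, t)) C1
   (fun t => stream_is_derive1 (y.1, t)) (fun t => h1 _) x.2 y.2.
have {}e1 : `|stream (y.1, x.2) - stream (x.1, x.2)| <= C2 * `|y.1 - x.1|.
  by apply: e1 => t; rewrite normrN.
move: b1 b2; rewrite /ball /= => b1 b2; rewrite distrC in b1; rewrite distrC in b2.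
rewrite -!surjective_pairing in e1 e2.
rewrite distrC (_ : stream y - stream x = (stream y - stream (y.1, x.2)) +
   (stream (y.1, x.2) - stream x)); last by ring.
apply: (le_trans (ler_normD _ _)); apply: (le_trans (lerD e2 e1)).
apply: (@le_trans _ _ (C1 * d + C2 * d)).
  by apply: lerD; apply: ler_wpM2l => //; exact: ltW.
rewrite -mulrDl /d mulrA ler_pdivrMr// mulrC ler_wpM2l ?ltW//.
by lra.
Qed.

Lemma partial_stream0 : partial 0 stream = fun x => - phi2 x.
Proof.
apply/funext => x; apply: partialE.
by apply/is_derive_slice0; exact: stream_is_derive0.
Qed.

Lemma partial_stream1 : partial 1 stream = phi1.
Proof.
apply/funext => x; apply: partialE.
by apply/is_derive_slice1; exact: stream_is_derive1.
Qed.

Lemma ord2 (j : 'I_2) : j = 0 \/ j = 1.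
Proof. by case: j => -[|[|//]] i; [left|right]; exact: val_inj. Qed.

Lemma stream_smooth : smooth stream.
Proof.
apply: smoothI; first exact: stream_continuous.
- move=> j x; have [->|->] := ord2 j.
    by have [] := (is_derive_slice0 stream x _).2 (stream_is_derive0 x).
  by have [] := (is_derive_slice1 stream x _).2 (stream_is_derive1 x).
- move=> j; have [->|->] := ord2 j; last by rewrite partial_stream1; case: t1.
  rewrite partial_stream0 (_ : (fun x => - phi2 x) = fun x => (-1) * phi2 x).
    by apply: smoothM; [exact: smooth_cst|case: t2].
  by apply/funext => x; rewrite mulN1r.
Qed.

(** The critical region lies above the supports, where the value is the full flux of [phi1] through
    a vertical line. It does not depend on x_1 there, because [phi2] vanishes, and it is 0 far to
    the right. *)
Lemma stream_gsupp : gsupp stream.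
Proof.
have [A A0 h1] := t1.2; have [B B0 h2] := t2.2.
pose M := Num.max A B.
have MA : A <= M by rewrite le_max lexx.
have MB : B <= M by rewrite le_max lexx orbT.
have M0 : 0 < M by exact: lt_le_trans MA.
have k1 x : phi1 x != 0 -> box M x by move=> /h1; exact: box_sub.
have k2 x : phi2 x != 0 -> box M x by move=> /h2; exact: box_sub.
have z0 x : (forall t, 0 <= t -> t <= x.2 -> phi1 (x.1, t) = 0) -> stream x = 0.
  move=> hz; rewrite /stream /Rintegral integral0_eq// => t /=.
  by rewrite in_itv /= => /andP[a b]; rewrite hz.
have z1 x : x.2 < M^-1 -> stream x = 0.
  move=> xM; apply: z0 => t _ tx; apply/eqP/negPn/negP => /k1[_ /=].
  by rewrite in_itv/= => /andP[]; lra.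
have z2 x : (x.1 < - M) || (M < x.1) -> stream x = 0.
  move=> xM; apply: z0 => t _ tx; apply/eqP/negPn/negP => /k1[/= + _].
  by rewrite in_itv/= => /andP[]; lra.
have z3 x : M < x.2 -> stream x = 0.
  move=> xM; have := @derive_lipschitz (fun t => stream (t, x.2)) (fun t => - phi2 (t, x.2)) 0
   (fun t => stream_is_derive0 (t, x.2)) _ (M + 1) x.1.
  move=> /(_ _)/wrap[].
    move=> t; rewrite normrN normr_le0; apply/negPn/negP => /k2[_ /=].
    by rewrite in_itv/= => /andP[]; lra.
  rewrite mul0r (z2 (M + 1, x.2)) ?subr0 ?normr_le0 -?surjective_pairing; first by move/eqP.
  by rewrite /= ltrDl ltr01 orbT.
exists M => // x sx; split; rewrite /= in_itv /=.
  rewrite !leNgt; apply/andP; split; apply: contra_neqN sx => xM.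
    by apply: z2; rewrite xM.
  by apply: z2; rewrite xM orbT.
rewrite !leNgt; apply/andP; split; apply: contra_neqN sx => xM; [exact: z1|exact: z3].
Qed.

Lemma tf_stream : tf stream.
Proof. by split; [exact: stream_smooth|exact: stream_gsupp]. Qed.

End Stream.

(** * Size and growth of stream functions *)

Section StreamBounds.
Context {R : realType}.
Notation mu := (lebesgue_plane R).
Notation lam := (@lebesgue_measure R).
Notation H := (@half_plane R).
Notation ip := (inner mu H).
Let mH := @measurable_half_plane R.

Variables phi1 phi2 : R * R -> R.
Hypotheses (t1 : tf phi1) (t2 : tf phi2).
Hypothesis div0 : forall x, partial 0 phi1 x + partial 1 phi2 x = 0.
Notation Phi := (stream phi1).
Notation G := (ip (partial 1 phi1) (partial 1 phi1)).
Notation G2 := (ip (partial 1 phi2) (partial 1 phi2)).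

(** On vertical lines Phi^2 is at most y times the integral of phi1^2 up to height y. The horizontal
    slices of phi1^2 are at most s G, crudely y G, over an interval of length y. *)
Lemma stream_slice_sq (y : R) : 0 < y ->
  (\int[lam]_x (Phi (x, y) ^+ 2)%:E <= (y ^+ 3 * G)%:E)%E.
Proof.
move=> y0; have tPhi := tf_stream t1 t2 div0.
pose h (x : R * R) := phi1 x ^+ 2 * (x.2 <= y)%R%:R.
have mh : mfun_half (EFin \o h).
  apply/measurable_EFinP; apply: measurable_funM.
    by apply: measurable_funX; exact: tf_measurable.
  rewrite (_ : (fun x => _) = (\1_(setT `*` `]-oo, y]) : plane R -> R)).
    by apply: measurable_indic; exact: measurableX.
  apply/funext => x; rewrite indicE; congr (_%:R); congr nat_of_bool.
  apply/idP/idP; first by move=> h1; rewrite inE; split => //=; rewrite in_itv.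
  by rewrite inE => -[_]; rewrite /= in_itv.
have h0 x : (0 <= (EFin \o h) x)%E by rewrite lee_fin mulr_ge0 ?sqr_ge0.
apply: (@le_trans _ _ (y%:E * \int[lam]_x \int[lam]_(s in `]0%R, +oo[) (EFin \o h) (x, s))%E).
  rewrite -ge0_integralZl_EFin//; last first.
  - exact: ltW.
  - exact: (measurable_int_slice1 mh).
  - by move=> x _; exact: integral_ge0.
  apply: ge0_le_integral => //.
  - by move=> x _; rewrite lee_fin sqr_ge0.
  - apply: (measurable_slice1 (f := fun x => (Phi x ^+ 2)%:E)) => //.
    by apply/measurable_EFinP; apply: measurable_funX; exact: tf_measurable.
  - by apply: measurable_funeM; exact: (measurable_int_slice1 mh).
  move=> x _.
  have := @sq_le_int_sq_itv _ (fun t => Phi (x, t)) (fun t => phi1 (x, t)) y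
    (fun t => stream_is_derive1 t1 (x, t)) (@tf_cont1 R _ x t1) _ y0.
  move=> /(_ _)/wrap[]; first exact: tf_zero.
  move/le_trans; apply; apply: lee_wpmul2l; first by rewrite lee_fin ltW.
  have mp (D : set (measurableTypeR R)) : measurable D -> measurable_fun D (fun t => phi1 (x, t)).
    move=> mD; apply: (measurable_funS measurableT) => //.
    by apply: continuous_measurable_fun; exact: tf_cont1.
  rewrite -(@integral_itv_obnd_cbnd _ _ (BRight y)); last first.
    by apply/measurable_EFinP; apply: measurable_funX; apply: mp.
  rewrite le_eqVlt; apply/orP; left; apply/eqP.
  rewrite integral_mkcond [RHS]integral_mkcond.
  apply: eq_integral => s _; rewrite !patchE !mem_setE !in_itv /= andbT /h /=.
  case: (ltP 0 s) => //= s0; case: (leP s y) => /= _; first by rewrite mulr1.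
  by rewrite mulr0.
rewrite -tonelli_H1// tonelli_H//.
apply: (@le_trans _ _ (y%:E * \int[lam]_(s in `]0%R, +oo[) ((cst (y * G)%:E) \_ (`]0%R, y]%classic)) s)%E).
  apply: lee_wpmul2l; first by rewrite lee_fin ltW.
  apply: ge0_le_integral => //.
  - by move=> s _; exact: integral_ge0.
  - exact: (measurable_int_slice2 mh).
  - by apply: (measurable_funS measurableT) => //; apply/(measurable_restrictT _ _).1.
  move=> s; rewrite /= in_itv /= andbT => s0.
  rewrite patchE mem_setE in_itv /= s0 /=; case: ifPn => sy.
    apply: (@le_trans _ _ (s * G)%:E); last by rewrite lee_fin ler_wpM2r// ip_ge0.
    apply: le_trans (tf_slice_sq t1 s0); rewrite le_eqVlt; apply/orP; left; apply/eqP.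
    by apply: eq_integral => t _; rewrite /h /= sy mulr1.
  by rewrite integral0_eq// => t _; rewrite /h /= (negbTE sy) mulr0.
rewrite -integral_mkcondr setIidr; last first.
  by move=> s; rewrite /= !in_itv /= andbT => /andP[].
have lE : lam `]0%R, y]%classic = y%:E.
  by rewrite lebesgue_measure_itv/= lte_fin y0 sube0.
rewrite integral_cst// [X in (_ * (_ * X))%E](_ : _ = y%:E); last exact: lE.
by rewrite -!EFinM lee_fin le_eqVlt; apply/orP; left; apply/eqP; ring.
Qed.

(** The supremum on a horizontal line is bounded by the integral of 2 |Phi| |phi2|. Young's
    inequality with weight y balances the slice bounds y^3 G and y G2 to y^2 each. As a consequence,
    stream functions converge at every point, and stream / x_2 is bounded by the Dirichlet norm. *)
Lemma stream_bound x : 0 < x.2 -> Phi x ^+ 2 <= x.2 ^+ 2 * (G + G2).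
Proof.
move=> x0; have tPhi := tf_stream t1 t2 div0; set y := x.2.
have mP : measurable_fun setT (fun x : measurableTypeR R => (Phi (x, y) ^+ 2)%:E).
  apply: (measurable_slice1 (f := fun x => (Phi x ^+ 2)%:E)) => //.
  by apply/measurable_EFinP; apply: measurable_funX; exact: tf_measurable.
have m2 : measurable_fun setT (fun x : measurableTypeR R => (phi2 (x, y) ^+ 2)%:E).
  apply: (measurable_slice1 (f := fun x => (phi2 x ^+ 2)%:E)) => //.
  by apply/measurable_EFinP; apply: measurable_funX; exact: tf_measurable.
have := tf_sup_slice x.1 y tPhi; rewrite -surjective_pairing => h.
rewrite -lee_fin; apply: (le_trans h).
apply: (@le_trans _ _ (\int[lam]_t ((y^-1)%:E * (Phi (t, y) ^+ 2)%:E + y%:E * (phi2 (t, y) ^+ 2)%:E)))%E.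
  apply: ge0_le_integral => //.
  - apply: (measurable_slice1 (f := fun x => (2 * `|Phi x| * `|partial 0 Phi x|)%:E)) => //.
    apply/measurable_EFinP; apply: measurable_funM; first apply: measurable_funM => //.
      by apply: measurableT_comp => //; exact: tf_measurable.
    by apply: measurableT_comp => //; apply: tf_measurable; exact: tf_partial.
  - by apply: emeasurable_funD; exact: measurable_funeM.
  move=> t _; rewrite (partial_stream0 t1 t2 div0) normrN -!EFinM -EFinD lee_fin.
  rewrite -(real_normK (num_real (Phi _))) -(real_normK (num_real (phi2 _))).
  rewrite -subr_ge0 [X in 0 <= X](_ : _ = y^-1 * (`|Phi (t, y)| - y * `|phi2 (t, y)|) ^+ 2).
    by rewrite mulr_ge0 ?sqr_ge0// invr_ge0 ltW.
  by field; rewrite gt_eqF.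
rewrite ge0_integralD//; last 4 first.
- by move=> t _; rewrite -EFinM lee_fin mulr_ge0 ?sqr_ge0// invr_ge0 ltW.
- exact: measurable_funeM.
- by move=> t _; rewrite -EFinM lee_fin mulr_ge0 ?sqr_ge0// ltW.
- exact: measurable_funeM.
rewrite ge0_integralZl_EFin//; last 2 first.
- by move=> t _; rewrite lee_fin sqr_ge0.
- by rewrite invr_ge0 ltW.
rewrite ge0_integralZl_EFin//; last 2 first.
- by move=> t _; rewrite lee_fin sqr_ge0.
- exact: ltW.
apply: (@le_trans _ _ ((y^-1)%:E * (y ^+ 3 * G)%:E + y%:E * (y * G2)%:E))%E.
  apply: leeD; apply: lee_wpmul2l.
  - by rewrite lee_fin invr_ge0 ltW.
  - exact: stream_slice_sq.
  - by rewrite lee_fin ltW.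
  - exact: tf_slice_sq.
rewrite -!EFinM -EFinD lee_fin.
rewrite (_ : y^-1 * (y ^+ 3 * G) = y ^+ 2 * G); last by field; rewrite gt_eqF.
by rewrite mulrA -expr2 mulrDr.
Qed.

Lemma stream_growth (x1 X : R) : 1 <= X ->
  `|Phi (x1, X)| <= `|Phi (x1, 1)| + \int[lam]_(t in `[1, X]) `|phi1 (x1, t)|.
Proof.
move=> X1; have h := @FTC_line _ (fun t => Phi (x1, t)) (fun t => phi1 (x1, t)) 1 X X1
  (fun t _ => stream_is_derive1 t1 (x1, t)) (fun t _ => @tf_cont1 R _ x1 t1 t).
have -> : Phi (x1, X) = Phi (x1, 1) + \int[lam]_(t in `[1, X]) phi1 (x1, t).
  by rewrite /Rintegral h /=; ring.
apply: (le_trans (ler_normD _ _)); rewrite lerD2l.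
by apply: le_normr_Rintegral => //; apply: continuous_integrable_itv; exact: tf_cont1.
Qed.
End StreamBounds.

(** * Limits of solenoidal test fields *)

Section Approximation.
Context {R : realType}.
Notation mu := (lebesgue_plane R).
Notation H := (@half_plane R).
Notation ip := (inner mu H).
Notation inL2 := (inL2 mu H).
Notation cvgL2 := (cvgL2 mu H).
Let mH := @measurable_half_plane R.

Lemma aeS (P Q : plane R -> Prop) : (forall x, P x -> Q x) ->
  {ae mu, forall x, P x} -> {ae mu, forall x, Q x}.
Proof. exact: (@filterS _ _ (@ae_filter_ringOfSetsType _ _ R mu) P Q). Qed.

Lemma aeS2 (P Q S : plane R -> Prop) : (forall x, P x -> Q x -> S x) ->
  {ae mu, forall x, P x} -> {ae mu, forall x, Q x} -> {ae mu, forall x, S x}.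
Proof. exact: (@filterS2 _ _ (@ae_filter_ringOfSetsType _ _ R mu) P Q S). Qed.

Lemma sum2 (F : 'I_2 -> R) : \sum_(j < 2) F j = F 0 + F 1.
Proof. by rewrite !big_ord_recl big_ord0 addr0; congr (F _ + F _); exact: val_inj. Qed.

Definition stf (phi : vfield R) : Prop :=
  (forall i, tf (phi i)) /\ (forall x, partial 0 (phi 0) x + partial 1 (phi 1) x = 0).

Lemma stfP phi : solenoidal_test_field phi <-> stf phi.
Proof.
split=> -[h1 h2]; split.
- by move=> i; exact: (test_functionP _).1 (h1 i).
- by move=> x; rewrite -(sum2 (fun j => partial j (phi j) x)); exact: h2.
- by move=> i; exact: (test_functionP _).2 (h1 i).
- by move=> x; rewrite sum2; exact: h2.
Qed.

Lemma stfB phi psi : stf phi -> stf psi -> stf (fun i x => phi i x - psi i x).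
Proof.
move=> [t1 d1] [t2 d2]; split=> [i|x]; first exact: tfB.
rewrite !partialB//; have := d1 x; have := d2 x; lra.
Qed.

Definition dirichlet (phi : vfield R) : R :=
  let d i j := ip (partial j (phi i)) (partial j (phi i)) in
  d 0 0 + d 0 1 + (d 1 0 + d 1 1).

Lemma le_sum4 (d : 'I_2 -> 'I_2 -> R) i j : (forall i j, 0 <= d i j) ->
  d i j <= d 0 0 + d 0 1 + (d 1 0 + d 1 1).
Proof.
move=> p; have := p 0 0; have := p 0 1; have := p 1 0; have := p 1 1.
have [->|->] := ord2 i; have [->|->] := ord2 j; lra.
Qed.

Lemma ip_le_dirichlet phi i j :
  ip (partial j (phi i)) (partial j (phi i)) <= dirichlet phi.
Proof.
apply: (@le_sum4 (fun i j => ip (partial j (phi i)) (partial j (phi i)))) => k l.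
exact: ip_ge0.
Qed.

(* Local L2 convergence of the fields enters only through almost everywhere
   convergence, which is obtained along a subsequence. *)
Record appr (phi : nat -> vfield R) (v : vfield R) (G : 'I_2 -> vfield R) : Prop := Appr {
  appr_stf : forall k, stf (phi k);
  appr_meas : forall i, mfun_half (v i);
  appr_grad : forall i j, cvgL2 (fun k => partial j (phi k i)) (G i j);
  appr_ae : forall i,
    {ae mu, forall x, H x -> (fun k => phi k i x) @ \oo --> v i x} }.

Lemma apprB phi v G psi w K : appr phi v G -> appr psi w K ->
  appr (fun k i x => phi k i x - psi k i x) (fun i x => v i x - w i x)
       (fun i j x => G i j x - K i j x).
Proof.
move=> [s1 m1 g1 a1] [s2 m2 g2 a2]; split.
- by move=> k; exact: stfB.
- by move=> i; apply: measurable_funB.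
- move=> i j; rewrite (_ : (fun k => _) =
    fun k x => partial j (phi k i) x - partial j (psi k i) x).
    exact: cvgL2B.
  apply/funext => k; rewrite partialB//; first by case: (s1 k).
  by case: (s2 k).
- move=> i; apply: aeS2 (a1 i) (a2 i) => x h1 h2 Hx.
  by apply: cvgB; [exact: h1|exact: h2].
Qed.

Lemma cvgL2_cauchy fs f (e : R) : cvgL2 fs f -> 0 < e ->
  exists N, forall n m, (N <= n)%N -> (N <= m)%N ->
    ip (fun x => fs n x - fs m x) (fun x => fs n x - fs m x) <= e.
Proof.
move=> [If In cv] e0.
have e4 : 0 < e / 4 by rewrite divr_gt0.
have /cvgr0Pnorm_le/(_ _ e4)[N _ hN] := cv.
exists N => n m Nn Nm.
have hn := hN _ Nn; have hm := hN _ Nm.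
rewrite /= ger0_norm ?ip_ge0// in hn; rewrite /= ger0_norm ?ip_ge0// in hm.
have := ip_sqD_le mH (inL2B mH (In n) If) (inL2Z mH (-1) (inL2B mH (In m) If)).
rewrite ipZl ?ipZr//; do ?[exact: inL2B | exact: inL2Z (inL2B mH (In m) If)].
rewrite (_ : ip _ _ = ip (fun x => fs n x - fs m x) (fun x => fs n x - fs m x)).
  move: hn hm; move: (ip _ _) (ip _ _) (ip _ _) => a b c; lra.
by apply: eq_ip => x _; ring.
Qed.

Lemma appr_cauchy phi v G (e : R) : appr phi v G -> 0 < e ->
  exists N, forall n m, (N <= n)%N -> (N <= m)%N ->
    dirichlet (fun i x => phi n i x - phi m i x) <= e.
Proof.
move=> [s1 m1 g1 a1] e0; have e4 : 0 < e / 4 by rewrite divr_gt0.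
have h i j := cvgL2_cauchy (g1 i j) e4.
have [N00 h00] := h 0 0; have [N01 h01] := h 0 1.
have [N10 h10] := h 1 0; have [N11 h11] := h 1 1.
exists (maxn (maxn N00 N01) (maxn N10 N11)) => n m.
rewrite !geq_max => /andP[/andP[n1 n2] /andP[n3 n4]] /andP[/andP[m1' m2] /andP[m3 m4]].
have E i j : partial j (fun x => phi n i x - phi m i x) =
    fun x => partial j (phi n i) x - partial j (phi m i) x.
  by rewrite partialB//; [case: (s1 n)|case: (s1 m)].
rewrite /dirichlet !E.
apply: (le_trans (lerD (lerD (h00 _ _ n1 m1') (h01 _ _ n2 m2))
  (lerD (h10 _ _ n3 m3) (h11 _ _ n4 m4)))).
by lra.
Qed.

(** A linear expression [T] in the field that is bounded by the Dirichlet norm maps the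
    approximating fields to a Cauchy sequence in L2; its limit is recognised from the almost
    everywhere limit. The weighted limits below are all obtained in this way. *)
Lemma appr_op phi v G (T : vfield R -> R * R -> R) (Tv : R * R -> R) (C : R) :
  appr phi v G -> 0 <= C ->
  (forall psi, stf psi -> inL2 (T psi)) ->
  (forall psi, stf psi -> ip (T psi) (T psi) <= C * dirichlet psi) ->
  (forall psi chi x, stf psi -> stf chi -> H x ->
     T (fun i x => psi i x - chi i x) x = T psi x - T chi x) ->
  mfun_half Tv ->
  {ae mu, forall x, H x -> (fun k => T (phi k) x) @ \oo --> Tv x} ->
  cvgL2 (fun k => T (phi k)) Tv.
Proof.
move=> ap C0 hL hB hlin mT cvT; apply: cauchy_cvgL2 => //.
  by move=> n; apply: hL; exact: appr_stf ap n.
move=> e e0; have eC : 0 < e / (C + 1) by rewrite divr_gt0// ltr_wpDl.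
have [N hN] := appr_cauchy ap eC.
exists N => n m Nn Nm; have D0 := hN _ _ Nn Nm.
have sB := stfB (appr_stf ap n) (appr_stf ap m).
rewrite (_ : ip _ _ = ip (T (fun i x => phi n i x - phi m i x))
                        (T (fun i x => phi n i x - phi m i x))); last first.
  by apply: eq_ip => x /set_mem Hx; rewrite hlin//; exact: (appr_stf ap).
apply: (le_trans (hB _ sB)).
apply: (@le_trans _ _ ((C + 1) * dirichlet (fun i x => phi n i x - phi m i x))).
  apply: ler_wpM2r; last by rewrite lerDl.
  by apply: le_trans (ip_le_dirichlet _ 0 0); exact: ip_ge0.
by rewrite mulrC -ler_pdivlMr// ltr_wpDl.
Qed.

(** [q] is a multiplier into L2. Only the vertical derivative stands on the right, and the final
    absorption depends on this: the horizontal derivatives are not charged for it. *)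
Definition weightp (q : R * R -> R) (C : R) : Prop :=
  [/\ 0 <= C, mfun_half q &
   forall f, tf f -> (\int[mu]_(x in H) ((q x * f x) ^+ 2)%:E <=
      (C * ip (partial 1 f) (partial 1 f))%:E)%E].

Lemma weightp_inL2 q C f : weightp q C -> tf f -> inL2 (fun x => q x * f x).
Proof.
move=> [C0 mq hq] tff; split; last by apply: le_lt_trans (hq _ tff) _; rewrite ltry.
by apply: measurable_funM => //; exact: tf_measurable.
Qed.

Lemma weightp_ip q C f : weightp q C -> tf f ->
  ip (fun x => q x * f x) (fun x => q x * f x) <= C * ip (partial 1 f) (partial 1 f).
Proof.
move=> wq tff; rewrite -lee_fin -(ipE mH (weightp_inL2 wq tff)).
by case: wq => _ _; exact.
Qed.

Lemma appr_weight phi v G q C i : appr phi v G -> weightp q C ->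
  cvgL2 (fun k x => q x * phi k i x) (fun x => q x * v i x).
Proof.
move=> ap wq; have [C0 mq _] := wq.
apply: (@appr_op phi v G (fun psi x => q x * psi i x) _ C) => //.
- by move=> psi [tp _]; exact: weightp_inL2 wq (tp i).
- move=> psi [tp _]; apply: (le_trans (weightp_ip wq (tp i))).
  by apply: ler_wpM2l => //; exact: ip_le_dirichlet.
- by move=> psi chi x _ _ _; rewrite mulrBr.
- by apply: measurable_funM => //; exact: appr_meas ap i.
- apply: aeS (appr_ae ap i) => x h Hx.
  by apply: cvgM; [exact: cvg_cst|exact: h].
Qed.

Lemma appr_weight_ip phi v G q C i : appr phi v G -> weightp q C ->
  ip (fun x => q x * v i x) (fun x => q x * v i x) <= C * ip (G i 1) (G i 1).
Proof.
move=> ap wq.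
have c1 := cvgL2_sq mH (appr_weight i ap wq).
have c2 : (fun k => C * ip (partial 1 (phi k i)) (partial 1 (phi k i))) @ \oo
    --> C * ip (G i 1) (G i 1).
  have c3 := cvgL2_sq mH (appr_grad ap i 1).
  by apply: cvgM; [exact: cvg_cst|exact: c3].
have le k : ip (fun x => q x * phi k i x) (fun x => q x * phi k i x) <=
    C * ip (partial 1 (phi k i)) (partial 1 (phi k i)).
  exact: (weightp_ip wq ((appr_stf ap k).1 i)).
exact: (ler_cvg_to c1 c2 (nearW _ le)).
Qed.

Lemma weightp_inv2 : weightp (fun x => x.2^-1) 4.
Proof.
split=> //; first by case: (@locbd_inv2 R).
move=> f tff; have I1 : inL2 (fun x => x.2^-1 * f x).
  by apply: locbd_inL2; [apply: locbdM (tf_locbd tff); exact: locbd_inv2|apply: csuppM; exact: tf_csupp].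
rewrite (ipE mH I1) lee_fin.
have := hardy 0 tff.
rewrite (_ : ip (fun x => x.2^-1 ^+ 1 * f x) _ = ip (fun x => x.2^-1 * f x) (fun x => x.2^-1 * f x)).
  move/le_trans; apply; rewrite le_eqVlt; apply/orP; left; apply/eqP.
  by congr (4 * _); apply: eq_ip => x _; rewrite expr0 mul1r.
by apply: eq_ip => x _; rewrite expr1.
Qed.

(** [tf_ladyzhenskaya] along the approximating fields, whose Dirichlet norms are eventually bounded
    by [l + 1], followed by Fatou's lemma. It applies to [u] as well, for which no pointwise bound
    is known. *)
Lemma weightp_appr phi v G j : appr phi v G ->
  exists C, weightp (fun x => x.2^-1 * v j x) C.
Proof.
move=> ap.
have c0 := cvgL2_sq mH (appr_grad ap j 0).
have c1 := cvgL2_sq mH (appr_grad ap j 1).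
pose l := ip (G j 0) (G j 0) + ip (G j 1) (G j 1).
have c : (fun k => ip (partial 0 (phi k j)) (partial 0 (phi k j)) +
     ip (partial 1 (phi k j)) (partial 1 (phi k j))) @ \oo --> l.
  by apply: cvgD; [exact: c0|exact: c1].
have l0 : 0 <= l by apply: addr_ge0; exact: ip_ge0.
exists (4 * (l + 1)); split.
- by rewrite mulr_ge0// ler_wpDr.
- by apply: measurable_funM; [case: (@locbd_inv2 R)|exact: appr_meas ap j].
move=> f tff.
apply: (@fatou_L2 _ _ _ _ _ mH (fun k x => x.2^-1 * phi k j x * f x)).
- move=> k; apply: measurable_funM; last exact: tf_measurable.
  apply: measurable_funM; first by case: (@locbd_inv2 R).
  by apply: tf_measurable; case: (appr_stf ap k).
- apply: aeS (appr_ae ap j) => x h Hx.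
  apply: cvgM; last exact: cvg_cst.
  by apply: cvgM; [exact: cvg_cst|exact: h].
- have : \forall k \near \oo, ip (partial 0 (phi k j)) (partial 0 (phi k j)) +
     ip (partial 1 (phi k j)) (partial 1 (phi k j)) <= l + 1.
    have l1 : l < l + 1 by rewrite ltrDl.
    exact: (cvgr_le _ c _ l1).
  apply: filterS => k hk; have tk := (appr_stf ap k).1 j.
  under eq_integral do rewrite -mulrA.
  apply: (le_trans (tf_ladyzhenskaya tk tff)); rewrite lee_fin.
  by apply: ler_wpM2r; [exact: ip_ge0|rewrite ler_wpM2l].
- apply: measurable_funM; last exact: tf_measurable.
  by apply: measurable_funM; [case: (@locbd_inv2 R)|exact: appr_meas ap j].
Qed.

End Approximation.

(** * Local limits, transport terms, and the weak form in terms of scalar products *)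

Section Trilinear.
Context {R : realType}.
Notation mu := (lebesgue_plane R).
Notation H := (@half_plane R).
Notation ip := (inner mu H).
Notation inL2 := (inL2 mu H).
Notation cvgL2 := (cvgL2 mu H).
Let mH := @measurable_half_plane R.

Definition sum4 (d : 'I_2 -> 'I_2 -> R) : R := d 0 0 + d 0 1 + (d 1 0 + d 1 1).

Lemma eq_inL2 (f g : R * R -> R) : (forall x, H x -> f x = g x) ->
  inL2 f -> inL2 g.
Proof.
move=> fg [mf hf]; split.
  by apply: (eq_measurable_fun f) => // x /set_mem; exact: fg.
apply: le_lt_trans hf; rewrite le_eqVlt; apply/orP; left; apply/eqP.
by apply: eq_integral => x /set_mem Hx; rewrite fg.
Qed.

Lemma eq_cvgL2 (fs gs : nat -> R * R -> R) (f g : R * R -> R) :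
  (forall n x, H x -> fs n x = gs n x) -> (forall x, H x -> f x = g x) ->
  cvgL2 fs f -> cvgL2 gs g.
Proof.
move=> e1 e2 [If In cv]; split; [exact: (eq_inL2 e2 If)|by move=> n; exact: (eq_inL2 (e1 n) (In n))|].
apply: cvg_trans cv; apply: near_eq_cvg; apply: nearW => n.
by apply: eq_ip => x /set_mem Hx; rewrite e1// e2.
Qed.

Lemma tf_snd_bounded (f : R * R -> R) : tf f ->
  exists C, forall x, H x -> `|x.2 * f x| <= C.
Proof.
move=> tff; have [C C0 hC] := tf_bounded (tfM (@smooth_snd R) tff).
by exists C => x _; exact: hC.
Qed.

Lemma measurable_sndM (f : R * R -> R) : tf f ->
  mfun_half (fun x : R * R => x.2 * f x).
Proof. by move=> tff; apply: tf_measurable; exact: (tfM (@smooth_snd R) tff). Qed.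

Lemma inL2_loc (v f : R * R -> R) : inL2 (fun x => x.2^-1 * v x) -> tf f ->
  inL2 (fun x => v x * f x).
Proof.
move=> Iv tff; have [C hC] := tf_snd_bounded tff.
apply: eq_inL2 (inL2M mH (measurable_sndM tff) hC Iv) => x Hx.
by field; rewrite gt_eqF.
Qed.

Lemma appr_loc phi v G (f : R * R -> R) i : appr phi v G -> tf f ->
  cvgL2 (fun k x => phi k i x * f x) (fun x => v i x * f x).
Proof.
move=> ap tff; have [C hC] := tf_snd_bounded tff.
have := cvgL2M mH (measurable_sndM tff) hC (appr_weight i ap (@weightp_inv2 R)).
apply: eq_cvgL2 => [n x Hx|x Hx]; by field; rewrite gt_eqF.
Qed.

(** The integrand is half of the divergence of c^2 a, since [a] is solenoidal. *)
Lemma transport_zero (a : vfield R) (c : R * R -> R) : stf a -> tf c ->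
  ip (partial 0 c) (fun x => a 0 x * c x) +
  ip (partial 1 c) (fun x => a 1 x * c x) = 0.
Proof.
move=> [ta da] tc.
have t j : tf (fun x => a j x * (c x * c x)).
  by apply: tfM; [case: (ta j)|apply: tfM => //; case: tc].
have I j := locbd_integrable (tf_locbd (tf_partial j (t j))) (tf_csupp (tf_partial j (t j))).
have tac j : tf (fun x => a j x * c x) by apply: tfM => //; case: (ta j).
have I2 j := inL2_mul mH (tf_inL2 (tf_partial j tc)) (tf_inL2 (tac j)).
have e : \int[mu]_(x in H) (partial 0 (fun x => a 0 x * (c x * c x)) x +
   partial 1 (fun x => a 1 x * (c x * c x)) x) = 0.
  by rewrite RintegralD// !int_partial// addr0.
have : 2 * (ip (partial 0 c) (fun x => a 0 x * c x) +
  ip (partial 1 c) (fun x => a 1 x * c x)) = 0.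
  rewrite -e /inner -RintegralD// -RintegralZl//; last exact: integrableDR.
  apply: eq_Rintegral => x _.
  have dc j : derivable c x (((j : 'I_2) == 0)%:R : R, ((j : 'I_2) == 1)%:R : R).
    by apply: smooth_derivable; case: tc.
  have dcc j : derivable (fun x => c x * c x) x (((j : 'I_2) == 0)%:R : R, ((j : 'I_2) == 1)%:R : R).
    by apply: smooth_derivable; apply: smoothM; case: tc.
  have dda j : derivable (a j) x (((j : 'I_2) == 0)%:R : R, ((j : 'I_2) == 1)%:R : R).
    by apply: smooth_derivable; case: (ta j).
  rewrite !partialM//; have := da x; move: (partial 0 (a 0) x) => p /eqP.
  by rewrite addr_eq0 => /eqP ->; ring.
by move/eqP; rewrite mulf_eq0 pnatr_eq0 /= => /eqP.
Qed.

(** The limits are taken one after the other. While [psi k] is fixed, it is a test function and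
    local convergence to [b] suffices; the limit in [k] then uses the multipliers [b 0] and
    [b 1]. *)
Lemma transport_zero1 phi b Gb psi q Gq C0 C1 i :
  appr phi b Gb -> appr psi q Gq -> weightp (b 0) C0 -> weightp (b 1) C1 ->
  ip (Gq i 0) (fun x => b 0 x * q i x) + ip (Gq i 1) (fun x => b 1 x * q i x) = 0.
Proof.
move=> ab aq w0 w1.
have z k : ip (partial 0 (psi k i)) (fun x => b 0 x * psi k i x) +
    ip (partial 1 (psi k i)) (fun x => b 1 x * psi k i x) = 0.
  have tk := (appr_stf aq k).1 i.
  have I j := tf_inL2 (tf_partial j tk).
  have l0 := cvgL2_ip mH (cvgL2_cst mH (I 0)) (appr_loc 0 ab tk).
  have l1 := cvgL2_ip mH (cvgL2_cst mH (I 1)) (appr_loc 1 ab tk).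
  apply/esym; apply: (cvg_unique _ _ (cvgD l0 l1)) => //.
  apply: cvg_near_cst; apply: nearW => l.
  exact: (transport_zero (appr_stf ab l) tk).
have l0 := cvgL2_ip mH (appr_grad aq i 0) (appr_weight i aq w0).
have l1 := cvgL2_ip mH (appr_grad aq i 1) (appr_weight i aq w1).
apply/esym; apply: (cvg_unique _ _ (cvgD l0 l1)) => //.
by apply: cvg_near_cst; apply: nearW => k; exact: z.
Qed.

(** The counterpart in which a component of [b] is the transported scalar instead of the
    transporting field. That component now supplies the multiplier needed for the limit in [q]. *)
Lemma transport_zero2 phi b Gb psi q Gq C i :
  appr phi b Gb -> appr psi q Gq -> weightp (b i) C ->
  ip (Gb i 0) (fun x => b i x * q 0 x) + ip (Gb i 1) (fun x => b i x * q 1 x) = 0.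
Proof.
move=> ab aq w.
have z k : ip (Gb i 0) (fun x => b i x * psi k 0 x) +
    ip (Gb i 1) (fun x => b i x * psi k 1 x) = 0.
  have l0 := cvgL2_ip mH (appr_grad ab i 0) (appr_loc i ab ((appr_stf aq k).1 0)).
  have l1 := cvgL2_ip mH (appr_grad ab i 1) (appr_loc i ab ((appr_stf aq k).1 1)).
  apply/esym; apply: (cvg_unique _ _ (cvgD l0 l1)) => //.
  apply: cvg_near_cst; apply: nearW => l.
  rewrite -[RHS](transport_zero (appr_stf aq k) ((appr_stf ab l).1 i)).
  by congr (_ + _); apply: eq_ip => x _; rewrite // mulrC.
have I j := let: And3 h _ _ := appr_grad ab i j in h.
have l0 := cvgL2_ip mH (cvgL2_cst mH (I 0)) (appr_weight 0 aq w).
have l1 := cvgL2_ip mH (cvgL2_cst mH (I 1)) (appr_weight 1 aq w).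
apply/esym; apply: (cvg_unique _ _ (cvgD l0 l1)) => //.
by apply: cvg_near_cst; apply: nearW => k; exact: z.
Qed.

Lemma weak_form_ip (v : vfield R) (G F : 'I_2 -> vfield R) (chi : vfield R) :
  (forall i j, inL2 (F i j)) -> (forall i j, inL2 (G i j)) ->
  (forall j, inL2 (fun x => x.2^-1 * v j x)) -> stf chi ->
  \sum_(i < 2) \int[mu]_(x in H)
      ((\sum_(j < 2) G i j x * partial j (chi i) x) +
       (\sum_(j < 2) v j x * G i j x) * chi i x) =
    \sum_(i < 2) \int[mu]_(x in H) (\sum_(j < 2) F i j x * partial j (chi i) x) ->
  sum4 (fun i j => ip (G i j) (partial j (chi i))) +
  sum4 (fun i j => ip (G i j) (fun x => v j x * chi i x)) =
  sum4 (fun i j => ip (F i j) (partial j (chi i))).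
Proof.
move=> IF IG Iv [tc _].
have I1 i j := inL2_mul mH (IG i j) (tf_inL2 (tf_partial j (tc i))).
have I2 i j := inL2_mul mH (IG i j) (inL2_loc (Iv j) (tc i)).
have I3 i j := inL2_mul mH (IF i j) (tf_inL2 (tf_partial j (tc i))).
have e1 i : \int[mu]_(x in H) ((\sum_(j < 2) G i j x * partial j (chi i) x) +
       (\sum_(j < 2) v j x * G i j x) * chi i x) =
   ip (G i 0) (partial 0 (chi i)) + ip (G i 1) (partial 1 (chi i)) +
   (ip (G i 0) (fun x => v 0 x * chi i x) + ip (G i 1) (fun x => v 1 x * chi i x)).
  rewrite /inner -!RintegralD//; do ?exact: integrableDR.
  by apply: eq_Rintegral => x _; rewrite !sum2; ring.
have e2 i : \int[mu]_(x in H) (\sum_(j < 2) F i j x * partial j (chi i) x) =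
   ip (F i 0) (partial 0 (chi i)) + ip (F i 1) (partial 1 (chi i)).
  by rewrite /inner -!RintegralD//; apply: eq_Rintegral => x _; rewrite !sum2.
rewrite !sum2 !e1 !e2 /sum4 => <-.
exact: addrACA.
Qed.
End Trilinear.

(** * The logarithmic cutoff *)

Section Cutoff.
Context {R : realType}.

(** The logarithm of 1 + y^2 rather than of y is smooth on the whole line, so the cutoff is smooth
    across the boundary. *)
Definition logsq (y : R) : R := ln (1 + y * y).

Lemma one_plus_gt0 (y : R) : 0 < 1 + y * y.
Proof. by rewrite ltr_pwDl// -expr2 sqr_ge0. Qed.

Lemma logsq_ge0 y : 0 <= logsq y.
Proof. by rewrite ln_ge0// lerDl -expr2 sqr_ge0. Qed.

Lemma expR_logsq y : expR (logsq y) = 1 + y * y.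
Proof. by rewrite lnK// posrE one_plus_gt0. Qed.

(** The inverse square of the Japanese bracket. The derivatives of [logsq] are polynomials in [y]
    and [bracket y]. *)
Definition bracket (y : R) : R := (1 + y * y)^-1.

Lemma is_derive_one_plus (y : R) : is_derive y 1 (fun y : R => 1 + y * y) (y + y).
Proof.
have i := @is_derive_id R R y 1.
have c := @is_derive_cst R R R (1 : R) y 1.
have := is_deriveD c (is_deriveM i i).
rewrite add0r /GRing.scale /= mulr1; exact.
Qed.

Lemma is_derive_bracket (y : R) :
  is_derive y 1 bracket (- (2 * y) * (bracket y * bracket y)).
Proof.
have n0 : 1 + y * y != 0 by rewrite gt_eqF ?one_plus_gt0.
have h := @is_deriveV R (fun y : R => 1 + y * y) y _ _ n0 (is_derive_one_plus y).
apply: (@is_derive_eq R R R bracket y 1 _ _ h).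
rewrite [LHS](_ : _ = - ((1 + y * y) ^- 2) * (y + y)) // expr2 invfM /bracket.
by move: (1 + y * y)^-1 => a; ring.
Qed.

Lemma is_derive_logsq (y : R) : is_derive y 1 logsq (2 * y * bracket y).
Proof.
have h2 := is_derive1_ln (one_plus_gt0 y).
have h := @is_derive1_comp R (@ln R) (fun y : R => 1 + y * y) y _ _ h2 (is_derive_one_plus y).
apply: (@is_derive_eq R R R logsq y 1 _ _ h).
by rewrite /bracket; move: (1 + y * y)^-1 => a; ring.
Qed.

(* [y E'(y) (1 + log (1 + y^2))] and [y^2 E''(y)] are bounded uniformly in
   [0 < t <= 1], while [E] itself decays faster than any power of [y]. *)
Definition cutoff (t y : R) : R := expR (- (t * (logsq y * logsq y))).

Definition dcutoff (t y : R) : R :=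
  - (4 * t) * (y * bracket y * logsq y) * cutoff t y.

Lemma is_derive_cutoff (t y : R) : is_derive y 1 (cutoff t) (dcutoff t y).
Proof.
have l := is_derive_logsq y.
have l2 := is_deriveM l l.
have c := @is_derive_cst R R R (- t : R) y 1.
have hq : is_derive y 1 (fun y => - (t * (logsq y * logsq y)))
    (- (4 * t) * (y * bracket y * logsq y)).
  rewrite (_ : (fun y => _) = cst (- t) * (logsq * logsq)); last first.
    by apply/funext => z; rewrite -mulNr.
  apply: (is_derive_eq (is_deriveM c l2)).
  rewrite [LHS](_ : _ = - t * (logsq y * (2 * y * bracket y) + logsq y * (2 * y * bracket y)) +
     logsq y * logsq y * 0)//.
  by move: (logsq y) (bracket y) => a b; ring.
have h := @is_derive1_comp R expR _ y _ _ (is_derive_expR _) hq.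
apply: (@is_derive_eq R R R (cutoff t) y 1 _ _ h).
by rewrite /dcutoff /cutoff mulrC.
Qed.

Lemma smooth_snd_fun (f : R -> R) (df : R -> R) :
  (forall y : R, is_derive y 1 f (df y)) ->
  [/\ continuous (fun x : R * R => f x.2),
      forall j x, derivable (fun x : R * R => f x.2) x
        (((j : 'I_2) == 0)%:R : R, ((j : 'I_2) == 1)%:R : R),
      partial 0 (fun x : R * R => f x.2) = (fun=> 0) &
      partial 1 (fun x : R * R => f x.2) = (fun x : R * R => df x.2)].
Proof.
move=> fd.
have d0 (x : R * R) : is_derive x (((0 : 'I_2) == 0)%:R : R, ((0 : 'I_2) == 1)%:R : R) (fun x : R * R => f x.2) 0.
  by apply/is_derive_slice0 => /=; exact: is_derive_cst.
have d1 (x : R * R) : is_derive x (((1 : 'I_2) == 0)%:R : R, ((1 : 'I_2) == 1)%:R : R) (fun x : R * R => f x.2) (df x.2).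
  by apply/is_derive_slice1; exact: fd.
split.
- move=> x; apply: (@continuous_comp _ _ _ snd f); first exact: cvg_snd.
  by have [d _] := fd x.2; apply: differentiable_continuous; exact/derivable1_diffP.
- by move=> j x; have [->|->] := ord2 j; [case: (d0 x)|case: (d1 x)].
- by apply/funext => x; apply: partialE; exact: d0.
- by apply/funext => x; apply: partialE; exact: d1.
Qed.

(** Bootstrapping: if [df] is an expression in [f] and known smooth functions, then C^n regularity
    of [f] passes to [df] and yields C^(n+1) for [f]. *)
Lemma Cn_snd_fun (f df : R -> R) :
  (forall y : R, is_derive y 1 f (df y)) ->
  (forall n, Cn n (fun x : R * R => f x.2) -> Cn n (fun x : R * R => df x.2)) ->
  smooth (fun x : R * R => f x.2).
Proof.
move=> fd hd; have [c d p0 p1] := smooth_snd_fun fd.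
apply/smoothP; elim => [|n ih] //; split=> // j.
by have [->|->] := ord2 j; rewrite ?p0 ?p1; [exact: Cn_cst|exact: hd].
Qed.

Lemma smooth_bracket : smooth (fun x : R * R => bracket x.2).
Proof.
apply: (Cn_snd_fun is_derive_bracket) => n hn.
apply: (@CnM _ n (fun x : R * R => - (2 * x.2)) (fun x : R * R => bracket x.2 * bracket x.2)); last exact: CnM.
rewrite (_ : (fun x => _) = (fun x : R * R => - 2 * x.2)).
  by apply: CnM; [exact: Cn_cst|exact: (smoothP _).1 (@smooth_snd R) n].
by apply/funext => x; rewrite mulNr.
Qed.

Lemma smooth_logsq : smooth (fun x : R * R => logsq x.2).
Proof.
apply: (Cn_snd_fun is_derive_logsq) => n _.
apply: (@CnM _ n (fun x : R * R => 2 * x.2) (fun x : R * R => bracket x.2)).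
  by apply: CnM; [exact: Cn_cst|exact: (smoothP _).1 (@smooth_snd R) n].
exact: (smoothP _).1 smooth_bracket n.
Qed.

Lemma smooth_cutoff_factor t :
  smooth (fun x : R * R => - (4 * t) * (x.2 * bracket x.2 * logsq x.2)).
Proof.
apply: smoothM; first exact: smooth_cst.
apply: smoothM smooth_logsq; apply: smoothM smooth_bracket; exact: smooth_snd.
Qed.

Lemma smooth_cutoff t : smooth (fun x : R * R => cutoff t x.2).
Proof.
apply: (Cn_snd_fun (@is_derive_cutoff t)) => n hn.
apply: (@CnM _ n (fun x : R * R => - (4 * t) * (x.2 * bracket x.2 * logsq x.2))) => //.
exact: (smoothP _).1 (smooth_cutoff_factor t) n.
Qed.

Definition ddcutoff (t y : R) : R :=
  (- (4 * t) * (bracket y * logsq y - 2 * (y * bracket y) * (y * bracket y) * logsq y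
     + 2 * (y * bracket y) * (y * bracket y))
   + (4 * t) ^+ 2 * (y * bracket y * logsq y) ^+ 2) * cutoff t y.

Lemma is_derive_dcutoff (t y : R) : is_derive y 1 (dcutoff t) (ddcutoff t y).
Proof.
have i := @is_derive_id R R y 1.
have l := is_derive_logsq y; have b := is_derive_bracket y.
have E := is_derive_cutoff t y.
have c := @is_derive_cst R R R (- (4 * t) : R) y 1.
rewrite (_ : dcutoff t = (cst (- (4 * t)) * (id * bracket * logsq)) * cutoff t); last first.
  by apply/funext => z.
apply: (is_derive_eq (is_deriveM (is_deriveM c (is_deriveM (is_deriveM i b) l)) E)).
rewrite [LHS](_ : _ = - (4 * t) * (y * bracket y * logsq y) * dcutoff t y +
  cutoff t y * (- (4 * t) * (y * bracket y * (2 * y * bracket y) +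
     logsq y * (y * (- (2 * y) * (bracket y * bracket y)) + bracket y * 1)) +
     y * bracket y * logsq y * 0))//.
rewrite /dcutoff /ddcutoff; move: (logsq y) (bracket y) (cutoff t y) => A B C; ring.
Qed.

Lemma smooth_dcutoff t : smooth (fun x : R * R => dcutoff t x.2).
Proof. exact: smoothM (smooth_cutoff_factor t) (smooth_cutoff t). Qed.

End Cutoff.

(** * Bounds on the cutoff, uniform in t or for fixed t, and its limit as t tends to 0 *)

Section CutoffBounds.
Context {R : realType}.
Notation logsq := (@logsq R).
Notation bracket := (@bracket R).
Implicit Types t y : R.

Lemma cutoff_ge0 t y : 0 <= cutoff t y.
Proof. exact: expR_ge0. Qed.

(** The inequality e^z >= 1 + z. The uniform bounds on the two derivatives use no stronger decay. *)
Lemma cutoff_mul_le1 t y : (1 + t * (logsq y * logsq y)) * cutoff t y <= 1.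
Proof.
rewrite /cutoff expRN ler_pdivrMr ?expR_gt0// mul1r; exact: expR_ge1Dx.
Qed.

Lemma cutoff_le1 t y : 0 <= t -> cutoff t y <= 1.
Proof.
by move=> t0; rewrite /cutoff -expR0 ler_expR oppr_le0 !mulr_ge0 ?logsq_ge0.
Qed.

Lemma bracket_bound y : 0 <= y * bracket y * y <= 1.
Proof.
rewrite /bracket; have h := one_plus_gt0 y.
rewrite (_ : y * _ * y = y * y / (1 + y * y)); last by rewrite mulrAC.
have yy : 0 <= y * y by rewrite -expr2 sqr_ge0.
apply/andP; split; first by rewrite divr_ge0// ltW.
by rewrite ler_pdivrMr// mul1r; lra.
Qed.

(** With s = y^2 / (1 + y^2) in [0, 1] and L = [logsq y], the left side is 4 s t (L + L^2) E. Here t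
    L^2 E <= 1, and 2 t L <= t + t L^2 handles the linear term. The factor 1 + L pays for the growth
    of the limit stream function. *)
Lemma dcutoff_bound t y : 0 < y -> 0 <= t -> t <= 1 ->
  `|y * dcutoff t y| * (1 + logsq y) <= 8.
Proof.
move=> y0 t0 t1.
have := bracket_bound y; set s := y * bracket y * y => /andP[s0 s1].
have L0 := logsq_ge0 y; have E0 := cutoff_ge0 t y; have E1 := cutoff_le1 y t0.
have pE := cutoff_mul_le1 t y.
rewrite (_ : y * dcutoff t y = - (4 * (t * s * logsq y * cutoff t y))); last first.
  by rewrite /dcutoff /s; ring.
move: s s0 s1 => {}s s0 s1.
move: (logsq y) (cutoff t y) L0 E0 E1 pE => L E L0 E0 E1 pE.
rewrite normrN ger0_norm; last by rewrite !mulr_ge0.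
have a1 : t * s * L * E * (1 + L) <= 1 * (t * L * E * (1 + L)).
  rewrite [leLHS](_ : _ = s * (t * L * E * (1 + L))); last by ring.
  by apply: ler_wpM2r => //; rewrite !mulr_ge0// ler_wpDl.
have a2 : 2 * (t * L) <= t + t * (L * L).
  have : 0 <= t * (L - 1) ^+ 2 by rewrite mulr_ge0 ?sqr_ge0.
  by rewrite sqrrB; lra.
have a3 : 2 * (t * L) * E <= (t + t * (L * L)) * E by apply: ler_wpM2r.
have a4 : t * E <= 1 * 1 by apply: ler_pM.
have a5 : 0 <= t * (L * L) * E by rewrite !mulr_ge0.
by lra.
Qed.

Lemma ddcutoff_bound t y : 0 < y -> 0 <= t -> t <= 1 ->
  `|y * y * ddcutoff t y| <= 40.
Proof.
move=> y0 t0 t1.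
have := bracket_bound y; set s := y * bracket y * y => /andP[s0 s1].
have L0 := logsq_ge0 y; have E0 := cutoff_ge0 t y; have E1 := cutoff_le1 y t0.
have pE := cutoff_mul_le1 t y.
rewrite (_ : y * y * ddcutoff t y =
   (- 4 * (t * (s * logsq y - 2 * (s * s) * logsq y + 2 * (s * s))) +
    16 * (t * (t * ((s * s) * (logsq y * logsq y))))) * cutoff t y); last first.
  by rewrite /ddcutoff /s; ring.
move: s s0 s1 => {}s s0 s1.
rewrite normrM (ger0_norm E0).
move: (logsq y) (cutoff t y) L0 E0 E1 pE => L E L0 E0 E1 pE.
have ss0 : 0 <= s * s by rewrite mulr_ge0.
have ss1 : s * s <= 1 by rewrite mulr_ile1.
have tL0 : 0 <= t * L by rewrite mulr_ge0.
have LL0 : 0 <= L * L by rewrite mulr_ge0.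
have b1 : s * (t * L) <= 1 * (t * L) by apply: ler_wpM2r.
have b10 : 0 <= s * (t * L) by rewrite mulr_ge0.
have b2 : s * s * (t * L) <= 1 * (t * L) by apply: ler_wpM2r.
have b20 : 0 <= s * s * (t * L) by rewrite mulr_ge0.
have b3 : s * s * t <= 1 * t by apply: ler_wpM2r.
have b30 : 0 <= s * s * t by rewrite mulr_ge0.
have tt : t * t <= 1 * t by apply: ler_wpM2r.
have b4 : s * s * (t * t * (L * L)) <= 1 * (1 * t * (L * L)).
  apply: ler_pM => //; first by rewrite !mulr_ge0.
  by apply: ler_wpM2r.
have b40 : 0 <= s * s * (t * t * (L * L)) by rewrite !mulr_ge0.
(* Powers of s are at most 1 and t^2 <= t; 12 = 4 + 8 gathers the two terms linear in L. The linear
   terms then cost 6 (t + t L^2), so the total is at most 14 t E + 22 t L^2 E. *)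
apply: (@le_trans _ _ ((12 * (t * L) + 8 * t + 16 * (t * (L * L))) * E)).
  apply: ler_wpM2r => //; rewrite ler_norml; apply/andP; split.
    move: b1 b10 b2 b20 b3 b30 b4 b40; clear; lra.
  move: b1 b10 b2 b20 b3 b30 b4 b40; clear; lra.
have a2 : 2 * (t * L) <= t + t * (L * L).
  have : 0 <= t * (L - 1) ^+ 2 by rewrite mulr_ge0 ?sqr_ge0.
  by rewrite sqrrB; lra.
have a3 : 2 * (t * L) * E <= (t + t * (L * L)) * E by apply: ler_wpM2r.
have a4 : t * E <= 1 * 1 by apply: ler_pM.
move: a3 a4 pE E0 E1; clear; lra.
Qed.

Lemma le_expR_logsq y : 0 < y -> y <= expR (logsq y).
Proof.
by move=> y0; rewrite expR_logsq; have := sqr_ge0 (y - 1); rewrite sqrrB; lra.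
Qed.

(** As y <= e^L with L = [logsq y], the exponent is at most L - t L^2 <= 1 / (4 t). This bound
    degenerates as t tends to 0 and serves only the limit in k at fixed t. *)
Lemma cutoff_decay t y : 0 < y -> 0 < t -> `|y * cutoff t y| <= expR (t^-1).
Proof.
move=> y0 t0; rewrite ger0_norm; last by rewrite mulr_ge0 ?cutoff_ge0// ltW.
apply: (@le_trans _ _ (expR (logsq y) * cutoff t y)).
  by apply: ler_wpM2r; [exact: cutoff_ge0|exact: le_expR_logsq].
rewrite /cutoff -expRD ler_expR -subr_ge0.
rewrite [X in 0 <= X](_ : _ = t * (logsq y - (2 * t)^-1) ^+ 2 + 3 / (4 * t)); last first.
  by field; rewrite gt_eqF.
apply: addr_ge0; first by apply: mulr_ge0; [exact: ltW|exact: sqr_ge0].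
by apply: divr_ge0 => //; apply: mulr_ge0 => //; exact: ltW.
Qed.

(** Now y L <= e^(2 L), and 1 / t is the maximum of 2 L - t L^2. *)
Lemma dcutoff_decay t y : 0 < y -> 0 < t -> t <= 1 ->
  `|y * y * dcutoff t y| <= 4 * expR (t^-1).
Proof.
move=> y0 t0 t1; have L0 := logsq_ge0 y.
have := bracket_bound y; set s := y * bracket y * y => /andP[s0 s1].
rewrite (_ : y * y * dcutoff t y = - (4 * (t * s * (y * logsq y * cutoff t y)))); last first.
  by rewrite /dcutoff /s; ring.
move: s s0 s1 => {}s s0 s1.
have z0 : 0 <= y * logsq y * cutoff t y by rewrite !mulr_ge0 ?cutoff_ge0// ltW.
have ts0 : 0 <= t * s by apply: mulr_ge0 => //; exact: ltW.
rewrite normrN ger0_norm; last by apply: mulr_ge0 => //; exact: mulr_ge0.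
apply: ler_wpM2l => //.
apply: (@le_trans _ _ (1 * (y * logsq y * cutoff t y))).
  by apply: ler_wpM2r => //; rewrite mulr_ile1// ltW.
rewrite mul1r.
apply: (@le_trans _ _ (expR (logsq y) * expR (logsq y) * cutoff t y)).
  apply: ler_wpM2r; first exact: cutoff_ge0.
  apply: ler_pM => //; [exact: ltW|exact: le_expR_logsq|].
  by apply: le_trans (expR_ge1Dx _); rewrite lerDr.
rewrite /cutoff -!expRD ler_expR -subr_ge0.
rewrite [X in 0 <= X](_ : _ = t * (logsq y - t^-1) ^+ 2); last first.
  by field; rewrite gt_eqF.
by rewrite mulr_ge0 ?sqr_ge0// ltW.
Qed.

Lemma cvg_cutoff (ts : nat -> R) y : ts @ \oo --> 0 ->
  (fun n => cutoff (ts n) y) @ \oo --> (1 : R).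
Proof.
move=> t0; rewrite -[X in _ --> X]expR0.
apply: continuous_cvg; first exact: continuous_expR.
rewrite -oppr0; apply: cvgN.
by rewrite -(mul0r (logsq y * logsq y)); apply: cvgM => //; exact: cvg_cst.
Qed.

Lemma cvg_dcutoff (ts : nat -> R) y : ts @ \oo --> 0 ->
  (fun n => dcutoff (ts n) y) @ \oo --> (0 : R).
Proof.
move=> t0; have E := cvg_cutoff y t0.
rewrite [X in _ --> X](_ : _ = - (4 * 0) * (y * bracket y * logsq y) * 1); last by ring.
apply: cvgM => //; apply: cvgM; last exact: cvg_cst.
by apply: cvgN; apply: cvgM => //; exact: cvg_cst.
Qed.

Lemma cvg_ddcutoff (ts : nat -> R) y : ts @ \oo --> 0 ->
  (fun n => ddcutoff (ts n) y) @ \oo --> (0 : R).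
Proof.
move=> t0; have E := cvg_cutoff y t0.
have c4 : (fun n => 4 * ts n) @ \oo --> (4 * 0 : R) by apply: cvgM => //; exact: cvg_cst.
rewrite [X in _ --> X](_ : _ =
  (- (4 * 0) * (bracket y * logsq y - 2 * (y * bracket y) * (y * bracket y) * logsq y
     + 2 * (y * bracket y) * (y * bracket y))
   + (4 * 0) ^+ 2 * (y * bracket y * logsq y) ^+ 2) * 1); last by ring.
apply: cvgM => //; apply: cvgD; apply: cvgM; try exact: cvg_cst; first exact: cvgN.
by rewrite expr2; under eq_fun do rewrite expr2; exact: cvgM.
Qed.

End CutoffBounds.

(** * Testing the equation with a weak solution *)

Section StreamLimit.
Context {R : realType}.
Notation mu := (lebesgue_plane R).
Notation lam := (@lebesgue_measure R).
Notation H := (@half_plane R).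
Notation ip := (inner mu H).
Let mH := @measurable_half_plane R.

Lemma cauchy_real_cvg (u : nat -> R) :
  (forall e, 0 < e -> exists N, forall n m, (N <= n)%N -> (N <= m)%N -> `|u n - u m| <= e) ->
  cvg (u @ \oo).
Proof.
move=> h; apply: cauchy_cvg; apply: cauchy_exP => e e0.
have e2 : 0 < e / 2 by rewrite divr_gt0.
have [N hN] := h _ e2; exists (u N); exists N => // n /= Nn.
rewrite /ball /=; apply: (le_lt_trans (hN _ _ (leqnn N) Nn)).
by rewrite ltr_pdivrMr// ltr_pMr// ltr1n.
Qed.

Lemma ae_fst (P : R -> Prop) : {ae lam, forall x, P x} ->
  {ae mu, forall x : plane R, P x.1}.
Proof.
move=> [N [mN N0 hN]]; exists (N `*` setT); split.
- exact: measurableX.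
- have -> : mu (N `*` setT) = (lam N * lam setT)%E by apply: product_measure1E.
  by rewrite N0 mul0e.
- by move=> x /= nP; split=> //; apply: hN.
Qed.

Lemma ae_eq0_integral (f : R -> \bar R) :
  measurable_fun (setT : set (measurableTypeR R)) f -> (forall x, (0 <= f x)%E) ->
  (\int[lam]_x f x = 0)%E -> {ae lam, forall x, f x = 0%E}.
Proof.
move=> mf f0 i0.
have := (ae_eq_integral_abs lam measurableT mf).1.
move=> /(_ _)/wrap[].
  by rewrite -[RHS]i0; apply: eq_integral => x _; rewrite gee0_abs.
by move=> h; apply: filterS h => x; exact.
Qed.

Lemma limn_einf0_frequently (u : nat -> \bar R) (d : R) N :
  limn_einf u = 0%E -> 0 < d -> exists2 k, (N <= k)%N & (u k <= d%:E)%E.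
Proof.
move=> u0 d0; apply: contrapT => h.
have dk k : (N <= k)%N -> (d%:E <= u k)%E.
  by move=> Nk; rewrite leNgt; apply/negP => /ltW ukd; apply: h; exists k.
have : (d%:E <= limn_einf u)%E.
  rewrite limn_einf_lim; apply: lime_ge; first exact: is_cvg_einfs.
  exists N => // n /= Nn; apply: le_ereal_inf_tmp => _ [k /= nk <-].
  by apply: dk; exact: leq_trans nk.
by rewrite u0 lee_fin leNgt d0.
Qed.

Lemma streamB (f g : R * R -> R) x : tf f -> tf g ->
  stream (fun x => f x - g x) x = stream f x - stream g x.
Proof.
move=> tff tfg; rewrite /stream /Rintegral -fineB; last 2 first.
- by apply: integrable_fin_num => //; apply: continuous_integrable_itv; exact: tf_cont1.
- by apply: integrable_fin_num => //; apply: continuous_integrable_itv; exact: tf_cont1.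
congr fine; rewrite -integralB//; apply: continuous_integrable_itv; exact: tf_cont1.
Qed.

Lemma stream_dirichlet (phi : vfield R) x : stf phi -> H x ->
  stream (phi 0) x ^+ 2 <= x.2 ^+ 2 * dirichlet phi.
Proof.
move=> [tp dp] Hx; apply: (le_trans (stream_bound (tp 0) (tp 1) dp Hx)).
apply: ler_wpM2l; first exact: sqr_ge0.
have p i j : 0 <= ip (partial j (phi i)) (partial j (phi i)) by exact: ip_ge0.
by apply: lerD; rewrite ?lerDr ?p.
Qed.

Variables (phi : nat -> vfield R) (b : vfield R) (Gb : 'I_2 -> vfield R).
Hypothesis ap : appr phi b Gb.

Lemma appr_dirichlet_bounded :
  exists2 K, 0 <= K & \forall k \near \oo, dirichlet (phi k) <= K.
Proof.
have c i j := cvgL2_sq mH (appr_grad ap i j).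
have b4 i j : \forall k \near \oo,
    ip (partial j (phi k i)) (partial j (phi k i)) <= ip (Gb i j) (Gb i j) + 1.
  have l1 : ip (Gb i j) (Gb i j) < ip (Gb i j) (Gb i j) + 1 by rewrite ltrDl.
  exact: (cvgr_le _ (c i j) _ l1).
pose d i j := ip (Gb i j) (Gb i j) + 1.
have d0 i j : 0 <= d i j by rewrite /d addr_ge0// ip_ge0.
exists (d 0 0 + d 0 1 + (d 1 0 + d 1 1)); first by apply: addr_ge0; apply: addr_ge0; exact: d0.
near=> k; rewrite /dirichlet; apply: lerD; apply: lerD; near: k; exact: b4.
Unshelve. all: by end_near. Qed.

Lemma stream_cauchy x : H x ->
  cvg ((fun k => stream (phi k 0) x) @ \oo).
Proof.
move=> Hx; apply: cauchy_real_cvg => e e0.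
have de : 0 < e ^+ 2 / x.2 ^+ 2 by rewrite divr_gt0// exprn_gt0.
have [N hN] := appr_cauchy ap de; exists N => n m Nn Nm.
have [sn sm] := (appr_stf ap n, appr_stf ap m).
have := stream_dirichlet (stfB sn sm) Hx.
rewrite streamB; [|by case: sn|by case: sm].
move=> /le_trans/(_ (ler_wpM2l (sqr_ge0 _) (hN _ _ Nn Nm))).
rewrite mulrC divfK; last by rewrite gt_eqF// exprn_gt0.
by rewrite -[X in X <= _]real_normK ?num_real// ler_sqr ?nnegrE// ltW.
Qed.

Variables (m : R -> R) (C0 : R).
Hypothesis mm : mfun_pos m.
Hypothesis m0 : forall y, 0 <= m y.
Hypothesis bm : forall x, H x -> `|b 0 x| <= m x.2.
Hypothesis mgrowth : forall X, 1 <= X ->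
  (\int[lam]_(y in `[1%R, X]) (m y)%:E <= (C0 * (1 + logsq X))%:E)%E.

Let d k (x : R * R) := x.2^-1 * (phi k 0 x - b 0 x).
Let s k (x1 : R) := (\int[lam]_(y in `]0%R, +oo[) ((d k (x1, y)) ^+ 2)%:E)%E.

Let md k : mfun_half (fun x => (d k x ^+ 2)%:E).
Proof.
apply/measurable_EFinP; apply: measurable_funX; apply: measurable_funM.
  by case: (@locbd_inv2 R).
apply: measurable_funB; last exact: appr_meas ap 0.
by apply: tf_measurable; case: (appr_stf ap k).
Qed.

(** The integrals of [s k] over x_1 tend to 0, so by Fatou's lemma the liminf vanishes on almost
    every vertical line. Smallness for infinitely many k suffices, because the stream functions
    converge at every point along the whole sequence. *)
Let ae_slice_frequently : {ae lam, forall x1, limn_einf (s^~ x1) = 0%E}.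
Proof.
have ms k : measurable_fun (setT : set (measurableTypeR R)) (s k).
  by apply: (measurable_int_slice1 (md k)) => x _; rewrite lee_fin sqr_ge0.
have s0 k x : (0 <= s k x)%E by apply: integral_ge0 => y _; rewrite lee_fin sqr_ge0.
have cv := appr_weight 0 ap (@weightp_inv2 R).
have ise k : (\int[lam]_x s k x = (ip (fun x => x.2^-1 * phi k 0 x - x.2^-1 * b 0 x)
    (fun x => x.2^-1 * phi k 0 x - x.2^-1 * b 0 x))%:E)%E.
  have [Ib In _] := cv.
  rewrite -(ipE mH (inL2B mH (In k) Ib)) (@tonelli_H1 _ (fun x => _)); last first.
  - by move=> x _; rewrite lee_fin sqr_ge0.
  - by apply/measurable_EFinP; apply: measurable_funX; case: (inL2B mH (In k) Ib).
  by apply: eq_integral => x _; apply: eq_integral => y _; rewrite /d /= mulrBr.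
apply: ae_eq0_integral.
- rewrite /limn_einf; apply: measurableT_comp => //.
  by apply: measurable_fun_limn_esup => n; exact: measurableT_comp.
- move=> x; rewrite limn_einf_lim; apply: lime_ge; first exact: is_cvg_einfs.
  by apply: nearW => n; apply: le_ereal_inf_tmp => _ [k _ <-].
apply/eqP; rewrite eq_le; apply/andP; split; last first.
  apply: integral_ge0 => x _.
  rewrite limn_einf_lim; apply: lime_ge; first exact: is_cvg_einfs.
  by apply: nearW => n; apply: le_ereal_inf_tmp => _ [k _ <-].
apply: (le_trans (fatou lam measurableT ms (fun k x _ => s0 k x))).
have cs : (fun k => (\int[lam]_x s k x)%E) @ \oo --> 0%E.
  under eq_fun do rewrite ise.
  by case: cv => _ _ cv; apply: cvg_EFin => //; exact: nearW.
by rewrite (cvg_limn_einf_sup cs).1.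
Qed.

(** Between heights 1 and [X], |phi| <= m + y |d|, and Young's inequality gives X |d| <= dd / 2 +
    X^2 d^2 / (2 dd). The hypothesis on [s k] makes the integral of these two terms at most
    [dd * X ^+ 2]. *)
Let stream_slice_close (x1 X dd : R) k : 1 <= X -> 0 < dd ->
  (s k x1 <= (dd ^+ 2)%:E)%E ->
  `|stream (phi k 0) (x1, X)| <=
  `|stream (phi k 0) (x1, 1)| + C0 * (1 + logsq X) + dd * X ^+ 2.
Proof.
move=> X1 d0 sk; have tk := (appr_stf ap k).1 0.
have X0 : 0 < X by exact: lt_le_trans X1.
apply: (le_trans (stream_growth tk x1 X1)); rewrite -addrA lerD2l.
have I1 : lam.-integrable `[1, X] (EFin \o (fun t => `|phi k 0 (x1, t)|)).
  apply: continuous_integrable_itv => t; apply: cvg_norm; exact: tf_cont1.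
rewrite -lee_fin /Rintegral fineK; last exact: integrable_fin_num I1.
have sub1 : `[1, X] `<=` `]0, +oo[%classic.
  move=> t; rewrite /= !in_itv /= andbT => /andP[t1 _]; exact: lt_le_trans t1.
have mdk : measurable_fun (`[1%R, X]%classic : set (measurableTypeR R))
    (fun y => ((d k (x1, y)) ^+ 2)%:E).
  by apply: (measurable_funS _ sub1) => //; exact: (measurable_slice2 x1 (md k)).
have mmX : measurable_fun (`[1%R, X]%classic : set (measurableTypeR R)) (fun y => (m y)%:E).
  by apply/measurable_EFinP; exact: (measurable_funS _ sub1).
have c0 : 0 <= X ^+ 2 / (2 * dd) by apply: divr_ge0; [exact: sqr_ge0|rewrite mulr_ge0// ltW].
apply: (@le_trans _ _ (\int[lam]_(y in `[1%R, X])
   ((m y)%:E + ((2^-1 * dd)%:E + (X ^+ 2 / (2 * dd))%:E * (d k (x1, y) ^+ 2)%:E)))%E).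
  apply: ge0_le_integral => //.
  - by apply: (measurable_int lam); exact: I1.
  - by apply: emeasurable_funD => //; apply: emeasurable_funD => //; exact: measurable_funeM.
  move=> y; rewrite /= in_itv /= => /andP[y1 yX].
  have y0 : 0 < y by exact: lt_le_trans y1.
  rewrite -EFinM -!EFinD lee_fin.
  have -> : phi k 0 (x1, y) = b 0 (x1, y) + y * d k (x1, y).
    by rewrite /d /=; field; rewrite gt_eqF.
  apply: (le_trans (ler_normD _ _)); apply: lerD; first exact: (bm (x := (x1, y))).
  rewrite normrM (gtr0_norm y0) -(real_normK (num_real (d k _))).
  move: (`|d k (x1, y)|) (normr_ge0 (d k (x1, y))) => a a0.
  apply: (@le_trans _ _ (X * a)); first exact: ler_wpM2r.
  rewrite -subr_ge0 [X in 0 <= X](_ : _ = (dd - X * a) ^+ 2 / (2 * dd)); last first.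
    by field; rewrite gt_eqF.
  by apply: divr_ge0; [exact: sqr_ge0|rewrite mulr_ge0// ltW].
rewrite ge0_integralD//; last 3 first.
- by move=> y _; rewrite lee_fin.
- move=> y _; rewrite -EFinM -EFinD lee_fin; apply: addr_ge0.
    by rewrite mulr_ge0// ltW.
  by rewrite mulr_ge0// sqr_ge0.
- by apply: emeasurable_funD => //; exact: measurable_funeM.
rewrite EFinD; apply: leeD; first exact: mgrowth.
rewrite ge0_integralD//; last 3 first.
- by move=> y _; rewrite lee_fin mulr_ge0// ltW.
- by move=> y _; rewrite -EFinM lee_fin mulr_ge0// sqr_ge0.
- exact: measurable_funeM.
rewrite ge0_integralZl_EFin//; last by move=> y _; rewrite lee_fin sqr_ge0.
have lE : lam `[1%R, X]%classic = (X - 1)%:E.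
  rewrite lebesgue_measure_itv/= lte_fin; case: ltP => h //.
  by congr EFin; lra.
rewrite integral_cst// [X in (_ * X + _)%E](_ : _ = (X - 1)%:E); last exact: lE.
apply: (@le_trans _ _ ((2^-1 * dd)%:E * (X - 1)%:E + (X ^+ 2 / (2 * dd))%:E * (dd ^+ 2)%:E)%E).
  apply: leeD => //; apply: lee_wpmul2l => //; apply: le_trans sk.
  apply: ge0_subset_integral => //; first exact: (measurable_slice2 x1 (md k)).
  by move=> y _; rewrite lee_fin sqr_ge0.
rewrite -!EFinM -EFinD lee_fin.
rewrite (_ : X ^+ 2 / (2 * dd) * dd ^+ 2 = 2^-1 * dd * X ^+ 2); last first.
  by field; rewrite gt_eqF.
have : 2^-1 * dd * (X - 1) <= 2^-1 * dd * X ^+ 2.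
  apply: ler_wpM2l; first by rewrite mulr_ge0// ltW.
  have : X * 1 <= X * X by apply: ler_wpM2l => //; exact: ltW.
  by rewrite expr2; lra.
by lra.
Qed.

Lemma exists_stream_limit : exists (Psi : R * R -> R) (C : R),
  [/\ mfun_half Psi, 0 <= C,
      (forall x, H x -> `|Psi x| <= C * (1 + logsq x.2)) &
      {ae mu, forall x, H x -> (fun k => stream (phi k 0) x) @ \oo --> Psi x}].
Proof.
pose P0 (x : R * R) : R := lim ((fun k => stream (phi k 0) x) @ \oo).
have P0c x : H x -> (fun k => stream (phi k 0) x) @ \oo --> P0 x by exact: stream_cauchy.
have mP0 : mfun_half P0.
  apply: (measurable_fun_cvg (h := fun k => stream (phi k 0))) => // k.
  by apply: tf_measurable; case: (appr_stf ap k) => t dv; exact: tf_stream (t 0) (t 1) dv.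
have [K K0 hK] := appr_dirichlet_bounded.
have small k x : H x -> x.2 <= 1 -> dirichlet (phi k) <= K ->
    `|stream (phi k 0) x| <= 1 + K.
  move=> Hx x1 Dk; have := stream_dirichlet (appr_stf ap k) Hx.
  rewrite -real_normK ?num_real//; move: `|_| (normr_ge0 (stream (phi k 0) x)) => a a0 h.
  have : x.2 ^+ 2 * dirichlet (phi k) <= 1 * K.
    apply: ler_pM => //; first exact: sqr_ge0.
      by apply: le_trans (ip_le_dirichlet _ 0 0); exact: ip_ge0.
    by rewrite -(expr1n _ 2) ler_sqr ?nnegrE// ltW.
  have := sqr_ge0 (a - 1); rewrite sqrrB; lra.
(* [1 + K] bounds the stream functions up to height 1, since 2 a <= 1 + a^2, and [C0] accounts for
   the growth above that height. *)
pose C := 1 + K + `|C0|.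
have C_ge0 : 0 <= C by rewrite /C !addr_ge0.
pose B (x : R * R) := C * (1 + logsq x.2).
have B0 x : 0 <= B x by rewrite mulr_ge0// addr_ge0// logsq_ge0.
have mB : mfun_half B.
  apply: measurable_funM => //; apply: measurable_funD => //.
  by case: (continuous_locbd (smooth_continuous (@smooth_logsq R))).
(* The bound on the pointwise limit [P0] is established only on almost every vertical line; clipping
   at [B] makes it hold everywhere. *)
pose Psi x := Num.max (- B x) (Num.min (B x) (P0 x)).
exists Psi, C; split => //.
- by apply: measurable_maxr; [exact: measurable_funN|exact: measurable_minr].
- move=> x Hx; rewrite ler_norml /Psi; apply/andP; split.
    by rewrite le_max lexx.
  rewrite ge_max; apply/andP; split; first by have := B0 x; rewrite /B; lra.
  by rewrite ge_min lexx.
apply: aeS (ae_fst ae_slice_frequently) => -[x1 X] /= h Hx.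
suff PB : `|P0 (x1, X)| <= B (x1, X).
  have -> : Psi (x1, X) = P0 (x1, X); last exact: P0c.
  by move: PB; rewrite /Psi ler_norml => /andP[p1 p2]; rewrite min_r// max_r.
have L0 := logsq_ge0 X.
have CB : 1 + K <= B (x1, X).
  rewrite /B /C /= mulrDr mulr1.
  have : 0 <= (1 + K + `|C0|) * logsq X by rewrite mulr_ge0.
  by have := normr_ge0 C0; lra.
have cn : (fun k => `|stream (phi k 0) (x1, X)|) @ \oo --> `|P0 (x1, X)|.
  by apply: cvg_norm; exact: P0c.
have [X1|X1] := leP X 1.
  apply: le_trans CB; rewrite -(cvg_lim _ cn)//; apply: limr_le.
    by apply/cvg_ex; exists `|P0 (x1, X)|.
  by apply: filterS hK => k Dk; exact: small.
apply/ler_addgt0Pr => e e0.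
have e2 : 0 < e / 2 by rewrite divr_gt0.
(* Chosen so that the slice error [dd * X ^+ 2] is e / 2; the other half of e covers the distance to
   the limit. *)
pose dd := e / 2 / X ^+ 2.
have dd0 : 0 < dd by rewrite divr_gt0// exprn_gt0.
have [N1 _ hN1] := hK.
have /cvgrPdist_le/(_ _ e2)[N2 _ hN2] := cn.
have dd20 : 0 < dd ^+ 2 by rewrite exprn_gt0.
have [k] := limn_einf0_frequently (maxn N1 N2) h dd20.
rewrite geq_max => /andP[k1 k2] sk.
have := stream_slice_close (ltW X1) dd0 sk.
have := hN2 _ k2; rewrite /= ler_norml => /andP[_ c2].
have sm : `|stream (phi k 0) (x1, 1)| <= 1 + K.
  by apply: small => //=; [rewrite /half_plane /=|exact: hN1].
have -> : dd * X ^+ 2 = e / 2 by rewrite /dd divfK// gt_eqF// exprn_gt0.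
have : C0 * (1 + logsq X) <= `|C0| * (1 + logsq X).
  by apply: ler_wpM2r; [rewrite addr_ge0|exact: ler_norm].
have : 0 <= (1 + K) * logsq X by rewrite mulr_ge0// addr_ge0.
rewrite /B /C /= => p1 p2 p3.
by move: c2 sm p1 p2 p3; lra.
Qed.
End StreamLimit.

(** * The two limits in the cut-off test fields *)

Section KeyIdentity.
Context {R : realType}.
Notation mu := (lebesgue_plane R).
Notation H := (@half_plane R).
Notation ip := (inner mu H).
Notation inL2 := (inL2 mu H).
Notation cvgL2 := (cvgL2 mu H).
Let mH := @measurable_half_plane R.

Lemma cvg_sum4 (f : nat -> 'I_2 -> 'I_2 -> R) (l : 'I_2 -> 'I_2 -> R) :
  (forall i j, (fun n => f n i j) @ \oo --> l i j) ->
  (fun n => sum4 (f n)) @ \oo --> sum4 l.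
Proof. by move=> h; apply: cvgD; apply: cvgD; exact: h. Qed.

Lemma cvg_eq_lim (f g : nat -> R) (a b : R) : (forall n, f n = g n) ->
  f @ \oo --> a -> g @ \oo --> b -> a = b.
Proof.
move=> fg fa gb; apply: (cvg_unique _ fa) => //.
by rewrite (_ : f = g)//; apply/funext.
Qed.

Lemma smooth_measurable (f : R * R -> R) : smooth f ->
  mfun_half f.
Proof. by move=> sf; case: (continuous_locbd (smooth_continuous sf)). Qed.

Lemma smooth_ddcutoff (t : R) : smooth (fun x : R * R => ddcutoff t x.2).
Proof.
have [_ _ _ <-] := smooth_snd_fun (@is_derive_dcutoff R t).
by apply: smooth_partial; exact: smooth_dcutoff.
Qed.

Variables (phi : nat -> vfield R) (b : vfield R) (Gb : 'I_2 -> vfield R).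
Hypothesis ab : appr phi b Gb.
Variables (Cb : R) (wb : forall j, weightp (b j) Cb).
Variables (Psi : R * R -> R) (CP : R).
Hypothesis mPsi : mfun_half Psi.
Hypothesis CP0 : 0 <= CP.
Hypothesis PsiB : forall x, H x -> `|Psi x| <= CP * (1 + logsq x.2).
Hypothesis PsiL :
  {ae mu, forall x, H x -> (fun k => stream (phi k 0) x) @ \oo --> Psi x}.
Variables (psi : nat -> vfield R) (u : vfield R) (Gu : 'I_2 -> vfield R).
Hypothesis au : appr psi u Gu.

(** The derivatives d_2 and -d_1 of [cutoff t x.2 * stream (phi k 0) x], written out; the term with
    [dcutoff] is what keeps the field solenoidal. *)
Let cut_field (t : R) (k : nat) : vfield R := fun i x =>
  if i == 0 then cutoff t x.2 * phi k 0 x + dcutoff t x.2 * stream (phi k 0) x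
  else cutoff t x.2 * phi k 1 x.

Let tphi k i : tf (phi k i). Proof. by case: (appr_stf ab k). Qed.

Let tstream k : tf (stream (phi k 0)).
Proof. by case: (appr_stf ab k) => tp dp; exact: tf_stream (tp 0) (tp 1) dp. Qed.

Let der (f : R * R -> R) j x : smooth f ->
  derivable f x (((j : 'I_2) == 0)%:R : R, ((j : 'I_2) == 1)%:R : R).
Proof. exact: smooth_derivable. Qed.

Let p_cut (t : R) :
  partial 0 (fun x : R * R => cutoff t x.2) = (fun=> 0) /\
  partial 1 (fun x : R * R => cutoff t x.2) = (fun x => dcutoff t x.2).
Proof. by have [_ _ p0 p1] := smooth_snd_fun (@is_derive_cutoff R t). Qed.

Let p_dcut (t : R) :
  partial 0 (fun x : R * R => dcutoff t x.2) = (fun=> 0) /\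
  partial 1 (fun x : R * R => dcutoff t x.2) = (fun x => ddcutoff t x.2).
Proof. by have [_ _ p0 p1] := smooth_snd_fun (@is_derive_dcutoff R t). Qed.

Let partial_cut j t (f : R * R -> R) : tf f ->
  partial j (fun x => cutoff t x.2 * f x) =
  fun x => cutoff t x.2 * partial j f x + f x * partial j (fun x : R * R => cutoff t x.2) x.
Proof.
move=> [sf _]; apply/funext => x.
exact: (partialM (@der _ j x (@smooth_cutoff R t)) (@der _ j x sf)).
Qed.

Let partial_dcut j t (f : R * R -> R) : tf f ->
  partial j (fun x => dcutoff t x.2 * f x) =
  fun x => dcutoff t x.2 * partial j f x + f x * partial j (fun x : R * R => dcutoff t x.2) x.
Proof.
move=> [sf _]; apply/funext => x.
exact: (partialM (@der _ j x (@smooth_dcutoff R t)) (@der _ j x sf)).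
Qed.

Let cut_partial t k (i j : 'I_2) x : partial j (cut_field t k i) x =
  if i == 0 then
    if j == 0 then cutoff t x.2 * partial 0 (phi k 0) x - dcutoff t x.2 * phi k 1 x
    else cutoff t x.2 * partial 1 (phi k 0) x + 2 * (dcutoff t x.2 * phi k 0 x)
         + ddcutoff t x.2 * stream (phi k 0) x
  else
    if j == 0 then cutoff t x.2 * partial 0 (phi k 1) x
    else cutoff t x.2 * partial 1 (phi k 1) x + dcutoff t x.2 * phi k 1 x.
Proof.
have [tp dp] := appr_stf ab k.
have [c0 c1] := p_cut t; have [d0 d1] := p_dcut t.
have ps0 := partial_stream0 (tp 0) (tp 1) dp; have ps1 := partial_stream1 (tp 0).
have sE := smoothM (@smooth_cutoff R t) (tp 0).1.
have sD := smoothM (@smooth_dcutoff R t) (tstream k).1.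
have pD j' := partialD (@der _ j' x sE) (@der _ j' x sD).
have [->|->] := ord2 i; have [->|->] := ord2 j; rewrite /cut_field /=.
- rewrite (pD 0) (partial_cut 0 t (tp 0)) (partial_dcut 0 t (tstream k)) c0 d0 ps0.
  by rewrite !mulr0 !addr0 mulrN.
- rewrite (pD 1) (partial_cut 1 t (tp 0)) (partial_dcut 1 t (tstream k)) c1 d1 ps1.
  move: (cutoff t x.2) (dcutoff t x.2) (ddcutoff t x.2) (stream (phi k 0) x) => A B C D.
  by move: (partial 1 (phi k 0) x) (phi k 0 x) => E F; ring.
- by rewrite (partial_cut 0 t (tp 1)) c0 mulr0 addr0.
- by rewrite (partial_cut 1 t (tp 1)) c1 (mulrC (phi k 1 x)).
Qed.

Let stf_cut t k : stf (cut_field t k).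
Proof.
have [tp dp] := appr_stf ab k; split=> [i|x].
  have [->|->] := ord2 i; rewrite /cut_field /=.
    by apply: tfD; apply: tfM => //; [exact: smooth_cutoff|exact: smooth_dcutoff].
  by apply: tfM => //; exact: smooth_cutoff.
rewrite (cut_partial t k 0 0) (cut_partial t k 1 1) /=.
have := dp x; move: (partial 0 (phi k 0) x) (partial 1 (phi k 1) x) => p q pq.
by rewrite addrACA -mulrDr addrC pq mulr0 addr0 addNr.
Qed.

Let cut_hardy i : cvgL2 (fun k x => x.2^-1 * phi k i x) (fun x => x.2^-1 * b i x).
Proof. exact: appr_weight i ab (@weightp_inv2 R). Qed.

(** Hardy's inequality twice, with q = 1 for the stream function and q = 0 for its derivative
    [phi k 0]; hence 16 = 4 * 4. *)
Let cut_stream : cvgL2 (fun k x => x.2^-1 ^+ 2 * stream (phi k 0) x)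
   (fun x => x.2^-1 ^+ 2 * Psi x).
Proof.
have lV := locbdX 2 (@locbd_inv2 R).
apply: (@appr_op _ phi b Gb (fun psi x => x.2^-1 ^+ 2 * stream (psi 0) x) _ 16) => //.
- move=> p [tp dp]; have ts := tf_stream (tp 0) (tp 1) dp.
  by apply: locbd_inL2; [exact: locbdM lV (tf_locbd ts)|apply: csuppM; exact: tf_csupp].
- move=> p [tp dp]; have ts := tf_stream (tp 0) (tp 1) dp.
  apply: (le_trans (hardy 1 ts)); rewrite (partial_stream1 (tp 0)).
  have -> : ip (fun x => x.2^-1 ^+ 1 * p 0 x) (fun x => x.2^-1 ^+ 1 * p 0 x) =
      ip (fun x => x.2^-1 * p 0 x) (fun x => x.2^-1 * p 0 x) by apply: eq_ip => x _; rewrite expr1.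
  have h1 := weightp_ip (@weightp_inv2 R) (tp 0).
  have h2 := ip_le_dirichlet p 0 1.
  apply: (@le_trans _ _ (4 * (4 * dirichlet p))).
    by apply: ler_wpM2l => //; apply: (le_trans h1); apply: ler_wpM2l.
  by rewrite mulrA -natrM.
- by move=> p q x [tp _] [tq _] _; rewrite streamB// mulrBr.
- by apply: measurable_funM => //; case: lV.
- apply: aeS PsiL => x h Hx; apply: cvgM; [exact: cvg_cst|exact: h].
Qed.

Let iu j : inL2 (fun x => x.2^-1 * u j x).
Proof. by have [] := appr_weight j au (@weightp_inv2 R). Qed.

Let cut_u i j : cvgL2 (fun k x => (x.2^-1 * u j x) * phi k i x)
   (fun x => (x.2^-1 * u j x) * b i x).
Proof. by have [C w] := weightp_appr j au; exact: appr_weight ab w. Qed.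

(** Here the first factor is bounded pointwise by the Dirichlet norm, through [stream_dirichlet],
    and the second is a fixed L2 function by Hardy's inequality. *)
Let cut_ustream j : cvgL2
   (fun k x => (x.2^-1 * stream (phi k 0) x) * (x.2^-1 * u j x))
   (fun x => (x.2^-1 * Psi x) * (x.2^-1 * u j x)).
Proof.
have lV := @locbd_inv2 R.
have bound p x : stf p -> H x -> (x.2^-1 * stream (p 0) x) ^+ 2 <= dirichlet p.
  move=> sp Hx; have h := stream_dirichlet sp Hx.
  have x0 : 0 < x.2 ^+ 2 by rewrite exprn_gt0.
  by rewrite exprMn exprVn mulrC ler_pdivrMr// mulrC.
have D0 (p : vfield R) : 0 <= dirichlet p.
  by apply: le_trans (ip_le_dirichlet p 0 0); exact: ip_ge0.
have ms (p : vfield R) : stf p -> mfun_half (fun x => x.2^-1 * stream (p 0) x).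
  move=> [tp dp]; have ts := tf_stream (tp 0) (tp 1) dp.
  by case: (locbdM lV (tf_locbd ts)).
have bound1 p x : stf p -> H x -> `|x.2^-1 * stream (p 0) x| <= Num.sqrt (dirichlet p).
  by move=> sp Hx; rewrite -sqrtr_sqr ler_wsqrtr// bound.
have IT p : stf p -> inL2 (fun x => (x.2^-1 * stream (p 0) x) * (x.2^-1 * u j x)).
  move=> sp; exact: (inL2M mH (ms p sp) (fun x Hx => bound1 p x sp Hx) (iu j)).
apply: (@appr_op _ phi b Gb
  (fun psi x => (x.2^-1 * stream (psi 0) x) * (x.2^-1 * u j x)) _
  (ip (fun x => x.2^-1 * u j x) (fun x => x.2^-1 * u j x))) => //.
- exact: ip_ge0.
- move=> p sp; set q := Num.sqrt (dirichlet p).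
  have -> : ip (fun x => x.2^-1 * u j x) (fun x => x.2^-1 * u j x) * dirichlet p =
      ip (fun x => q * (x.2^-1 * u j x)) (fun x => q * (x.2^-1 * u j x)).
    rewrite ipZl ?ipZr//; last exact: inL2Z.
    by rewrite mulrA -expr2 (sqr_sqrtr (D0 p)); exact: mulrC.
  apply: (ip_le mH (IT p sp) (inL2Z mH q (iu j))) => x Hx.
  rewrite !normrM -normrM ler_wpM2r ?mulr_ge0//.
  by rewrite (le_trans (bound1 p x sp Hx))// ler_norm.
- by move=> p q x [tp _] [tq _] _; rewrite streamB// mulrBr mulrBl.
- apply: measurable_funM; last by case: (iu j).
  by apply: measurable_funM => //; case: lV.
- apply: aeS PsiL => x h Hx.
  by apply: cvgM; [apply: cvgM; [exact: cvg_cst|exact: h]|exact: cvg_cst].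
Qed.

Let m_snd : mfun_half (fun x : R * R => x.2).
Proof. exact: smooth_measurable (@smooth_snd R). Qed.

Let mE (t : R) := smooth_measurable (@smooth_cutoff R t).
Let mD (t : R) := smooth_measurable (@smooth_dcutoff R t).
Let mDD (t : R) := smooth_measurable (@smooth_ddcutoff t).
Let mD1 (t : R) := measurable_funM m_snd (mD t).
Let mX1 (t : R) := measurable_funM m_snd (mE t).
Let mX2 (t : R) := measurable_funM (measurable_funM m_snd m_snd) (mD t).
Let mD2 (t : R) := measurable_funM (measurable_funM m_snd m_snd) (mDD t).

Let bE (t : R) : 0 < t -> forall x, H x -> `|cutoff t x.2| <= 1.
Proof.
move=> t0 x Hx; rewrite ger0_norm ?cutoff_ge0//.
by apply: cutoff_le1; exact: ltW.
Qed.

Let bD1 (t : R) : 0 < t -> t <= 1 -> forall x, H x -> `|x.2 * dcutoff t x.2| <= 8.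
Proof.
move=> t0 t1 x Hx; apply: le_trans (dcutoff_bound Hx (ltW t0) t1).
by rewrite ler_peMr// lerDl logsq_ge0.
Qed.

Let bD2 (t : R) : 0 < t -> t <= 1 -> forall x, H x -> `|x.2 * x.2 * ddcutoff t x.2| <= 40.
Proof. by move=> t0 t1 x Hx; exact: (ddcutoff_bound Hx (ltW t0) t1). Qed.

(** The gradient of the cut field after k has tended to infinity. Powers of x_2 are distributed so
    that every coefficient is bounded uniformly in t and multiplies a fixed L2 function. *)
Let Dlim (t : R) (i j : 'I_2) (x : R * R) : R :=
  if i == 0 then
    if j == 0 then cutoff t x.2 * Gb 0 0 x - (x.2 * dcutoff t x.2) * (x.2^-1 * b 1 x)
    else cutoff t x.2 * Gb 0 1 x + 2 * ((x.2 * dcutoff t x.2) * (x.2^-1 * b 0 x))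
         + (x.2 * x.2 * ddcutoff t x.2) * (x.2^-1 ^+ 2 * Psi x)
  else
    if j == 0 then cutoff t x.2 * Gb 1 0 x
    else cutoff t x.2 * Gb 1 1 x + (x.2 * dcutoff t x.2) * (x.2^-1 * b 1 x).

Let cvg_grad (t : R) i j : 0 < t -> t <= 1 ->
  cvgL2 (fun k => partial j (cut_field t k i)) (Dlim t i j).
Proof.
move=> t0 t1.
have cG i' j' := cvgL2M mH (mE t) (bE t0) (appr_grad ab i' j').
have cH i' := cvgL2M mH (mD1 t) (bD1 t0 t1) (cut_hardy i').
have cS := cvgL2M mH (mD2 t) (bD2 t0 t1) cut_stream.
have n0 x : H x -> x.2 != 0 by move=> Hx; rewrite gt_eqF.
have [->|->] := ord2 i; have [->|->] := ord2 j.
- apply: eq_cvgL2 (cvgL2B mH (cG 0 0) (cH 1)) => [k x Hx|x Hx] //.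
  rewrite (cut_partial t k 0 0) /=; congr (_ - _).
  by move: (dcutoff _ _) (phi k 1 x) => A B; field; exact: n0.
- apply: eq_cvgL2 (cvgL2D mH (cvgL2D mH (cG 0 1) (cvgL2Z mH 2 (cH 0))) cS) => [k x Hx|x Hx] //.
  rewrite (cut_partial t k 0 1) /=; congr (_ + 2 * _ + _).
    by move: (dcutoff _ _) (phi k 0 x) => A B; field; exact: n0.
  by move: (ddcutoff _ _) (stream _ x) => A B; field; exact: n0.
- apply: eq_cvgL2 (cG 1 0) => [k x Hx|x Hx]; last by rewrite /Dlim.
  by rewrite (cut_partial t k 1 0).
- apply: eq_cvgL2 (cvgL2D mH (cG 1 1) (cH 1)) => [k x Hx|x Hx] //.
  rewrite (cut_partial t k 1 1) /=; congr (_ + _).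
  by move: (dcutoff _ _) (phi k 1 x) => A B; field; exact: n0.
Qed.

(** The convective products after the limit in k. In this grouping the coefficients x_2 E and x_2^2
    E' are bounded for each t, but not uniformly. *)
Let Ulim (t : R) (i j : 'I_2) (x : R * R) : R :=
  if i == 0 then (x.2 * cutoff t x.2) * ((x.2^-1 * u j x) * b 0 x)
     + (x.2 * x.2 * dcutoff t x.2) * ((x.2^-1 * Psi x) * (x.2^-1 * u j x))
  else (x.2 * cutoff t x.2) * ((x.2^-1 * u j x) * b 1 x).

Let cvg_trans (t : R) i j : 0 < t -> t <= 1 ->
  cvgL2 (fun k x => u j x * cut_field t k i x) (Ulim t i j).
Proof.
move=> t0 t1.
have b1 x : H x -> `|x.2 * cutoff t x.2| <= expR t^-1.
  by move=> Hx; exact: cutoff_decay.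
have b2 x : H x -> `|x.2 * x.2 * dcutoff t x.2| <= 4 * expR t^-1.
  by move=> Hx; exact: dcutoff_decay.
have c1 i' := cvgL2M mH (mX1 t) b1 (cut_u i' j).
have c2 := cvgL2M mH (mX2 t) b2 (cut_ustream j).
have n0 x : H x -> x.2 != 0 by move=> Hx; rewrite gt_eqF.
have [->|->] := ord2 i.
- apply: eq_cvgL2 (cvgL2D mH (c1 0) c2) => [k x Hx|x Hx] //.
  rewrite /cut_field /=.
  move: (dcutoff _ _) (cutoff _ _) (stream _ x) (phi k 0 x) (u j x) => A B C D E.
  by field; exact: n0.
- apply: eq_cvgL2 (c1 1) => [k x Hx|x Hx] //.
  rewrite /cut_field /=.
  move: (cutoff _ _) (phi k 1 x) (u j x) => B D E.
  by field; exact: n0.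
Qed.

Let ts (n : nat) : R := n.+1%:R^-1.

Let ts0 n : 0 < ts n. Proof. by rewrite invr_gt0. Qed.

Let ts1 n : ts n <= 1. Proof. by rewrite invf_le1// ler1n. Qed.

Let cvg_ts : ts @ \oo --> 0. Proof. exact: cvg_harmonic. Qed.

Let cvg_ED x : H x ->
  [/\ (fun n => cutoff (ts n) x.2) @ \oo --> (1 : R),
      (fun n => x.2 * dcutoff (ts n) x.2) @ \oo --> (0 : R) &
      (fun n => x.2 * x.2 * ddcutoff (ts n) x.2) @ \oo --> (0 : R)].
Proof.
move=> Hx; split; first exact: cvg_cutoff.
- rewrite -(mulr0 x.2); apply: cvgM; [exact: cvg_cst|exact: cvg_dcutoff].
- rewrite -(mulr0 (x.2 * x.2)); apply: cvgM; [exact: cvg_cst|exact: cvg_ddcutoff].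
Qed.

Let cvg_Dlim i j : cvgL2 (fun n => Dlim (ts n) i j) (Gb i j).
Proof.
have IG i' j' : inL2 (Gb i' j') by have [] := appr_grad ab i' j'.
have Ib i' : inL2 (fun x => x.2^-1 * b i' x) by have [] := cut_hardy i'.
have IP : inL2 (fun x => x.2^-1 ^+ 2 * Psi x) by have [] := cut_stream.
have cG i' j' := cvgL2_mulseq mH (fun n => mE (ts n)) (@measurable_cst _ _ _ _ _ (1 : R))
  (fun n => bE (ts0 n)) (fun x Hx => let: And3 h _ _ := cvg_ED Hx in h) (IG i' j').
have cH i' := cvgL2_mulseq mH (fun n => mD1 (ts n)) (@measurable_cst _ _ _ _ _ (0 : R))
  (fun n => bD1 (ts0 n) (ts1 n)) (fun x Hx => let: And3 _ h _ := cvg_ED Hx in h) (Ib i').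
have cS := cvgL2_mulseq mH (fun n => mD2 (ts n)) (@measurable_cst _ _ _ _ _ (0 : R))
  (fun n => bD2 (ts0 n) (ts1 n)) (fun x Hx => let: And3 _ _ h := cvg_ED Hx in h) IP.
have [->|->] := ord2 i; have [->|->] := ord2 j.
- apply: eq_cvgL2 (cvgL2B mH (cG 0 0) (cH 1)) => [k x Hx|x Hx] //.
  by rewrite mul1r mul0r subr0.
- apply: eq_cvgL2 (cvgL2D mH (cvgL2D mH (cG 0 1) (cvgL2Z mH 2 (cH 0))) cS) => [k x Hx|x Hx] //.
  by rewrite mul1r !mul0r mulr0 !addr0.
- apply: eq_cvgL2 (cG 1 0) => [k x Hx|x Hx] //.
  by rewrite mul1r.
- apply: eq_cvgL2 (cvgL2D mH (cG 1 1) (cH 1)) => [k x Hx|x Hx] //.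
  by rewrite mul1r mul0r addr0.
Qed.

(** For the limit in t the products are regrouped as E (u_j b_i) and (x_2 E' Psi) (u_j / x_2). The
    first uses that [b i] is a multiplier; in the second, the logarithmic bound on [Psi] makes the
    coefficient at most [8 * CP], and it tends to 0 pointwise. *)
Let cvg_Ulim i j : cvgL2 (fun n => Ulim (ts n) i j) (fun x => u j x * b i x).
Proof.
have Iub i' : inL2 (fun x => u j x * b i' x).
  have [h _ _] := appr_weight j au (wb i'); apply: eq_inL2 h => x _; exact: mulrC.
have c1 i' := cvgL2_mulseq mH (fun n => mE (ts n)) (@measurable_cst _ _ _ _ _ (1 : R))
  (fun n => bE (ts0 n)) (fun x Hx => let: And3 h _ _ := cvg_ED Hx in h) (Iub i').
have mDP n := measurable_funM (mD1 (ts n)) mPsi.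
have bDP n x : H x -> `|x.2 * dcutoff (ts n) x.2 * Psi x| <= 8 * CP.
  move=> Hx; rewrite normrM.
  apply: (@le_trans _ _ (`|x.2 * dcutoff (ts n) x.2| * (CP * (1 + logsq x.2)))).
    by apply: ler_wpM2l => //; exact: PsiB.
  rewrite mulrCA mulrC; apply: ler_wpM2r => //.
  exact: (dcutoff_bound Hx (ltW (ts0 n)) (ts1 n)).
have cDP x : H x -> (fun n => x.2 * dcutoff (ts n) x.2 * Psi x) @ \oo --> (0 : R).
  move=> Hx; rewrite -(mul0r (Psi x)); apply: cvgM; last exact: cvg_cst.
  by have [_ h _] := cvg_ED Hx.
have c2 := cvgL2_mulseq mH mDP (@measurable_cst _ _ _ _ _ (0 : R)) bDP cDP (iu j).
have n0 x : H x -> x.2 != 0 by move=> Hx; rewrite gt_eqF.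
have [->|->] := ord2 i.
- apply: eq_cvgL2 (cvgL2D mH (c1 0) c2) => [n x Hx|x Hx]; last first.
    by rewrite mul1r mul0r addr0.
  rewrite /Ulim /=.
  move: (dcutoff _ _) (cutoff _ _) (Psi x) (b 0 x) (u j x) => A B C D E.
  by field; exact: n0.
- apply: eq_cvgL2 (c1 1) => [n x Hx|x Hx]; last by rewrite mul1r.
  rewrite /Ulim /=.
  move: (cutoff _ _) (b 1 x) (u j x) => B D E.
  by field; exact: n0.
Qed.

Lemma weak_form_extend (F : 'I_2 -> vfield R) :
  (forall i j, inL2 (F i j)) ->
  (forall chi, stf chi ->
    sum4 (fun i j => ip (Gu i j) (partial j (chi i))) +
    sum4 (fun i j => ip (Gu i j) (fun x => u j x * chi i x)) =
    sum4 (fun i j => ip (F i j) (partial j (chi i)))) ->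
  sum4 (fun i j => ip (Gu i j) (Gb i j)) +
  sum4 (fun i j => ip (Gu i j) (fun x => u j x * b i x)) =
  sum4 (fun i j => ip (F i j) (Gb i j)).
Proof.
move=> IF weak.
have IGu i j : inL2 (Gu i j) by have [] := appr_grad au i j.
have cip (A : 'I_2 -> vfield R) fs f : (forall i j, inL2 (A i j)) ->
    (forall i j, cvgL2 (fun k => fs k i j) (f i j)) ->
    (fun k => sum4 (fun i j => ip (A i j) (fs k i j))) @ \oo -->
    sum4 (fun i j => ip (A i j) (f i j)).
  move=> IA c; apply: (cvg_sum4 (f := fun k i j => ip (A i j) (fs k i j))) => i j.
  by apply: (cvgL2_ip mH) (c i j); apply: cvgL2_cst.
have weakn n : sum4 (fun i j => ip (Gu i j) (Dlim (ts n) i j)) +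
    sum4 (fun i j => ip (Gu i j) (Ulim (ts n) i j)) =
    sum4 (fun i j => ip (F i j) (Dlim (ts n) i j)).
  have cD i j := cvg_grad i j (ts0 n) (ts1 n).
  have cU i j := cvg_trans i j (ts0 n) (ts1 n).
  apply: (cvg_eq_lim (fun k => weak _ (stf_cut (ts n) k))); last exact: cip _ _ _ IF cD.
  by apply: cvgD; [exact: cip _ _ _ IGu cD|exact: cip _ _ _ IGu cU].
apply: (cvg_eq_lim weakn); last exact: cip _ _ _ IF cvg_Dlim.
by apply: cvgD; [exact: cip _ _ _ IGu cvg_Dlim|exact: cip _ _ _ IGu cvg_Ulim].
Qed.

End KeyIdentity.

(** * Uniqueness *)

Section Uniqueness.
Context {R : realType}.
Notation mu := (lebesgue_plane R).
Notation lam := (@lebesgue_measure R).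
Notation H := (@half_plane R).
Notation ip := (inner mu H).
Notation inL2 := (inL2 mu H).
Let mH := @measurable_half_plane R.

Lemma appr_div phi v G : appr phi v G -> ip (G 0 0) (G 0 0) = ip (G 1 1) (G 1 1).
Proof.
move=> ap; apply: (cvg_eq_lim _ (cvgL2_sq mH (appr_grad ap 0 0)) (cvgL2_sq mH (appr_grad ap 1 1))).
move=> k; have [_ dk] := appr_stf ap k; apply: eq_Rintegral => x _.
by have /eqP := dk x; rewrite addr_eq0 => /eqP ->; rewrite mulrNN.
Qed.

Lemma ip0_ae (f : R * R -> R) : inL2 f -> ip f f = 0 ->
  {ae mu, forall x, H x -> f x = 0}.
Proof.
move=> If i0; have := ipE mH If; rewrite i0 => e.
have mf2 : mfun_half (fun x => (f x ^+ 2)%:E).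
  by apply/measurable_EFinP; apply: measurable_funX; case: If.
have := (@ae_eq_integral_abs _ _ _ mu _ mH _ mf2).1.
move=> /(_ _)/wrap[].
  rewrite -[RHS]e; apply: eq_integral => x _.
  by rewrite gee0_abs// lee_fin sqr_ge0.
apply: aeS => x h Hx; have /= := h Hx.
by move=> [] /eqP; rewrite sqrf_eq0 => /eqP.
Qed.

Lemma weightp_le (q q' : R * R -> R) (C : R) : weightp q C -> mfun_half q' ->
  (forall x, H x -> `|q' x| <= `|q x|) -> weightp q' C.
Proof.
move=> wq mq' h; have [C0 mq hq] := wq; split=> // f tff.
apply: le_trans (hq f tff).
have mf := tf_measurable tff.
apply: ge0_le_integral => //.
- by move=> x _; rewrite lee_fin sqr_ge0.
- by apply/measurable_EFinP; apply: measurable_funX; exact: measurable_funM.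
- by apply/measurable_EFinP; apply: measurable_funX; exact: measurable_funM.
move=> x Hx; rewrite lee_fin -(real_normK (num_real (q' x * _))).
rewrite -(real_normK (num_real (q x * _))) ler_sqr ?nnegrE//.
by rewrite !normrM ler_wpM2r// h.
Qed.

Variables (F : 'I_2 -> vfield R) (m : R -> R) (C0 : R).
Hypothesis IF : forall i j, inL2 (F i j).
Hypothesis mm : mfun_pos m.
Hypothesis m0 : forall y, 0 <= m y.
Hypothesis wm : weightp (fun x => m x.2) (5 / 4).
Hypothesis mgrowth : forall X, 1 <= X ->
  (\int[lam]_(y in `[1%R, X]) (m y)%:E <= (C0 * (1 + logsq X))%:E)%E.
Variables (phi : nat -> vfield R) (b : vfield R) (Gb : 'I_2 -> vfield R).
Hypothesis ab : appr phi b Gb.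
Hypothesis bm : forall x, H x -> b 0 x ^+ 2 + b 1 x ^+ 2 <= m x.2 ^+ 2.
Variables (psi : nat -> vfield R) (u : vfield R) (Gu : 'I_2 -> vfield R).
Hypothesis au : appr psi u Gu.

Definition weak_eq (v : vfield R) (G : 'I_2 -> vfield R) := forall chi, stf chi ->
    sum4 (fun i j => ip (G i j) (partial j (chi i))) +
    sum4 (fun i j => ip (G i j) (fun x => v j x * chi i x)) =
    sum4 (fun i j => ip (F i j) (partial j (chi i))).

Definition energy_le (G : 'I_2 -> vfield R) :=
  sum4 (fun i j => ip (G i j) (G i j)) <= sum4 (fun i j => ip (F i j) (G i j)).

Hypotheses (weakb : weak_eq b Gb) (weaku : weak_eq u Gu).
Hypotheses (eb : energy_le Gb) (eu : energy_le Gu).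

Let bm1 i x : H x -> `|b i x| <= m x.2.
Proof.
move=> Hx; have := bm Hx; have := sqr_ge0 (b 0 x); have := sqr_ge0 (b 1 x) => h1 h0 h.
rewrite -(ler_sqr (x := `|b i x|)) ?nnegrE// real_normK ?num_real//.
by have [->|->] := ord2 i; lra.
Qed.

Let wb j : weightp (b j) (5 / 4).
Proof.
apply: weightp_le wm _ _; first exact: appr_meas ab j.
by move=> x Hx; rewrite (ger0_norm (m0 _)) bm1.
Qed.

Let w : vfield R := fun i x => u i x - b i x.
Let Gw : 'I_2 -> vfield R := fun i j x => Gu i j x - Gb i j x.
Let aw : appr (fun k i x => psi k i x - phi k i x) w Gw := apprB au ab.

Let IGu i j : inL2 (Gu i j). Proof. by have [] := appr_grad au i j. Qed.
Let IGb i j : inL2 (Gb i j). Proof. by have [] := appr_grad ab i j. Qed.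
Let IGw i j : inL2 (Gw i j). Proof. by have [] := appr_grad aw i j. Qed.

Let Ibv i j phi' v G : appr phi' v G -> inL2 (fun x => b i x * v j x).
Proof. by move=> av; have [] := appr_weight j av (wb i). Qed.

Let Iub i j : inL2 (fun x => u j x * b i x).
Proof. by apply: eq_inL2 (Ibv i j au) => x _; exact: mulrC. Qed.

Let Iwb i j : inL2 (fun x => w j x * b i x).
Proof. by apply: eq_inL2 (Ibv i j aw) => x _; exact: mulrC. Qed.

Let weak_ub : sum4 (fun i j => ip (Gu i j) (Gb i j)) +
  sum4 (fun i j => ip (Gu i j) (fun x => u j x * b i x)) =
  sum4 (fun i j => ip (F i j) (Gb i j)).
Proof.
have [Psi [CP [mP CP0 PB PL]]] := exists_stream_limit ab mm m0 (@bm1 0) mgrowth.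
exact: (weak_form_extend ab wb mP CP0 PB PL au IF weaku).
Qed.

Let weak_bu : sum4 (fun i j => ip (Gb i j) (Gu i j)) +
  sum4 (fun i j => ip (Gb i j) (fun x => b j x * u i x)) =
  sum4 (fun i j => ip (F i j) (Gu i j)).
Proof.
apply: (cvg_eq_lim (fun k => weakb (appr_stf au k))).
  apply: cvgD.
    apply: (cvg_sum4 (f := fun k i j => ip (Gb i j) (partial j (psi k i)))) => i j.
    by apply: (cvgL2_ip mH) (appr_grad au i j); exact: cvgL2_cst.
  apply: (cvg_sum4 (f := fun k i j => ip (Gb i j) (fun x => b j x * psi k i x))) => i j.
  by apply: (cvgL2_ip mH) (appr_weight i au (wb j)); exact: cvgL2_cst.
apply: (cvg_sum4 (f := fun k i j => ip (F i j) (partial j (psi k i)))) => i j.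
by apply: (cvgL2_ip mH) (appr_grad au i j); exact: cvgL2_cst.
Qed.

Let sum4_lin (A B C : 'I_2 -> 'I_2 -> R) (a : R) :
  sum4 (fun i j => A i j - a * B i j + C i j) = sum4 A - a * sum4 B + sum4 C.
Proof. by rewrite /sum4; ring. Qed.

(** Expanding the square leaves -2 times the mixed gradient pairing. The sum of the two tested
    equations removes it together with the forcing terms of the energy inequalities. *)
Let energy_diff : sum4 (fun i j => ip (Gw i j) (Gw i j)) <=
  sum4 (fun i j => ip (Gu i j) (fun x => u j x * b i x)) +
  sum4 (fun i j => ip (Gb i j) (fun x => b j x * u i x)).
Proof.
have -> : sum4 (fun i j => ip (Gw i j) (Gw i j)) =
   sum4 (fun i j => ip (Gu i j) (Gu i j)) - 2 * sum4 (fun i j => ip (Gu i j) (Gb i j)) +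
   sum4 (fun i j => ip (Gb i j) (Gb i j)).
  rewrite -sum4_lin.
  by rewrite /sum4 /Gw !(ip_sqB mH).
have e : sum4 (fun i j => ip (Gb i j) (Gu i j)) = sum4 (fun i j => ip (Gu i j) (Gb i j)).
  by congr sum4; apply/funext => i; apply/funext => j; exact: ipC.
move: weak_ub weak_bu eb eu; rewrite e /energy_le.
by do 7 move: (sum4 _) => ?; lra.
Qed.

Let ipw_expand i j : ip (Gw i j) (fun x => w j x * b i x) =
  ip (Gu i j) (fun x => u j x * b i x) - ip (Gu i j) (fun x => b j x * b i x)
  - (ip (Gb i j) (fun x => u j x * b i x) - ip (Gb i j) (fun x => b j x * b i x)).
Proof.
have Ibb : inL2 (fun x => b j x * b i x) by exact: Ibv ab.
have Iuu := Iub i j.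
rewrite /Gw (ipBl mH (IGu i j) (IGb i j) (Iwb i j)).
have e g : inL2 g -> ip g (fun x => w j x * b i x) =
    ip g (fun x => u j x * b i x) - ip g (fun x => b j x * b i x).
  move=> Ig; rewrite -(ipBr mH Iuu Ibb Ig); apply: eq_ip => // x _.
  by rewrite /w mulrBl.
by rewrite !e.
Qed.

Let ipw_expand2 i j : ip (Gw i j) (fun x => b j x * w i x) =
  ip (Gu i j) (fun x => b j x * u i x) - ip (Gu i j) (fun x => b j x * b i x)
  - (ip (Gb i j) (fun x => b j x * u i x) - ip (Gb i j) (fun x => b j x * b i x)).
Proof.
have Ibb : inL2 (fun x => b j x * b i x) by exact: Ibv ab.
have Iuu : inL2 (fun x => b j x * u i x) by exact: Ibv au.
have Iww : inL2 (fun x => b j x * w i x) by exact: Ibv aw.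
rewrite /Gw (ipBl mH (IGu i j) (IGb i j) Iww).
have e g : inL2 g -> ip g (fun x => b j x * w i x) =
    ip g (fun x => b j x * u i x) - ip g (fun x => b j x * b i x).
  move=> Ig; rewrite -(ipBr mH Iuu Ibb Ig); apply: eq_ip => // x _.
  by rewrite /w mulrBr.
by rewrite !e.
Qed.

(** For each i, transport of [b i] by [u] and by [b] integrates to 0, which removes the terms with
    [Gb] from the expanded right side. Transport of [u i] and [w i] by [b] gives the antisymmetry
    that turns the sum over j of <Gb i j, b_j u_i> into minus that of <Gu i j, b_j b_i>. *)
Let trilinear_diff :
  sum4 (fun i j => ip (Gu i j) (fun x => u j x * b i x)) +
  sum4 (fun i j => ip (Gb i j) (fun x => b j x * u i x)) =
  sum4 (fun i j => ip (Gw i j) (fun x => w j x * b i x)).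
Proof.
have sw (g : R * R -> R) (p q : R * R -> R) :
    ip g (fun x => p x * q x) = ip g (fun x => q x * p x).
  by apply: eq_ip => // x _; exact: mulrC.
have z1u i := transport_zero1 i ab au (wb 0) (wb 1).
have z1w i := transport_zero1 i ab aw (wb 0) (wb 1).
have z2u i := transport_zero2 ab au (wb i).
have z2b i := transport_zero2 ab ab (wb i).
have row i : ip (Gu i 0) (fun x => u 0 x * b i x) + ip (Gu i 1) (fun x => u 1 x * b i x) +
    (ip (Gb i 0) (fun x => b 0 x * u i x) + ip (Gb i 1) (fun x => b 1 x * u i x)) =
    ip (Gw i 0) (fun x => w 0 x * b i x) + ip (Gw i 1) (fun x => w 1 x * b i x).
  have := z1u i; have := z1w i; have := z2u i; have := z2b i.
  rewrite !ipw_expand !ipw_expand2.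
  rewrite (sw (Gb i 0) (b i) (u 0)) (sw (Gb i 1) (b i) (u 1)).
  rewrite (sw (Gb i 0) (b i) (b 0)) (sw (Gb i 1) (b i) (b 1)).
  move: (ip (Gu i 0) (fun x => u 0 x * b i x)) (ip (Gu i 1) (fun x => u 1 x * b i x)) => A0 A1.
  move: (ip (Gb i 0) (fun x => b 0 x * u i x)) (ip (Gb i 1) (fun x => b 1 x * u i x)) => B0 B1.
  move: (ip (Gb i 0) (fun x => b 0 x * b i x)) (ip (Gb i 1) (fun x => b 1 x * b i x)) => D0 D1.
  move: (ip (Gu i 0) (fun x => b 0 x * b i x)) (ip (Gu i 1) (fun x => b 1 x * b i x)) => E0 E1.
  move: (ip (Gb i 0) (fun x => u 0 x * b i x)) (ip (Gb i 1) (fun x => u 1 x * b i x)) => H0 H1.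
  move: (ip (Gu i 0) (fun x => b 0 x * u i x)) (ip (Gu i 1) (fun x => b 1 x * u i x)) => K0 K1.
  by lra.
by rewrite /sum4 addrACA (row 0) (row 1).
Qed.

Let ip_young (f g : R * R -> R) (s : R) : 0 < s -> inL2 f -> inL2 g ->
  ip f g <= 2^-1 * (s * ip g g + s^-1 * ip f f).
Proof.
move=> s0 If Ig; have := ip_ge0 mu H (fun x => f x - s * g x).
rewrite (ip_sqB mH If (inL2Z mH s Ig)) (ipZr mH s Ig If).
rewrite (ipZl mH s Ig (inL2Z mH s Ig)) (ipZr mH s Ig Ig).
move: (ip f f) (ip g g) (ip f g) => A B C h.
have : 0 <= s^-1 * (A - 2 * (s * C) + s * (s * B)) by rewrite mulr_ge0// invr_ge0 ltW.
rewrite (_ : s^-1 * _ = s^-1 * A - 2 * C + s * B); first by lra.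
by field; rewrite gt_eqF.
Qed.

(** The pointwise bound is used for |b|^2 as a whole; treating the two components separately would
    lose a factor 2. *)
Let ip_wb j : ip (fun x => w j x * b 0 x) (fun x => w j x * b 0 x) +
    ip (fun x => w j x * b 1 x) (fun x => w j x * b 1 x) <= 5 / 4 * ip (Gw j 1) (Gw j 1).
Proof.
apply: le_trans (appr_weight_ip j aw wm).
have [Iw _ _] := appr_weight j aw wm.
rewrite /inner -RintegralD//; [|exact: inL2_mul..].
apply: le_Rintegral => //.
- by apply: integrableDR; exact: inL2_mul.
- exact: inL2_mul.
move=> x Hx; have h := bm Hx.
rewrite [leLHS](_ : _ = w j x ^+ 2 * (b 0 x ^+ 2 + b 1 x ^+ 2)); last by ring.
rewrite [leRHS](_ : _ = w j x ^+ 2 * m x.2 ^+ 2); last by ring.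
by apply: ler_wpM2l => //; exact: sqr_ge0.
Qed.

Lemma unique_gradient i j : ip (Gw i j) (Gw i j) = 0.
Proof.
(* The 3/2 balances the entries: with a the common norm of d_1 w_1
   and d_2 w_2, the final coefficients are 85/48 < 2 for a^2, 1/2 for
   |d_1 w_2|^2 and 23/24 for |d_2 w_1|^2. *)
have s32 : (0 : R) < 3 / 2 by rewrite divr_gt0.
have y00 := ip_young ltr01 (IGw 0 0) (Iwb 0 0).
have y10 := ip_young ltr01 (IGw 1 0) (Iwb 1 0).
have y01 := ip_young s32 (IGw 0 1) (Iwb 0 1).
have y11 := ip_young s32 (IGw 1 1) (Iwb 1 1).
have w0 := ip_wb 0; have w1 := ip_wb 1.
have dv := appr_div aw.
have ed := energy_diff; rewrite trilinear_diff in ed.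
have g0 i' j' : 0 <= ip (Gw i' j') (Gw i' j') by exact: ip_ge0.
have inv32 : (3 / 2 : R)^-1 = 2 / 3 by field.
have : sum4 (fun i j => ip (Gw i j) (Gw i j)) <= 0.
  move: (g0 0 0) (g0 0 1) (g0 1 0) (g0 1 1) dv ed y00 y10 y01 y11 w0 w1.
  rewrite /sum4 invr1 inv32.
  move: (ip (Gw 0 0) (Gw 0 0)) (ip (Gw 0 1) (Gw 0 1)) => a p.
  move: (ip (Gw 1 0) (Gw 1 0)) (ip (Gw 1 1) (Gw 1 1)) => r q.
  move: (ip (Gw 0 0) _) (ip (Gw 0 1) _) (ip (Gw 1 0) _) (ip (Gw 1 1) _) => A B C D.
  move: (ip (fun x => w 0 x * b 0 x) _) (ip (fun x => w 0 x * b 1 x) _) => E1 E2.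
  move: (ip (fun x => w 1 x * b 0 x) _) (ip (fun x => w 1 x * b 1 x) _) => E3 E4.
  lra.
move=> s0; apply/le_anti; rewrite g0 andbT; apply: le_trans s0.
exact: (@le_sum4 _ (fun i j => ip (Gw i j) (Gw i j))).
Qed.

(** Hardy's inequality converts the vanishing gradient of [w] into the vanishing of w / x_2. *)
Lemma unique_ae i : {ae mu, forall x, H x -> u i x = b i x}.
Proof.
have [Iw _ _] := appr_weight i aw (@weightp_inv2 R).
have := appr_weight_ip i aw (@weightp_inv2 R); rewrite unique_gradient mulr0 => h.
have h0 : ip (fun x => x.2^-1 * w i x) (fun x => x.2^-1 * w i x) = 0.
  by apply/le_anti; rewrite h ip_ge0.
apply: aeS (ip0_ae Iw h0) => x h1 Hx; have /eqP := h1 Hx.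
rewrite mulf_eq0 invr_eq0 gt_eqF//= subr_eq0 => /eqP; exact.
Qed.

End Uniqueness.

(** * From the function spaces to the abstract hypotheses *)

Section FunctionSpaces.
Context {R : realType}.
Notation mu := (lebesgue_plane R).
Notation H := (@half_plane R).
Notation inL2 := (inL2 mu H).
Notation cvgL2 := (cvgL2 mu H).
Let mH := @measurable_half_plane R.

Lemma integral_sq_Lnorm (D : set (plane R)) (g : R * R -> R) : measurable D ->
  (\int[mu]_(x in D) (g x ^+ 2)%:E = 'N[mu]_2%:E [EFin \o (g \_ D)] `^ 2)%E.
Proof.
move=> mD; rewrite poweR_Lnorm// [LHS]integral_mkcond; apply: eq_integral => x _.
have -> : (EFin \o g \_ D) x = (if x \in D then (g x)%:E else 0)%E.
  by rewrite /= /patch; case: ifP.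
rewrite /patch; case: ifPn => _; last by rewrite abse0 poweR0r.
by rewrite abse_EFin poweR_EFin powR_mulrn// real_normK// num_real.
Qed.

Lemma L2_inL2 (f : R * R -> R) : L2 f -> inL2 f.
Proof.
move=> Lf; have := Lf; rewrite /L2 inE => /andP[]; rewrite inE /= => mf _; split.
  by apply/(measurable_restrictT _ mH).
have I := @integrableS _ _ _ mu _ _ _ measurableT mH (@subsetT _ _) (Lfun2_integrable_sqr Lf).
have /integrableP[_] := I; apply: le_lt_trans.
rewrite le_eqVlt; apply/orP; left; apply/eqP; apply: eq_integral => x Hx.
by rewrite /= /patch Hx ger0_norm ?sqr_ge0.
Qed.

Lemma Lnorm2_near (D : set (plane R)) (gs : nat -> R * R -> R) (e : R) :
  measurable D -> 0 < e ->
  ('N[mu]_2%:E [EFin \o ((gs k) \_ D)])%E @[k --> \oo] --> 0%E ->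
  \forall k \near \oo, (\int[mu]_(x in D) (gs k x ^+ 2)%:E <= e%:E)%E.
Proof.
move=> mD e0 h.
have se0 : 0 < Num.sqrt e by rewrite sqrtr_gt0.
have h' : \forall k \near \oo, ('N[mu]_2%:E [EFin \o ((gs k) \_ D)] < (Num.sqrt e)%:E)%E.
  have U : open [set y : \bar R | (y < (Num.sqrt e)%:E)%E] by exact: open_ereal_lt_ereal.
  have U0 : nbhs (0%E : \bar R) [set y : \bar R | (y < (Num.sqrt e)%:E)%E].
    by apply: open_nbhs_nbhs; split => //=; rewrite lte_fin.
  exact: h U0.
apply: filterS h' => k; rewrite integral_sq_Lnorm//.
have := Lnorm_ge0 mu 2%:E (EFin \o ((gs k) \_ D)).
case: ('N[mu]_2%:E [EFin \o ((gs k) \_ D)])%E => [r| |]//.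
rewrite lee_fin lte_fin poweR_EFin lee_fin => r0 rs.
rewrite powR_mulrn// -(sqr_sqrtr (ltW e0)).
by apply: lerXn2r; [rewrite nnegrE|rewrite nnegrE ltW|exact: ltW].
Qed.

Lemma Lnorm2_cvgL2 (fs : nat -> R * R -> R) f : inL2 f -> (forall n, inL2 (fs n)) ->
  ('N[mu]_2%:E [EFin \o ((fs k \- f)%R \_ H)])%E @[k --> \oo] --> 0%E -> cvgL2 fs f.
Proof.
move=> If In h; split=> //.
apply/cvgr0Pnorm_le => e e0.
apply: filterS (Lnorm2_near mH e0 h) => k; rewrite (_ : (fun x => _) = fun x => ((fs k x - f x) ^+ 2)%:E)//.
have J := inL2B mH (In k) If.
by rewrite (ipE mH J) lee_fin ger0_norm// ip_ge0.
Qed.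

Lemma box_cover (x : R * R) : H x -> \forall n \near \oo, box n.+1%:R x.
Proof.
move=> x0.
have h1 : \forall n \near \oo, `|x.1| <= n%:R by exact: nbhs_infty_ger.
have h2 : \forall n \near \oo, x.2 <= n%:R by exact: nbhs_infty_ger.
have h3 : \forall n \near \oo, x.2^-1 <= n%:R by exact: nbhs_infty_ger.
near=> n.
have l : n%:R <= n.+1%:R :> R by rewrite ler_nat.
have a1 : `|x.1| <= n%:R by near: n.
have a2 : x.2 <= n%:R by near: n.
have a3 : x.2^-1 <= n%:R by near: n.
split; rewrite /= in_itv /=.
  by rewrite -ler_norml (le_trans a1).
rewrite (le_trans a2)// andbT -[leRHS]invrK lef_pV2 ?posrE ?invr_gt0//.
exact: le_trans l.
Unshelve. all: by end_near. Qed.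

Lemma half_plane_bigcup : H = \bigcup_n box n.+1%:R.
Proof.
apply/seteqP; split=> [x Hx|x [n _]]; last exact: box_half_plane.
by have [n _ h] := box_cover Hx; exists n => //; apply: h => /=.
Qed.

Lemma L1loc_measurable (f : R * R -> R) : L1loc f -> mfun_half f.
Proof.
move=> h; rewrite half_plane_bigcup.
apply/measurable_fun_bigcup => [n|n]; first exact: measurable_box.
by have /integrableP[/measurable_EFinP] := h _ (@compact_box R n.+1%:R)
  (@box_half_plane R n.+1%:R (ltr0Sn _ _)).
Qed.

(** A diagonal choice: [s n] makes the squared error on the n-th box at most 2^-(n+1). These errors
    are summable, and since the boxes exhaust the half-plane, the subsequence converges almost
    everywhere on all of it. *)
Lemma H1dot0sigma_appr (v : vfield R) : H1dot0sigma v ->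
  exists phi, appr phi v (fun i j => weak_partial j (v i)).
Proof.
move=> [Hv [phi [sphi gphi lphi]]].
have mv i : mfun_half (v i).
  by apply: L1loc_measurable; case: (Hv i).
have mphi k i : mfun_half (phi k i).
  by apply: tf_measurable; have [/(_ i)] := (stfP _).1 (sphi k).
have ex n : exists k, (n <= k)%N /\ forall i,
    (\int[mu]_(x in box n.+1%:R) ((phi k i x - v i x) ^+ 2)%:E <= (1 / (2 ^ n.+1)%:R)%:E)%E.
  have e0 : 0 < 1 / (2 ^ n.+1)%:R :> R by rewrite divr_gt0// ltr0n expn_gt0.
  have h i := Lnorm2_near (@measurable_box R n.+1%:R) e0
    (lphi i _ (@compact_box R n.+1%:R) (@box_half_plane R n.+1%:R (ltr0Sn _ _))).
  have g : \forall k \near \oo, (n <= k)%N by exact: nbhs_infty_ge.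
  near \oo => k; exists k; split; first by near: k.
  have q0 : (\int[mu]_(x in box n.+1%:R) ((phi k 0 x - v 0 x) ^+ 2)%:E <= (1 / (2 ^ n.+1)%:R)%:E)%E.
    by near: k; exact: h.
  have q1 : (\int[mu]_(x in box n.+1%:R) ((phi k 1 x - v 1 x) ^+ 2)%:E <= (1 / (2 ^ n.+1)%:R)%:E)%E.
    by near: k; exact: h.
  move=> i; have [->|->] // : i = 0 \/ i = 1.
  by case: i => [[|[|//]] hi]; [left|right]; apply/val_inj.
have [s hs] := choice ex.
have scv : s @ \oo --> \oo.
  move=> A [N _ hA]; exists N => // n /= Nn; apply: hA => /=.
  by apply: leq_trans Nn _; case: (hs n).
exists (phi \o s); split=> /=.
- by move=> k; apply/stfP.
- by [].
- move=> i j; apply: Lnorm2_cvgL2.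
  + by apply: L2_inL2; case: (Hv i) => _ /(_ j)[].
  + move=> n; have [t _] := (stfP _).1 (sphi (s n)).
    by apply: tf_inL2; exact: tf_partial.
  + exact: (cvg_comp _ _ scv (gphi i j)).
move=> i.
(* The indicator restricts the n-th error to the n-th box; at a given point it equals 1 for all
   large n. *)
pose gs n x := ((phi (s n) i x - v i x) ^+ 2) * \1_(box n.+1%:R : set (plane R)) x.
have mgs n : mfun_half (gs n).
  apply: measurable_funM; first by apply: measurable_funX; exact: measurable_funB.
  by apply: measurable_indic; exact: measurable_box.
have gs0 n x : H x -> 0 <= gs n x by move=> _; rewrite mulr_ge0 ?sqr_ge0.
have gsi n : (\int[mu]_(x in H) (gs n x)%:E <= (1 / (2 ^ n.+1)%:R)%:E)%E.
  have [_ /(_ i)] := hs n; apply: le_trans.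
  rewrite (_ : box n.+1%:R = H `&` box n.+1%:R); last first.
    by rewrite setIC; apply/esym/setIidl; apply: box_half_plane.
  rewrite integral_mkcondr le_eqVlt; apply/orP; left; apply/eqP.
  apply: eq_integral => x _; rewrite /gs /patch indicE.
  by case: (x \in box n.+1%:R); rewrite ?mulr1 ?mulr0.
apply: aeS (ae_cvg0_summable mH mgs gs0 gsi) => x h Hx.
have c := h Hx.
have c2 : (fun n => (phi (s n) i x - v i x) ^+ 2) @ \oo --> (0:R).
  apply: cvg_trans c; apply: near_eq_cvg; apply: filterS (box_cover Hx) => n bn.
  by rewrite /gs indicE mem_set// mulr1.
apply/subr_cvg0; apply/norm_cvg0P.
have c3 : (fun n => Num.sqrt ((phi (s n) i x - v i x) ^+ 2)) @ \oo --> (Num.sqrt 0 : R).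
  by apply: continuous_cvg c2; exact: sqrt_continuous.
rewrite sqrtr0 in c3.
by under eq_fun do rewrite -sqrtr_sqr.
Unshelve. all: by end_near. Qed.

End FunctionSpaces.

(** * Modification of a field on a null set *)

Section Truncation.
Context {R : realType}.
Notation mu := (lebesgue_plane R).
Notation H := (@half_plane R).
Notation ip := (inner mu H).
Let mH := @measurable_half_plane R.

Lemma ae_ip (f g g' : R * R -> R) : mfun_half f ->
  mfun_half g -> mfun_half g' ->
  {ae mu, forall x, H x -> g x = g' x} -> ip f g = ip f g'.
Proof.
move=> mf mg mg' e; rewrite /inner /Rintegral; congr fine.
apply: ae_eq_integral => //.
- by apply/measurable_EFinP; exact: measurable_funM.
- by apply/measurable_EFinP; exact: measurable_funM.
by apply: aeS e => x h Hx; rewrite /= h.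
Qed.

(* Changing v on a null set makes an almost everywhere bound hold everywhere. *)
Definition truncation (m : R -> R) (v : vfield R) : vfield R :=
  fun i x => if v 0 x ^+ 2 + v 1 x ^+ 2 <= m x.2 ^+ 2 then v i x else 0.

Lemma truncation_le m v x :
  truncation m v 0 x ^+ 2 + truncation m v 1 x ^+ 2 <= m x.2 ^+ 2.
Proof. by rewrite /truncation; case: ifPn => // _; rewrite expr0n addr0 sqr_ge0. Qed.

Lemma measurable_sndH (m : R -> R) :
  mfun_pos m -> mfun_half (fun x => m x.2).
Proof.
move=> mm; apply: (@measurable_comp _ _ _ _ _ _ (`]0%R, +oo[%classic : set (measurableTypeR R))) => //.
  by move=> y [x x0 <-] /=; rewrite in_itv /= andbT.
exact: measurable_funTS.
Qed.

Lemma measurable_truncation m v i :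
  mfun_pos m -> (forall i, mfun_half (v i)) -> mfun_half (truncation m v i).
Proof.
move=> mm mv; apply: measurable_fun_if => //.
- apply: measurable_fun_ler; last by apply: measurable_funX; exact: measurable_sndH.
  by apply: measurable_funD; apply: measurable_funX.
- apply: measurable_funS (mv i) => //; exact: subIsetl.
Qed.

Variables (m : R -> R) (v : vfield R).
Hypothesis mm : mfun_pos m.
Hypothesis vm : {ae mu, forall x, H x -> v 0 x ^+ 2 + v 1 x ^+ 2 <= m x.2 ^+ 2}.

Lemma truncation_ae i : {ae mu, forall x, H x -> truncation m v i x = v i x}.
Proof. by apply: aeS vm => x h Hx; rewrite /truncation h. Qed.

Lemma appr_truncation phi G : appr phi v G -> appr phi (truncation m v) G.
Proof.
move=> ap; split; [exact: appr_stf ap| |exact: appr_grad ap|].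
  by move=> i; apply: measurable_truncation => // j; exact: appr_meas ap j.
by move=> i; apply: aeS2 (truncation_ae i) (appr_ae ap i) => x e h Hx; rewrite e//; exact: h.
Qed.

Lemma weak_eq_truncation phi F G : appr phi v G -> weak_eq F v G ->
  weak_eq F (truncation m v) G.
Proof.
move=> ap we chi schi; rewrite -(we chi schi); congr (_ + _); rewrite /sum4.
have e i j : ip (G i j) (fun x => truncation m v j x * chi i x) =
    ip (G i j) (fun x => v j x * chi i x).
  have mc : mfun_half (chi i) by apply: tf_measurable; case: schi.
  apply: ae_ip.
  - by have [[]] := appr_grad ap i j.
  - apply: measurable_funM => //; apply: measurable_truncation => // k; exact: appr_meas ap k.
  - apply: measurable_funM => //; exact: appr_meas ap j.
  by apply: aeS (truncation_ae j) => x h Hx; rewrite h.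
by rewrite !e.
Qed.

End Truncation.

(** * The pointwise majorant under the weighted sup bounds *)

Section Smallness.
Context {R : realType}.
Notation mu := (lebesgue_plane R).
Notation lam := (@lebesgue_measure R).
Notation H := (@half_plane R).
Let mH := @measurable_half_plane R.

Lemma Linfty_leP d (T : measurableType d) (nu : {measure set T -> \bar R})
    (f : T -> \bar R) a : (0 <= a)%E ->
  ('N[nu]_+oo [f] <= a)%E <-> {ae nu, forall x, (`|f x| <= a)%E}.
Proof.
move=> a0; rewrite unlock; case: ifPn => [_|n0].
  by split=> [/ess_supP|h]; last exact/ess_supP.
(* If the whole space is null, the norm is 0 by definition and every property holds almost
   everywhere. *)
split=> // _; exists setT; split=> //.
by apply/le_anti; rewrite measure_ge0 andbT leNgt.
Qed.

Lemma field_norm_sq (v : vfield R) x : field_norm v x ^+ 2 = v 0 x ^+ 2 + v 1 x ^+ 2.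
Proof. by rewrite /field_norm sqr_sqrtr ?sum2// addr_ge0 ?sqr_ge0. Qed.

Lemma measurable_field_norm (v : vfield R) :
  (forall i, mfun_half (v i)) -> mfun_half (field_norm v).
Proof.
move=> mv; apply: (@measurableT_comp _ _ _ _ _ _ (@Num.sqrt R)).
  by apply: continuous_measurable_fun; exact: sqrt_continuous.
under eq_fun do rewrite sum2.
by apply: measurable_funD; apply: measurable_funX.
Qed.

Lemma integral_inv (X : R) : 1 <= X ->
  (\int[lam]_(y in `[1%R, X]) (y^-1)%:E = (ln X)%:E)%E.
Proof.
move=> X1; rewrite -[in RHS](subr0 (ln X)) -(@ln1 R).
apply: FTC_line => // t /andP[t1 _].
  by apply: is_derive1_ln; exact: lt_le_trans t1.
by apply: inv_continuous; rewrite gt_eqF//; exact: lt_le_trans t1.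
Qed.

Lemma ln_le_logsq (X : R) : 1 <= X -> ln X <= logsq X.
Proof.
move=> X1; rewrite /logsq ler_ln ?posrE; last 2 first.
- exact: lt_le_trans X1.
- by rewrite addr_gt0// mulr_gt0 ?(lt_le_trans ltr01).
by have := sqr_ge0 (X - 1); rewrite sqrrB; lra.
Qed.

Lemma weightpZ (k : R) q C : weightp q C -> weightp (fun x => k * q x) (k ^+ 2 * C).
Proof.
move=> wq; have [C0 mq hq] := wq; split; first by rewrite mulr_ge0// sqr_ge0.
  exact: measurable_funM.
move=> f tff; have J := weightp_inL2 wq tff.
have -> : (\int[mu]_(x in H) ((k * q x * f x) ^+ 2)%:E =
    \int[mu]_(x in H) ((k ^+ 2)%:E * ((q x * f x) ^+ 2)%:E))%E.
  by apply: eq_integral => x _; rewrite -EFinM -mulrA exprMn.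
rewrite ge0_integralZl//; last 3 first.
- by apply/measurable_EFinP; apply: measurable_funX; case: J.
- by move=> x _; rewrite lee_fin sqr_ge0.
- by rewrite lee_fin sqr_ge0.
rewrite -mulrA (EFinM (k ^+ 2)); apply: lee_wpmul2l; [by rewrite lee_fin sqr_ge0|exact: hq].
Qed.

(* 5/4 = 4 (sqrt 5 / 4)^2: Hardy's constant times the square of the constant
   in |v x| <= sqrt 5 / (4 x_2), which omega_ge yields under condition (i). *)
Definition dominated (v : vfield R) := exists (m : R -> R) (C0 : R),
  [/\ mfun_pos m,
      (forall y, 0 <= m y), weightp (fun x => m x.2) (5 / 4),
      (forall X, 1 <= X ->
        (\int[lam]_(y in `[1%R, X]) (m y)%:E <= (C0 * (1 + logsq X))%:E)%E) &
      {ae mu, forall x, H x -> v 0 x ^+ 2 + v 1 x ^+ 2 <= m x.2 ^+ 2}].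

Lemma le_euclid_norm (x : R * R) : H x -> x.2 <= euclid_norm x.
Proof.
move=> Hx; have x0 : 0 < x.2 := Hx.
rewrite -[leLHS](ger0_norm (ltW x0)) -sqrtr_sqr /euclid_norm.
by rewrite ler_wsqrtr// lerDr sqr_ge0.
Qed.

(** All three comparisons rest on |x| >= x_2. The worst weight is [omega] at index 0: r / (x_2 + 4
    r) increases with r = |x| and equals 1/5 at r = x_2. *)
Lemma omega_ge i (x : R * R) : H x -> x.2 ^+ 2 / 5 <= omega i x.
Proof.
move=> Hx; have r := le_euclid_norm Hx; have y0 : 0 < x.2 := Hx.
rewrite /omega; case: i => [[|[|[|//]]] hi] /=; rewrite (ger0_norm (ltW y0)).
- rewrite ler_pdivlMr; last by lra.
  rewrite -subr_ge0 (_ : _ - _ = x.2 ^+ 2 * (euclid_norm x - x.2) / 5).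
    by rewrite divr_ge0// mulr_ge0 ?sqr_ge0// subr_ge0.
  by field.
- apply: (@le_trans _ _ (x.2 * x.2)); first by rewrite -expr2; have := sqr_ge0 x.2; lra.
  by rewrite ler_pM2l.
- by have := sqr_ge0 x.2; lra.
Qed.

Lemma dominated_weighted (v : vfield R) i : let w := fun x => omega i x `^ 2^-1 in
  (weighted_Linfty_norm w v < (1 / 4)%:E)%E -> dominated v.
Proof.
move=> w /ltW hw; have K0 : 0 <= Num.sqrt 5 / 4 :> R by rewrite divr_ge0// sqrtr_ge0.
have K2 : (Num.sqrt 5 / 4) ^+ 2 * 4 = 5 / 4 :> R.
  by rewrite expr_div_n sqr_sqrtr//; field.
have minv : mfun_pos (fun y : R => `|y^-1|).
  apply: measurableT_comp => //.
  apply: subspace_continuous_measurable_fun => //.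
  apply: continuous_in_subspaceT => y; rewrite inE /= in_itv /= andbT => y0.
  by apply: inv_continuous; rewrite gt_eqF.
(* The absolute value keeps the majorant nonnegative at negative heights, as [dominated] demands. *)
exists (fun y => Num.sqrt 5 / 4 * `|y^-1|), (Num.sqrt 5 / 4); split.
- exact: measurable_funM.
- by move=> y; rewrite mulr_ge0.
- rewrite -K2; apply: weightpZ; apply: weightp_le (@weightp_inv2 R) _ _.
    exact: (@measurable_sndH R (fun y => `|y^-1|) minv).
  by move=> x _; rewrite normr_id.
- move=> X X1.
  have -> : (\int[lam]_(y in `[1%R, X]) (Num.sqrt 5 / 4 * `|y^-1|)%:E =
     \int[lam]_(y in `[1%R, X]) ((Num.sqrt 5 / 4)%:E * (y^-1)%:E))%E.
    apply: eq_integral => y; rewrite inE /= in_itv /= => /andP[y1 _].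
    by rewrite ger0_norm// invr_ge0 (le_trans ler01).
  rewrite ge0_integralZl//; last 2 first.
  + apply/measurable_EFinP; apply: (eq_measurable_fun (fun y : R => `|y^-1|)).
      move=> y; rewrite inE /= in_itv /= => /andP[y1 _].
      by rewrite ger0_norm// invr_ge0 (le_trans ler01).
    apply: measurable_funS minv => //.
    by move=> y /=; rewrite !in_itv /= andbT => /andP[y1 _]; exact: lt_le_trans y1.
  + move=> y /=; rewrite in_itv /= => /andP[y1 _].
    by rewrite lee_fin invr_ge0 (le_trans ler01).
  rewrite (integral_inv X1) -EFinM lee_fin; apply: ler_wpM2l => //.
  by apply: le_trans (ln_le_logsq X1) _; rewrite lerDr.
have q0 : (0 <= (1 / 4 : R)%:E)%E by rewrite lee_fin.
have := (Linfty_leP _ _ q0).1 hw; apply: aeS => x h Hx.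
have y0 : 0 < x.2 := Hx.
have om := omega_ge i Hx.
have {}h : field_norm v x * Num.sqrt (omega i x) <= 1 / 4.
  move: h; rewrite /= /patch mem_set// lee_fin => h; apply: le_trans h.
  rewrite /w powR12_sqrt ?ler_norm//.
  by apply: le_trans om; rewrite divr_ge0// sqr_ge0.
have s5 : Num.sqrt 5 ^+ 2 = 5 :> R by rewrite sqr_sqrtr.
rewrite -field_norm_sq exprMn expr_div_n s5 real_normK ?num_real//.
rewrite exprVn ler_pdivlMr ?exprn_gt0//.
have o0 : 0 <= omega i x by apply: le_trans om; rewrite divr_ge0// sqr_ge0.
have f0 : 0 <= field_norm v x by exact: sqrtr_ge0.
have h2 : (field_norm v x * Num.sqrt (omega i x)) ^+ 2 <= (1 / 4) ^+ 2.
  by apply: lerXn2r => //; rewrite ?nnegrE// mulr_ge0// sqrtr_ge0.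
rewrite exprMn (sqr_sqrtr o0) in h2.
have h3 : field_norm v x ^+ 2 * (x.2 ^+ 2 / 5) <= field_norm v x ^+ 2 * omega i x.
  by apply: ler_wpM2l; rewrite ?sqr_ge0.
rewrite mulrA ler_pdivrMr// in h3; apply: le_trans h3 _.
rewrite -ler_pdivlMr//; apply: le_trans h2 _.
by rewrite le_eqVlt; apply/orP; left; apply/eqP; field.
Qed.

End Smallness.

(** * Measurability of essential suprema over horizontal slices *)

Section SliceSup.
Context {R : realType}.
Notation mu := (lebesgue_plane R).
Notation lam := (@lebesgue_measure R).
Notation H := (@half_plane R).
Notation ip := (inner mu H).
Notation inL2 := (inL2 mu H).
Let mH := @measurable_half_plane R.

Variable h : R * R -> R.
Hypothesis mh : mfun_half h.
Hypothesis h0 : forall x, 0 <= h x.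

Definition slice_sup (y : R) : \bar R := ('N[lam]_+oo [(fun x1 => (h (x1, y))%:E)])%E.

Let mslice y : 0 < y -> measurable_fun setT (fun x : measurableTypeR R => (h (x, y))%:E).
Proof.
move=> y0; apply: (@measurable_slice1 _ (EFin \o h) y) => //.
exact/measurable_EFinP.
Qed.

(** An essential supremum over slices is not visibly measurable in [y]. This describes its sublevel
    sets as zero sets of the measure of a slice, which Tonelli's theorem makes measurable. *)
Lemma slice_sup_leP (y a : R) : 0 < y -> 0 <= a ->
  (slice_sup y <= a%:E)%E <-> (\int[lam]_x (a < h (x, y))%R%:R%:E = 0)%E.
Proof.
move=> y0 a0.
have mB : measurable ([set x | a < h (x, y)] : set (measurableTypeR R)).
  rewrite (_ : [set _ | _] = setT `&` [set x | (a%:E < (h (x, y))%:E)%E]).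
    exact: emeasurable_fun_o_infty (mslice y0) _.
  by rewrite setTI; apply/seteqP; split=> x /=; rewrite lte_fin.
have -> : (\int[lam]_x (a < h (x, y))%R%:R%:E = lam [set x | (a < h (x, y))%R])%E.
  transitivity (\int[lam]_x (\1_([set x | (a < h (x, y))%R] : set (measurableTypeR R)) x)%:E)%E.
    apply: eq_integral => x _; rewrite indicE; congr (_%:R%:E); congr nat_of_bool.
    by apply/idP/idP => q; [rewrite mem_set|rewrite inE in q].
  by rewrite integral_indic// setIT.
rewrite /slice_sup Linfty_leP ?lee_fin//.
split=> [[N [mN N0 hN]]|z].
  apply: (@subset_measure0 _ _ _ lam _ N) => // x /= ax; apply: hN => /=.
  rewrite lee_fin ger0_norm// => hx; by rewrite ltNge hx in ax.
by exists [set x | a < h (x, y)]; split => // x /= /negP; rewrite lee_fin ger0_norm// -ltNge.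
Qed.

Lemma measurable_slice_sup : mfun_pos slice_sup.
Proof.
move=> mD; apply: (measurability _ (ErealGenOInfty.measurableE R)) => // _ [_ [a ->] <-].
have [a0|a0] := ltP a 0.
  rewrite (_ : _ `&` _ = `]0%R, +oo[%classic)//; apply/setIidl => y _ /=.
  by rewrite in_itv /= andbT (lt_le_trans _ (Lnorm_ge0 _ _ _))// lte_fin.
pose g (y : R) := (\int[lam]_x (a < h (x, y))%R%:R%:E)%E.
have mg : mfun_pos g.
  apply: (@measurable_int_slice2 _ (fun x => (a < h x)%R%:R%:E)) => //.
  apply/measurable_EFinP.
  apply: (@measurableT_comp _ _ _ _ _ _ (fun b : bool => b%:R : R)) => //.
  by apply: measurable_fun_ltr.
rewrite (_ : _ `&` _ = `]0%R, +oo[%classic `&` [set y | (0 < g y)%E]).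
  exact: emeasurable_fun_o_infty.
have D0 (y : R) : y \in `]0, +oo[ -> 0 < y by rewrite in_itv /= andbT.
apply/seteqP; split=> y [] /= y0 z; split=> //=.
  move: z; rewrite in_itv /= andbT => z.
  rewrite lt0e integral_ge0// andbT; apply/eqP => e.
  by have := (slice_sup_leP (D0 _ y0) a0).2 e; rewrite leNgt z.
rewrite in_itv /= andbT ltNge; apply/negP => e.
have e0 : g y = 0%E := (slice_sup_leP (D0 _ y0) a0).1 e.
by rewrite e0 ltxx in z.
Qed.

(* Equal to [slice_sup y] for almost every [y], where the latter is finite. *)
Definition msup (y : R) : R := fine (slice_sup y).

Lemma msup_ge0 y : 0 <= msup y.
Proof. by apply: fine_ge0; exact: Lnorm_ge0. Qed.

Lemma measurable_msup : mfun_pos msup.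
Proof. by apply: measurableT_comp => //; exact: measurable_slice_sup. Qed.

Lemma slice_sup_sq_ge0 y : (0 <= slice_sup y ^+ 2)%E.
Proof. exact: mule_ge0 (Lnorm_ge0 _ _ _) (Lnorm_ge0 _ _ _). Qed.

Lemma msup_sq_le y : 0 < y -> ((y * msup y ^+ 2)%:E <= y%:E * slice_sup y ^+ 2)%E.
Proof.
move=> y0; rewrite EFinM; apply: lee_wpmul2l; first by rewrite lee_fin ltW.
rewrite /msup; have : (0 <= slice_sup y)%E by exact: Lnorm_ge0.
case: (slice_sup y) => //= _.
by rewrite mulyy leey.
Qed.

Hypothesis hfin : (\int[lam]_(y in `]0%R, +oo[) (y%:E * slice_sup y ^+ 2) < +oo)%E.

(** The finite integral makes [slice_sup] finite at almost every height, where [fine] changes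
    nothing. There the slice of the set where [h] exceeds [msup] is null, and Tonelli's theorem
    concludes. *)
Lemma le_msup_ae : {ae mu, forall x, H x -> h x <= msup x.2}.
Proof.
have mm : mfun_half (fun x => msup x.2).
  exact: measurable_sndH measurable_msup.
pose f (x : R * R) : R := (msup x.2 < h x)%R%:R.
have mf : mfun_half f.
  apply: (@measurableT_comp _ _ _ _ _ _ (fun b : bool => b%:R : R)) => //.
  by apply: measurable_fun_ltr.
have mE : mfun_pos (fun y => y%:E * slice_sup y ^+ 2)%E.
  apply: emeasurable_funM; first exact/measurable_EFinP.
  by apply: emeasurable_funM; exact: measurable_slice_sup.
have mI : measurable (`]0%R, +oo[%classic : set (measurableTypeR R)) by exact: measurable_itv.
have int : lam.-integrable (`]0%R, +oo[%classic : set (measurableTypeR R))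
    (fun y => y%:E * slice_sup y ^+ 2)%E.
  apply/integrableP; split=> //; apply: le_lt_trans hfin.
  rewrite le_eqVlt; apply/orP; left; apply/eqP; apply: eq_integral => y.
  rewrite inE /= in_itv /= andbT => y0; rewrite gee0_abs//.
  by apply: mule_ge0; [rewrite lee_fin ltW|exact: slice_sup_sq_ge0].
have i0 : (\int[mu]_(x in H) (f x ^+ 2)%:E = 0)%E.
  rewrite tonelli_H; last 2 first.
  - by apply/measurable_EFinP; exact: measurable_funX.
  - by move=> x _; rewrite lee_fin sqr_ge0.
  rewrite (@ae_eq_integral _ _ _ lam `]0%R, +oo[%classic (cst 0%E))//; last 2 first.
  - apply: (@measurable_int_slice2 _ (fun x => (f x ^+ 2)%:E)).
      by apply/measurable_EFinP; exact: measurable_funX.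
    by move=> x _; rewrite lee_fin sqr_ge0.
  - have [N [mN N0 hN]] := @integrable_ae _ _ _ lam _ mI _ int.
    exists N; split=> //; apply: subset_trans hN; apply: subsetC => y /= hy y0; have {}hy := hy y0.
    have y00 : 0 < y by move: y0; rewrite /= in_itv /= andbT.
    have sf : slice_sup y = (msup y)%:E.
      rewrite /msup; have : (0 <= slice_sup y)%E by exact: Lnorm_ge0.
      move: hy; case: (slice_sup y) => [r| |]//=.
      by rewrite mulyy gt0_muley ?lte_fin.
    have := (slice_sup_leP y00 (msup_ge0 y)).1; rewrite sf lexx => /(_ isT) <-.
    apply: eq_integral => x _; rewrite /f; by case: (_ < _); rewrite ?expr1n ?expr0n.
  by rewrite integral_cst// mul0e.
have If : inL2 f by split=> //; rewrite i0 ltry.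
have : ip f f = 0 by have := ipE mH If; rewrite i0 => /esym[].
move=> /(ip0_ae If) hf; apply: aeS hf => x hx Hx; have := hx Hx; rewrite /f leNgt.
by case: (_ < _) => // /eqP; rewrite oner_eq0.
Qed.

End SliceSup.

(** * The pointwise majorant under the integrability condition *)

Section SmallSliceSup.
Context {R : realType}.
Notation mu := (lebesgue_plane R).
Notation lam := (@lebesgue_measure R).
Notation H := (@half_plane R).
Notation ip := (inner mu H).
Let mH := @measurable_half_plane R.

Lemma dominated_slice_sup (v : vfield R) :
  (forall i, mfun_half (v i)) ->
  (X_norm_sq v `^ 2^-1 < 1)%E -> dominated v.
Proof.
move=> mv hX.
have X0 : (0 <= X_norm_sq v)%E.
  apply: integral_ge0 => y; rewrite /= in_itv /= andbT => y0.
  apply: mule_ge0; first by rewrite lee_fin ltW.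
  exact: mule_ge0 (Lnorm_ge0 _ _ _) (Lnorm_ge0 _ _ _).
have X1 : (X_norm_sq v <= 1)%E.
  move: X0 hX; case: (X_norm_sq v) => [r| |]//.
    rewrite lee_fin poweR_EFin lte_fin => r0; rewrite powR12_sqrt// => r1.
    rewrite lee_fin -(sqr_sqrtr r0); apply: exprn_ile1; [exact: sqrtr_ge0|exact: ltW].
  by rewrite poweRyr ?invr_eq0.
have mh := measurable_field_norm mv.
have h0 x : 0 <= field_norm v x by exact: sqrtr_ge0.
have hfin : (\int[lam]_(y in `]0%R, +oo[) (y%:E * slice_sup (field_norm v) y ^+ 2) < +oo)%E.
  by apply: le_lt_trans X1 _; rewrite ltry.
have mm := measurable_msup mh h0.
have im : (\int[lam]_(y in `]0%R, +oo[) (y * msup (field_norm v) y ^+ 2)%:E <= 1)%E.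
  apply: le_trans X1; apply: ge0_le_integral => //.
  - move=> y; rewrite /= in_itv /= andbT => y0.
    by rewrite lee_fin mulr_ge0 ?sqr_ge0 ?ltW.
  - apply/measurable_EFinP; apply: measurable_funM => //; exact: measurable_funX.
  - apply: emeasurable_funM; first exact/measurable_EFinP.
    by apply: emeasurable_funM; exact: measurable_slice_sup.
  - by move=> y; rewrite /= in_itv /= andbT => y0; exact: msup_sq_le.
exists (msup (field_norm v)), 1; split=> //.
- by move=> y; exact: msup_ge0.
- split=> //; first exact: measurable_sndH.
  move=> f tff; apply: le_trans (tf_weight mm tff) _.
  (* In this case the multiplier constant is 1, relaxed to the common value 5/4. *)
  apply: (@le_trans _ _ (1 * (ip (partial 1 f) (partial 1 f))%:E)%E).
    by apply: lee_wpmul2r => //; rewrite lee_fin ip_ge0.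
  rewrite mul1e lee_fin ler_peMl ?ip_ge0//; lra.
- move=> X X1'.
  have sub : [set` `[1%R, X]] `<=` [set` `]0%R, +oo[].
    by move=> y /=; rewrite !in_itv /= andbT => /andP[y1 _]; exact: lt_le_trans y1.
  have m1 : measurable_fun (`[1%R, X]%classic : set (measurableTypeR R)) (fun y => y * msup (field_norm v) y ^+ 2).
    apply: measurable_funM => //; apply: measurable_funX; exact: measurable_funS mm.
  have m2 : measurable_fun (`[1%R, X]%classic : set (measurableTypeR R)) (fun y => y^-1).
    apply: subspace_continuous_measurable_fun => //.
    apply: continuous_in_subspaceT => y; rewrite inE /= in_itv /= => /andP[y1 _].
    by apply: inv_continuous; rewrite gt_eqF// (lt_le_trans ltr01).
  (* For s >= 0 one has s <= 1 / y + y s^2, so the integral over [[1, X]] is at most ln X plus the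
     integral assumed to be at most 1. *)
  apply: (@le_trans _ _ (\int[lam]_(y in `[1%R, X]) ((y^-1)%:E + (y * msup (field_norm v) y ^+ 2)%:E))%E).
    apply: ge0_le_integral => //.
    + by move=> y _; rewrite lee_fin msup_ge0.
    + by apply/measurable_EFinP; exact: measurable_funS mm.
    + by apply: emeasurable_funD; apply/measurable_EFinP.
    move=> y; rewrite /= in_itv /= => /andP[y1 _]; rewrite -EFinD lee_fin.
    have y0 : 0 < y by exact: lt_le_trans y1.
    set s := msup _ y; have s0 : 0 <= s by exact: msup_ge0.
    rewrite -subr_ge0 (_ : _ - _ = y^-1 * ((y * s - 1) ^+ 2 + y * s)).
      by rewrite mulr_ge0 ?invr_ge0 ?(ltW y0)// addr_ge0 ?sqr_ge0// mulr_ge0 ?(ltW y0).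
    by field; rewrite gt_eqF.
  rewrite ge0_integralD//; last 4 first.
  + by move=> y; rewrite /= in_itv /= => /andP[y1 _]; rewrite lee_fin invr_ge0 (le_trans ler01).
  + exact/measurable_EFinP.
  + move=> y; rewrite /= in_itv /= => /andP[y1 _]; rewrite lee_fin mulr_ge0 ?sqr_ge0//.
    exact: le_trans y1.
  + exact/measurable_EFinP.
  rewrite (integral_inv X1') mul1r (addrC 1) (EFinD (logsq X)).
  apply: leeD; first by rewrite lee_fin; exact: ln_le_logsq.
  apply: le_trans im; apply: ge0_subset_integral => //.
  + apply/measurable_EFinP; apply: measurable_funM => //; exact: measurable_funX.
  + by move=> y; rewrite /= in_itv /= andbT => y0; rewrite lee_fin mulr_ge0 ?sqr_ge0 ?ltW.
apply: aeS (le_msup_ae mh h0 hfin) => x hx Hx; rewrite -field_norm_sq.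
by apply: lerXn2r; rewrite ?nnegrE ?msup_ge0// hx.
Qed.

End SmallSliceSup.

(** * The hypotheses of the theorem in terms of scalar products, and the conclusion *)

Section Reformulation.
Context {R : realType}.
Notation mu := (lebesgue_plane R).
Notation H := (@half_plane R).
Notation ip := (inner mu H).
Notation inL2 := (inL2 mu H).
Let mH := @measurable_half_plane R.

Lemma appr_inL2 phi (v : vfield R) G : appr phi v G -> forall i j, inL2 (G i j).
Proof. by move=> ap i j; have [] := appr_grad ap i j. Qed.

Lemma weak_solution_weak_eq F (v : vfield R) phi :
  (forall i j, inL2 (F i j)) ->
  appr phi v (fun i j => weak_partial j (v i)) -> weak_solution F v ->
  weak_eq F v (fun i j => weak_partial j (v i)).
Proof.
move=> IF ap [_ ws] chi schi; apply: weak_form_ip => //.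
- exact: appr_inL2 ap.
- by move=> j; have [] := appr_weight j ap (@weightp_inv2 R).
by apply: ws; exact/stfP.
Qed.

Lemma energy_le_ip F (G : 'I_2 -> vfield R) :
  (forall i j, inL2 (F i j)) -> (forall i j, inL2 (G i j)) ->
  \int[mu]_(x in H) (\sum_(i < 2) \sum_(j < 2) G i j x ^+ 2) <=
    \sum_(i < 2) \int[mu]_(x in H) (\sum_(j < 2) G i j x * F i j x) ->
  energy_le F G.
Proof.
move=> IF IG.
have I1 i j := inL2_mul mH (IG i j) (IG i j).
have I2 i j := inL2_mul mH (IG i j) (IF i j).
have e1 : \int[mu]_(x in H) (\sum_(i < 2) \sum_(j < 2) G i j x ^+ 2) =
   sum4 (fun i j => ip (G i j) (G i j)).
  rewrite /sum4 /inner -(RintegralD mH (I1 0 0) (I1 0 1)) -(RintegralD mH (I1 1 0) (I1 1 1)).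
  rewrite -(RintegralD mH (integrableDR (I1 0 0) (I1 0 1)) (integrableDR (I1 1 0) (I1 1 1))).
  by apply: eq_Rintegral => x _; rewrite !sum2 !expr2.
have e2 i : \int[mu]_(x in H) (\sum_(j < 2) G i j x * F i j x) =
   ip (F i 0) (G i 0) + ip (F i 1) (G i 1).
  rewrite (ipC _ _ (F i 0)) (ipC _ _ (F i 1)) /inner -(RintegralD mH (I2 i 0) (I2 i 1)).
  by apply: eq_Rintegral => x _; rewrite sum2.
by rewrite sum2 (e2 0) (e2 1) e1.
Qed.

Lemma small_dominated (v : vfield R) :
  (forall i, mfun_half (v i)) ->
  (exists i : 'I_3,
     let w := fun x => omega i x `^ 2^-1 in
     weighted_Linfty w v /\ (weighted_Linfty_norm w v < (1 / 4)%:E)%E) \/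
  (X_space v /\ (X_norm_sq v `^ 2^-1 < 1)%E) -> dominated v.
Proof.
move=> mv [[i [_ h]]|[_ h]]; first exact: dominated_weighted h.
exact: dominated_slice_sup.
Qed.

End Reformulation.

Theorem theorem1p3 (R : realType) (F : 'I_2 -> 'I_2 -> R * R -> R)
    (ubar : 'I_2 -> R * R -> R)
    (F_L2 : forall i j, L2 (F i j))
    (ubar_sol : weak_solution F ubar)
    (ubar_energy : energy_inequality F ubar)
    (ubar_small :
      (exists i : 'I_3,
         let w := fun x => omega i x `^ 2^-1 in
         weighted_Linfty w ubar /\
         (weighted_Linfty_norm w ubar < (1 / 4)%:E)%E) \/
      (X_space ubar /\ (X_norm_sq ubar `^ 2^-1 < 1)%E)) :
  forall u : 'I_2 -> R * R -> R,
    weak_solution F u -> energy_inequality F u ->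
    forall i, u i = ubar i %[ae lebesgue_plane R in half_plane].
Proof.
move=> u u_sol u_energy i.
have IF i' j := L2_inL2 (F_L2 i' j).
have [phi ab] := H1dot0sigma_appr ubar_sol.1.
have [psi au] := H1dot0sigma_appr u_sol.1.
have [m [C0 [mm m0 wm gm vm]]] := small_dominated (appr_meas ab) ubar_small.
(* Only [ubar] is replaced by its truncation. The weak gradients stay those of the original fields,
   so both energy inequalities apply unchanged. *)
have wb := weak_eq_truncation mm vm ab (weak_solution_weak_eq IF ab ubar_sol).
have wu := weak_solution_weak_eq IF au u_sol.
have eb := energy_le_ip IF (appr_inL2 ab) ubar_energy.
have eu := energy_le_ip IF (appr_inL2 au) u_energy.
have h := unique_ae IF mm m0 wm gm (appr_truncation mm vm ab)
  (fun x _ => truncation_le m ubar x) au wb wu eb eu i.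
by apply: aeS2 h (truncation_ae vm i) => x ex bx Hx; rewrite ex// bx.
Qed.
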